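(* Let $f:M\to N$ be a smooth map between Riemannian manifolds, and let $(\mathcal{M}_n)_{n\in\mathbb{N}}$ be a fine and crystalline sequence of geodesic meshes on $M$, with mesh sizes $r=r_n$. Suppose the underlying graphs $\mathcal{G}_n$ are equipped with systems of positive vertex and edge weights. Let $f_n$ denote the restriction of $f$ to the vertex set of $\mathcal{G}_n$. Then $$e_{\mathcal{G}_n}(f_n)=e(f)+O(r^2)$$ on the set of vertices where $\mathcal{G}_n$ is Laplacian. Here the $O(r^2)$ is independent of $n$, depends on $f$, and is locally uniform: for every compact set $K\subseteq M$ there are $C>0$ and $n_0$ such that $|e_{\mathcal{G}_n}(f_n)_x-e(f)_x|\le C r_n^2$ for all $n\ge n_0$ and all vertices $x\in K$ of $\mathcal{G}_n$ at which the weights are Laplacian (if $M$ is compact one may take $K=M$).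
   Context: Manifolds are smooth, connected and complete. A geodesic mesh on $M$ is a triangulation of $M$ whose edges are embedded geodesic segments; its underlying graph is its $1$-skeleton; $x\sim y$ means adjacent; $\overrightarrow{xy}:=\exp_x^{-1}(y)$. Weights are denoted $\mu_x>0$ (vertices) and $\omega_{xy}>0$ (edges), their dependence on $n$ being omitted. The mesh size $r_n$ is the longest edge length of $\mathcal{M}_n$. Fine: $r_n\to0$. Crystalline: there is a uniform positive lower bound for the thickness of all simplices of all $\mathcal{M}_n$, where the thickness of $D$ is the distance from its center of mass to its boundary, divided by its diameter. The weights are Laplacian (to third order) at a vertex $x$ if for every $L\in T_x^*M$: (1) $\frac1{\mu_x}\sum_{y\sim x}\omega_{xy}\overrightarrow{xy}=0$; (2) $\frac1{\mu_x}\sum_{y\sim x}\omega_{xy}L(\overrightarrow{xy})^2=2\|L\|^2$; (3) $\frac1{\mu_x}\sum_{y\sim x}\omega_{xy}L(\overrightarrow{xy})^3=0$. The energy density is $e(f)=\frac12\|df\|^2$, and the discrete energy density is $e_{\mathcal{G}_n}(f_n)_x=\frac1{4\mu_x}\sum_{y\sim x}\omega_{xy}\,d_N(f(x),f(y))^2$. *)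

(* Defs.v *)
From HB Require Import structures.
From mathcomp Require Import all_boot all_order all_algebra.
From mathcomp Require Import all_classical all_reals all_analysis.

Set Implicit Arguments.
Unset Strict Implicit.
Unset Printing Implicit Defensive.
Import Order.TTheory GRing.Theory Num.Theory.
Import numFieldNormedType.Exports.

Local Open Scope classical_set_scope.
Local Open Scope ring_scope.

Section Calculus.
Context {R : realType}.

Definition partial {m} {V : normedModType R} (i : 'I_m)
    (F : 'rV[R]_m -> V) (z : 'rV[R]_m) : V :=
  'D_(delta_mx 0 i) F z.

Fixpoint Ck_on {m} {V : normedModType R} (k : nat) (U : set 'rV[R]_m)
    (F : 'rV[R]_m -> V) : Prop :=
  (forall z, U z -> {for z, continuous F}) /\
  (if k is k'.+1 then
     forall i : 'I_m,
       (forall z, U z -> derivable F z (delta_mx 0 i)) /\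
       Ck_on k' U (partial i F)
   else True).

(* Only meaningful for open U. *)
Definition smooth_on {m} {V : normedModType R} (U : set 'rV[R]_m)
    (F : 'rV[R]_m -> V) : Prop :=
  forall k, Ck_on k U F.

(* Row-vector convention, as in the library's [jacobian]: the differential of
   F at z maps v to v *m jac F z. *)
Definition jac {m p} (F : 'rV[R]_m -> 'rV[R]_p) (z : 'rV[R]_m) :
    'M[R]_(m, p) :=
  \matrix_(i < m, j < p) partial i F z 0 j.

End Calculus.

Record chart (R : realType) (m : nat) (M : topologicalType) := Chart {
  cdom : set M;
  cmap : M -> 'rV[R]_m;
  cinv : 'rV[R]_m -> M;
  cdom_open : open cdom;
  cimg_open : open (cmap @` cdom);
  cmapK : forall x, cdom x -> cinv (cmap x) = x;
  cmap_cont : forall x, cdom x -> {for x, continuous cmap};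
  cinv_cont : forall z, (cmap @` cdom) z -> {for z, continuous cinv} }.

(* A tangent vector at x is represented by its coordinates in the preferred
   chart [chart_at x], so that T_xM is identified with 'rV[R]_m; accordingly
   [metric x] is the Gram matrix of the metric at x in that chart. *)
Definition gram_of (R : realType) (m : nat) (M : topologicalType)
    (chart_at : M -> chart R m M) (g : M -> 'M[R]_m)
    (a : chart R m M) (z : 'rV[R]_m) : 'M[R]_m :=
  let x := cinv a z in
  let J := jac (cmap (chart_at x) \o cinv a) z in
  J *m g x *m J^T.

Record riemannian (R : realType) (m : nat) := Riemannian {
  rspace :> ptopologicalType;
  rspace_hausdorff : hausdorff_space rspace;
  rspace_second_countable : @second_countable rspace;
  rspace_connected : connected [set: rspace];
  atlas : set (chart R m rspace);
  chart_at : rspace -> chart R m rspace;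
  chart_at_atlas : forall x, atlas (chart_at x);
  chart_at_dom : forall x, cdom (chart_at x) x;
  transition_smooth : forall a b, atlas a -> atlas b ->
    smooth_on (cmap a @` (cdom a `&` cdom b)) (cmap b \o cinv a);
  metric : rspace -> 'M[R]_m;
  metric_sym : forall x, (metric x)^T = metric x;
  metric_pos : forall x (v : 'rV[R]_m), v != 0 ->
    0 < (v *m metric x *m v^T) 0 0;
  metric_smooth : forall a, atlas a ->
    smooth_on (cmap a @` cdom a) (gram_of chart_at metric a) }.

Arguments atlas {R m} _ _.

Section RiemannianGeometry.
Context {R : realType} {m : nat} {M : riemannian R m}.
Implicit Types (x y : M) (a : chart R m M) (c : R -> M) (A : set M).

Definition gram a : 'rV[R]_m -> 'M[R]_m :=
  gram_of (@chart_at R m M) (@metric R m M) a.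

Definition tnorm x (v : 'rV[R]_m) : R :=
  Num.sqrt ((v *m metric x *m v^T) 0 0).

(* A covector acts on a tangent vector v by v |-> (v *m L) 0 0. *)
Definition conorm x (L : 'cV[R]_m) : R :=
  Num.sqrt ((L^T *m invmx (metric x) *m L) 0 0).

Definition in_chart a c : R -> 'rV[R]_m := cmap a \o c.

Definition velocity c (t : R) : 'rV[R]_m :=
  derive1 (in_chart (chart_at (c t)) c) t.

Definition C1_curve c : Prop :=
  forall t, 0 <= t <= 1 ->
    {for t, continuous c} /\
    forall a, atlas M a -> cdom a (c t) ->
      (\forall s \near t, derivable (in_chart a c) s 1) /\
      {for t, continuous (derive1 (in_chart a c))}.

Definition curve_length c : R :=
  (\int[lebesgue_measure]_(t in `[0, 1]) tnorm (c t) (velocity c t))%R.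

Definition dist x y : R :=
  inf [set l | exists c, [/\ C1_curve c, c 0 = x, c 1 = y
                          & l = curve_length c]].

Definition riemannian_complete : Prop :=
  forall u : nat -> M,
    (forall e, 0 < e -> exists k, forall i j, (k <= i)%N -> (k <= j)%N ->
       dist (u i) (u j) < e) ->
    exists p, dist (u n) p @[n --> \oo] --> 0.

(* Gamma^k_{ij} of the Levi-Civita connection in the chart a *)
Definition christoffel a (z : 'rV[R]_m) (i j k : 'I_m) : R :=
  2^-1 * \sum_l invmx (gram a z) k l *
    (partial i (fun w => gram a w j l) z
     + partial j (fun w => gram a w i l) z
     - partial l (fun w => gram a w i j) z).

Definition geodesic c : Prop :=
  continuous c /\
  forall t a, atlas M a -> cdom a (c t) ->
    let u := in_chart a c in
    [/\ \forall s \near t, derivable u s 1,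
        derivable (derive1 u) t 1
      & forall k, derive1 (derive1 u) t 0 k =
          - \sum_i \sum_j christoffel a (u t) i j k
                            * derive1 u t 0 i * derive1 u t 0 j].

(* exp_x(t v) = c t. On a complete manifold every geodesic is defined on all
   of R. *)
Definition geodesic_from x (v : 'rV[R]_m) c : Prop :=
  [/\ geodesic c, c 0 = x & velocity c 0 = v].

Definition diam A : \bar R :=
  ereal_sup (0%E |` [set e | exists x y, [/\ A x, A y & e = (dist x y)%:E]]).

Definition dist_to_set x A : R := inf [set dist x y | y in A].

(* k-dimensional Hausdorff measure of the distance, without normalizing
   constant; for k > 0 only. *)
Definition hausdorff (k : nat) (A : set (g_sigma_algebraType (@open M))) :
    \bar R :=
  ereal_sup [set
    ereal_inf [set s | exists U : nat -> set M,
       [/\ A `<=` \bigcup_i U i,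
           forall i, (diam (U i) <= delta%:E)%E
         & s = (\sum_(i <oo) diam (U i) ^+ k)%E]]
  | delta in [set delta : R | 0 < delta]].

(* Second moment about p of the uniform k-dimensional mass on A *)
Definition second_moment (k : nat) A (p : M) : \bar R :=
  (\int[hausdorff k]_(y in (A : set (g_sigma_algebraType (@open M))))
     (dist p y ^+ 2)%:E)%E.

Definition center_of_mass (k : nat) A (p : M) : Prop :=
  (second_moment k A p < +oo)%E /\
  forall q, (second_moment k A p <= second_moment k A q)%E.

End RiemannianGeometry.

Arguments riemannian_complete {R m} M.

Section Triangulations.
Context {R : realType}.

(* Barycentric coordinates on the abstract simplex with vertex set s; the
   topology of pointwise convergence is the Euclidean one on this set. *)
Definition std_simplex (T : choiceType) (s : set T) : set {ptws T -> R} :=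
  [set b | [/\ forall x, 0 <= b x, forall x, ~ s x -> b x = 0
            & \sum_(x \in s) b x = 1]].

Definition std_boundary (T : choiceType) (s : set T) : set {ptws T -> R} :=
  [set b | std_simplex s b /\ exists2 x, s x & b x = 0].

End Triangulations.

(* The vertices of the abstract complex [simplices] are points of M, and
   [realize] is a homeomorphism from its geometric realization onto M, given as
   a bijection that is continuous on each simplex, the family of the cells being
   locally finite. *)
Record triangulation (R : realType) (m : nat) (M : riemannian R m) :=
  Triangulation {
  simplices : set (set M);
  simplex_finite : forall s, simplices s -> finite_set s;
  simplex_neq0 : forall s, simplices s -> s !=set0;
  simplex_face : forall s t, simplices s -> t `<=` s -> t !=set0 ->
    simplices t;
  realize : {ptws M -> R} -> M;
  realize_bij :
    set_bij (\bigcup_(s in simplices) std_simplex s) [set: M] realize;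
  realize_cont : forall s, simplices s ->
    {within std_simplex s, continuous realize};
  realize_vertex : forall x, simplices [set x] -> realize \1_[set x] = x;
  cells_locally_finite : forall p : M, exists2 U, nbhs p U &
    finite_set [set s | simplices s /\ realize @` std_simplex s `&` U !=set0]
}.

Section Meshes.
Context {R : realType} {m : nat} {M : riemannian R m}.
Implicit Types (T : triangulation M) (x y : M) (s : set M).

Definition vertex T x : Prop := simplices T [set x].

Definition adjacent T x y : Prop := x <> y /\ simplices T [set x; y].

Definition cell T s : set M := realize T @` std_simplex s.

Definition cell_boundary T s : set M := realize T @` std_boundary s.

Definition edge_geodesic T x y (c : R -> M) : Prop :=
  [/\ geodesic c, c 0 = x, c 1 = y, set_inj `[0, 1] c
    & c @` `[0, 1] = cell T [set x; y]].

Definition geodesic_mesh T : Prop :=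
  forall x y, adjacent T x y -> exists c, edge_geodesic T x y c.

(* exp_x^{-1}(y): the tangent vector v with t |-> exp_x(t v), 0 <= t <= 1,
   running along the edge from x to y. *)
Definition edge_vector T x y : 'rV[R]_m :=
  xget 0 [set v | exists2 c, geodesic_from x v c & edge_geodesic T x y c].

(* The element 0 only matters when there are no edges. *)
Definition mesh_size T : \bar R :=
  ereal_sup (0%E |` [set l | exists x y c,
    [/\ adjacent T x y, edge_geodesic T x y c & l = (curve_length c)%:E]]).

(* s has k.+1 vertices, hence its cell is k-dimensional. *)
Definition has_thickness T s (theta : R) : Prop :=
  exists k p, [/\ (s #= `I_k.+1)%card, center_of_mass k (cell T s) p
    & theta = dist_to_set p (cell_boundary T s) / fine (diam (cell T s))].

Definition fine_seq (T : nat -> triangulation M) : Prop :=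
  mesh_size (T n) @[n --> \oo] --> 0%E.

(* Thickness makes sense for simplices of positive dimension only. *)
Definition crystalline (T : nat -> triangulation M) : Prop :=
  exists2 theta0 : R, 0 < theta0 &
    forall n s, simplices (T n) s -> ~ (exists x, s = [set x]) ->
      exists2 theta, has_thickness (T n) s theta & theta0 <= theta.

Record weights T := Weights {
  vweight : M -> R;
  eweight : M -> M -> R;
  vweight_gt0 : forall x, vertex T x -> 0 < vweight x;
  eweight_gt0 : forall x y, adjacent T x y -> 0 < eweight x y;
  eweight_sym : forall x y, adjacent T x y -> eweight x y = eweight y x }.

Definition neighbors T x : set M := [set y | adjacent T x y].

Definition laplacian_at T (w : weights T) x : Prop :=
  let pair (L : 'cV[R]_m) y := (edge_vector T x y *m L) 0 0 in
  forall L : 'cV[R]_m,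
  [/\ (vweight w x)^-1 *:
        (\sum_(y \in neighbors T x) eweight w x y *: edge_vector T x y) = 0,
      (vweight w x)^-1 *
        (\sum_(y \in neighbors T x) eweight w x y * pair L y ^+ 2)
        = 2 * conorm x L ^+ 2
    & (vweight w x)^-1 *
        (\sum_(y \in neighbors T x) eweight w x y * pair L y ^+ 3) = 0].

End Meshes.

Section Energy.
Context {R : realType} {m p : nat} {M : riemannian R m} {N : riemannian R p}.
Implicit Types (f : M -> N) (x : M).

Definition smooth_map f : Prop :=
  continuous f /\
  forall a b, atlas M a -> atlas N b ->
    smooth_on (cmap a @` (cdom a `&` f @^-1` cdom b))
              (cmap b \o f \o cinv a).

Definition tangent_map f x : 'M[R]_(m, p) :=
  jac (cmap (chart_at (f x)) \o f \o cinv (chart_at x))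
      (cmap (chart_at x) x).

(* |df|^2 / 2 for the Hilbert-Schmidt norm:
   g^{ij} h_{kl} d_i f^k d_j f^l / 2 in coordinates *)
Definition energy_density f x : R :=
  2^-1 * \tr (invmx (metric x) *m
              (tangent_map f x *m metric (f x) *m (tangent_map f x)^T)).

Definition discrete_energy_density (T : triangulation M) (w : weights T)
    f x : R :=
  (4 * vweight w x)^-1 *
    \sum_(y \in neighbors T x) eweight w x y * dist (f x) (f y) ^+ 2.

End Energy.

(* Main.v *)
Require Import Defs.
From mathcomp Require Import all_boot all_order all_algebra.
From mathcomp Require Import all_classical all_reals all_analysis.
From mathcomp Require Import ring lra.
Import Order.TTheory GRing.Theory Num.Theory.
Import numFieldNormedType.Exports.
Local Open Scope classical_set_scope.
Local Open Scope ring_scope.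
Set Implicit Arguments.
Unset Strict Implicit.
Unset Printing Implicit Defensive.

(** The discrete energy density at a Laplacian vertex [x] is a weighted sum of the
    squared distances between [f x] and [f y], where [y] is the end point of the
    geodesic with initial velocity [v], the edge vector. The whole statement
    follows from one expansion, [near_edge_expansion]: locally uniformly in [x],

      dist (f x) (f y) ^ 2 = |df v| ^ 2 + (a cubic form in v) + O(|v| ^ 4).

    Summed with the weights, the quadratic term gives four times the energy
    density because the second moment of the edge vectors is twice the inverse
    metric; the cubic form gives zero because their third moments vanish, by
    polarization; the remainder is at most [C * r ^ 2] times the weighted sum of
    the [|v| ^ 2], which the second moment condition evaluates to [2 * m]. This is
    [discrete_energy_close]. Compactness of [K] makes the constant uniform.

    The expansion has two halves. On the source, geodesics have constant speed
    ([geodesic_speed_cst]), so short ones stay in a chart, and a function along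
    them has second derivative given by its covariant Hessian; [geodesic_taylor]
    expands the coordinates of [f y] up to third order in [v].

    On the target, [near_dist_expansion] compares the squared distance between two
    points of a chart with the squared norm of the vector

      xi = w + gamma (w, w) / 2,

    [w] being the difference of the coordinates and [gamma] the connection at the
    first point; the error is of fourth order in [w]. In the coordinates [xi] the
    first derivatives of the metric vanish at the first point ([dgram_gamma]), so
    that near it the metric is constant up to second order. The upper bound for the
    distance is the length of a curve that is almost straight in these coordinates
    ([short_curve_exists]). For the lower bound ([curve_length_ge]), a component of
    [xi] has gradient of norm at most [1 + O(|w| ^ 2)] and can be integrated along
    an arbitrary curve, stopped when it leaves a ball of radius comparable to [|w|].

    Quantitative statements near a point are mostly of the form [P C] for all large
    [C], where [C] serves at once as a bound and as the inverse of a radius, so that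
    finitely many of them share a constant. *)

(** * Functions of one real variable *)

Section OneVariable.
Context {R : realType}.
Implicit Types (f df : R -> R).

Lemma mvt_from0 f df (T : R) : 0 <= T ->
  (forall t : R, 0 <= t <= T -> is_derive t 1 f (df t)) ->
  exists2 s, 0 <= s <= T & f T - f 0 = df s * T.
Proof.
move=> T0 fd.
have [c| |c] := @MVT_segment R f df 0 T T0.
- by rewrite in_itv/= => /andP[/ltW c0 /ltW cT]; apply: fd; rewrite c0 cT.
- apply: continuous_in_subspaceT => t.
  rewrite inE/= in_itv/= => /fd [dft _].
  exact/differentiable_continuous/derivable1_diffP.
- by rewrite in_itv/= subr0 => c01 ->; exists c.
Qed.

Lemma norm_le_of_derive f df (B T : R) : 0 <= T ->
  (forall t : R, 0 <= t <= T -> is_derive t 1 f (df t)) ->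
  (forall t, 0 <= t <= T -> `|df t| <= B) ->
  forall t, 0 <= t <= T -> `|f t - f 0| <= B * t.
Proof.
move=> T0 fd dfB t /andP[t0 tT].
have [s /andP[s0 st] ->] := @mvt_from0 f df t t0
  (fun s Hs => fd s (introT andP
     (conj (andP Hs).1 (le_trans (andP Hs).2 tT)))).
rewrite normrM (ger0_norm t0) ler_wpM2r// dfB//.
by rewrite s0 (le_trans st).
Qed.

(** Integrating [|f'' t - f'' 0| <= B] twice. *)
Lemma taylor2_of_derive2_close f f1 f2 (B : R) :
  (forall t : R, 0 <= t <= 1 -> is_derive t 1 f (f1 t)) ->
  (forall t : R, 0 <= t <= 1 -> is_derive t 1 f1 (f2 t)) ->
  (forall t, 0 <= t <= 1 -> `|f2 t - f2 0| <= B) ->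
  `|f 1 - f 0 - f1 0 - 2^-1 * f2 0| <= B.
Proof.
move=> d1 d2 f2B.
have B0 : 0 <= B by rewrite (le_trans _ (f2B 0 _))// lexx ler01.
pose g (t : R) := f1 t - t * f2 0.
have gd (t : R) : 0 <= t <= 1 -> is_derive t 1 g (f2 t - f2 0).
  move=> /d2 ?; rewrite /g.
  apply: is_derive_eq; rewrite !scaler0 add0r.
  by rewrite /GRing.scale/= mulr1.
have g_close := norm_le_of_derive ler01 gd f2B.
pose h (t : R) := f t - t * f1 0 - 2^-1 * t ^+ 2 * f2 0.
have hd (t : R) : 0 <= t <= 1 -> is_derive t 1 h (g t - g 0).
  move=> /d1 ?; rewrite /h /g.
  apply: is_derive_eq; rewrite !scaler0 !add0r /GRing.scale/=.
  by rewrite /GRing.exp/=; field.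
have : `|h 1 - h 0| <= B * 1.
  apply: (norm_le_of_derive ler01 hd); last by rewrite ler01 lexx.
  move=> t t01; rewrite (le_trans (g_close t t01))// ler_piMr//.
  by case/andP: t01.
rewrite /h !mul0r expr0n/= mulr0 mul0r !subr0 expr1n mulr1 mul1r.
by move: (f 1) (f 0) (f1 0) => a b c; rewrite [a - c - _ - b](_ : _ = a - b - c - 2^-1 * f2 0) ?mulr1//; ring.
Qed.

End OneVariable.

(** * Increments of functions of several variables *)

Section RowVectors.
Context {R : realType} {m : nat}.
Implicit Types (v w : 'rV[R]_m) (f : 'rV[R]_m -> R).

Lemma coord_norm v i : `|v 0 i| <= `|v|.
Proof.
rewrite [leRHS]/Num.Def.normr/= mx_normrE.
exact: (le_bigmax _ (fun ij : 'I_1 * 'I_m => `|v ij.1 ij.2|) (0, i)).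
Qed.

Lemma rV_norm_le v (B : R) : 0 <= B -> (forall i, `|v 0 i| <= B) -> `|v| <= B.
Proof.
move=> B0 vB; rewrite [leLHS]/Num.Def.normr/= mx_normrE.
by apply: bigmax_le => // -[i j] _ /=; rewrite ord1.
Qed.

Lemma rV_norm_lt v (B : R) : 0 < B -> (forall i, `|v 0 i| < B) -> `|v| < B.
Proof.
move=> B0 vB; rewrite [ltLHS]/Num.Def.normr/= mx_normrE.
by apply: bigmax_lt => // -[i j] _ /=; rewrite ord1.
Qed.

Lemma is_derive_line f v y (t : R) : derivable f (y + t *: v) v ->
  is_derive t 1 (fun s => f (y + s *: v)) ('D_v f (y + t *: v)).
Proof.
move=> fd.
have E : (fun h : R => h^-1 *: (f (y + (h *: 1 + t) *: v) - f (y + t *: v)))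
  = (fun h : R => h^-1 *: (f (h *: v + (y + t *: v)) - f (y + t *: v))).
  by apply/funext => h; congr (_ *: (f _ - _));
    rewrite scalerDl [h *: 1]mulr1 addrCA.
split; first by move: fd; rewrite /derivable /= E.
by rewrite /derive /= E.
Qed.

Lemma is_derive_scaled_line f v y (c t : R) :
  derivable f (y + t *: (c *: v)) v ->
  is_derive t 1 (fun s => f (y + s *: (c *: v)))
    (c * 'D_v f (y + t *: (c *: v))).
Proof.
rewrite !scalerA => /is_derive_line fd.
have -> : (fun s => f (y + s *: (c *: v)))
    = (fun s => f (y + s *: v)) \o (fun s : R => s * c).
  by apply/funext => s /=; rewrite scalerA.
have sd : is_derive t 1 (fun s : R => s * c) c.
  by apply: is_derive_eq; rewrite scaler0 add0r [_ *: _]mulr1.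
by have := is_derive1_comp; move=> /(_ _ _ (fun s : R => s * c) _ _ _ fd sd); rewrite mulrC.
Qed.

(** Mean value theorem along a path of [m] segments parallel to the axes; the
    norm is the maximum norm, so the path does not leave a ball that contains
    its end points. *)
Lemma increment f z (d : R) :
  (forall y, `|y - z| < d -> forall i, derivable f y (delta_mx 0 i)) ->
  forall z1 z2, `|z1 - z| < d -> `|z2 - z| < d ->
  exists zeta : 'I_m -> 'rV[R]_m,
    (forall i, `|zeta i - z| < d /\ `|zeta i - z1| <= `|z2 - z1|) /\
    f z2 - f z1 = \sum_i (z2 - z1) 0 i * partial i f (zeta i).
Proof.
move=> fd z1 z2 z1d z2d.
have d0 : 0 < d by exact: le_lt_trans z1d.
pose mix (k : nat) (t : R) : 'rV[R]_m :=
  \row_j (z1 0 j + ((j < k)%:R + (j == k :> nat)%:R * t) * (z2 - z1) 0 j).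
have mixP k t : 0 <= t <= 1 ->
    `|mix k t - z| < d /\ `|mix k t - z1| <= `|z2 - z1|.
  move=> /andP[t0 t1].
  have s01 (j : 'I_m) : (0 : R) <= (j < k)%:R + (j == k :> nat)%:R * t <= 1.
    by case: ltngtP => _ /=; rewrite ?mul0r ?mul1r ?addr0 ?add0r ?t0 ?t1 ?lexx ?ler01.
  split.
    apply: rV_norm_lt => // j; rewrite !mxE; set s := (_ + _ * t).
    have /andP[s0 s1] : 0 <= s <= 1 by exact: s01.
    have a1 := le_lt_trans (coord_norm (z1 - z) j) z1d.
    have a2 := le_lt_trans (coord_norm (z2 - z) j) z2d.
    move: a1 a2; rewrite !mxE !ltr_norml => /andP[a1 a1'] /andP[a2 a2'].
    have [->|s_ne0] := eqVneq s 0; first by apply/andP; split; lra.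
    have sp : 0 < s by rewrite lt0r s_ne0.
    by apply/andP; split; nra.
  apply: rV_norm_le => // j; rewrite !mxE; set s := (_ + _ * t).
  have /andP[s0 s1] : 0 <= s <= 1 by exact: s01.
  rewrite addrAC subrr add0r normrM ger0_norm//.
  have := coord_norm (z2 - z1) j; rewrite !mxE => /(le_trans _); apply.
  by rewrite ler_piMl.
have mixE (i : 'I_m) t :
    mix i t = mix i 0 + t *: ((z2 - z1) 0 i *: delta_mx 0 i).
  apply/rowP => j; rewrite !mxE eqxx/= -val_eqE/=.
  case: (altP eqP) => [/val_inj->|_]; last by rewrite !mul0r !mulr0 !addr0.
  by rewrite mulr1 mulr0 addr0 mul1r mulrDl addrA.
have step (i : 'I_m) : exists y, (`|y - z| < d /\ `|y - z1| <= `|z2 - z1|) /\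
    f (mix i.+1 0) - f (mix i 0) = (z2 - z1) 0 i * partial i f y.
  have [|s s01 E] := @mvt_from0 R (fun t => f (mix i t))
     (fun t => (z2 - z1) 0 i * partial i f (mix i t)) 1 ler01.
    move=> t t01; rewrite (_ : (fun t => _) =
      (fun t => f (mix i 0 + t *: ((z2 - z1) 0 i *: delta_mx 0 i)))); last first.
      by apply/funext => s; rewrite (mixE i s).
    rewrite (mixE i t); apply: is_derive_scaled_line.
    by apply: fd; rewrite -(mixE i t); case: (mixP i t t01).
  exists (mix i s); split; first exact: mixP.
  rewrite -[RHS]mulr1 -E; congr (f _ - _); apply/rowP => j; rewrite !mxE.
  rewrite ltnS leq_eqVlt; case: (ltngtP j i) => /= _;
    by rewrite ?mulr0 ?mulr1 ?addr0 ?add0r.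
have [zeta zetaP] := choice step.
exists zeta; split=> [i|]; first by case: (zetaP i).
rewrite -(eq_bigr _ (fun i _ => (zetaP i).2)).
rewrite -(big_mkord predT (fun k => f (mix k.+1 0) - f (mix k 0))).
rewrite telescope_sumr//; congr (f _ - f _); apply/rowP => j; rewrite !mxE.
  by rewrite ltn_ord mulr0 addr0 mul1r addrCA subrr addr0.
by rewrite ltn0 mulr0 addr0 mul0r addr0.
Qed.

End RowVectors.

(** * Chain rule and locally Lipschitz functions *)

Section LocalCalculus.
Context {R : realType} {m : nat}.
Implicit Types (f g : 'rV[R]_m -> R) (z : 'rV[R]_m).

Lemma near_norm (V : normedModType R) (x : V) (P : V -> Prop) :
  (\forall y \near x, P y) <-> exists2 d : R, 0 < d & forall y, `|y - x| < d -> P y.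
Proof.
split=> [/nbhs_normP[d /= d0 dP]|[d d0 dP]].
  by exists d => // y yx; apply: dP; rewrite /= distrC.
by apply/nbhs_normP; exists d => //= y /=; rewrite distrC => /dP.
Qed.

Lemma near_ge (r : R) : \forall x \near +oo, r <= x.
Proof. by apply: nbhs_pinfty_ge; rewrite num_real. Qed.

Definition C1_near f z : Prop :=
  \forall y \near z, forall i : 'I_m,
    derivable f y (delta_mx 0 i) /\ {for y, continuous (partial i f)}.

(** The difference quotient of [f \o u] is a combination of those of the
    coordinates of [u], with weights that converge by continuity of the partial
    derivatives. *)
Lemma is_derive_chain f (u : R -> 'rV[R]_m) (t : R) :
  C1_near f (u t) -> derivable u t 1 ->
  is_derive t 1 (f \o u) (\sum_i (derive1 u t) 0 i * partial i f (u t)).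
Proof.
move=> /near_norm[d d0 fd] ud.
have ucont : {for t, continuous u}.
  exact/differentiable_continuous/derivable1_diffP.
have /choice[zeta zetaP] : forall h : R, exists zeta : 'I_m -> 'rV[R]_m,
    `|u (h *: 1 + t) - u t| < d ->
    (forall i, `|zeta i - u t| <= `|u (h *: 1 + t) - u t|) /\
    f (u (h *: 1 + t)) - f (u t) =
      \sum_i (u (h *: 1 + t) - u t) 0 i * partial i f (zeta i).
  move=> h; have [hd|] := boolP (`|u (h *: 1 + t) - u t| < d); last first.
    by exists (fun=> 0).
  have [y yd i|||zeta [z1 z2]] := @increment _ _ f (u t) d _ (u t) (u (h *: 1 + t)).
  - by case: (fd y yd i).
  - by rewrite subrr normr0.
  - by [].
  by exists zeta => _; split=> // i; case: (z1 i).
have ht0 : (h *: 1 + t : R) @[h --> 0^'] --> t.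
  rewrite -[X in _ --> X]add0r; apply: cvgD; last exact: cvg_cst.
  rewrite -[X in _ --> X](scale0r (1 : R)).
  by apply: cvgZr_tmp; apply: cvg_within_filter; exact: cvg_id.
have uht : u (h *: 1 + t) @[h --> (0 : R)^'] --> u t.
  exact: (cvg_comp _ _ ht0 ucont).
have near_d : \forall h \near (0 : R)^', `|u (h *: 1 + t) - u t| < d.
  move/cvgrPdist_lt: uht => /(_ d d0).
  by apply: filterS => h; rewrite distrC.
have zeta_cvg i : zeta h i @[h --> (0 : R)^'] --> u t.
  apply/cvgrPdist_lt => e e0.
  move/cvgrPdist_lt: uht => /(_ e e0); apply: filterS2 near_d => h hd.
  by rewrite distrC [in X in _ -> X]distrC; apply: le_lt_trans; case: (zetaP h hd).
have quot_cvg i : (h^-1 *: (u (h *: 1 + t) - u t)) 0 i @[h --> (0 : R)^']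
    --> (derive1 u t) 0 i.
  rewrite derive1E.
  have := @coord_continuous _ 1 m 0 i (derive u t 1).
  exact: cvg_comp.
have partial_cvg i : partial i f (zeta h i) @[h --> (0 : R)^']
    --> partial i f (u t).
  apply: cvg_comp (zeta_cvg i) _.
  by case: (fd (u t) _ i); rewrite ?subrr ?normr0.
have total_cvg : (h^-1 *: (f (u (h *: 1 + t)) - f (u t))) @[h --> (0 : R)^']
    --> \sum_i (derive1 u t) 0 i * partial i f (u t).
  apply: (@cvg_trans _ ((fun h : R => \sum_i (h^-1 *: (u (h *: 1 + t) - u t)) 0 i
      * partial i f (zeta h i)) @ (0 : R)^')).
    apply: near_eq_cvg; apply: filterS near_d => h hd.
    case: (zetaP h hd) => _ ->; rewrite scaler_sumr; apply: eq_bigr => i _.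
    by rewrite !mxE -mulrA.
  apply: cvg_big => [|i _]; first exact: add_continuous.
  by apply: cvgM.
split; first by apply/cvg_ex; eexists; exact: total_cvg.
exact: (cvg_lim _ total_cvg).
Qed.

(** A single constant [C] bounds both a Lipschitz constant and the inverse of
    the radius on which it is valid; enlarging [C] weakens the property, so
    that finitely many such bounds hold with a common constant. *)
Definition lip_on_ball z (C : R) f : Prop :=
  forall x y, `|x - z| < C^-1 -> `|y - z| < C^-1 -> `|f x - f y| <= C * `|x - y|.

Definition loc_lip z f : Prop := exists2 C, 0 < C & lip_on_ball z C f.

Lemma lt_invW (C C' : R) (a : R) : 0 < C -> C <= C' -> a < C'^-1 -> a < C^-1.
Proof.
move=> C0 CC' /lt_le_trans; apply; rewrite lef_pV2// posrE//.
exact: lt_le_trans CC'.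
Qed.

Lemma lip_on_ballW z (C C' : R) f : 0 < C -> C <= C' ->
  lip_on_ball z C f -> lip_on_ball z C' f.
Proof.
move=> C0 CC' fC x y xz yz; apply: le_trans (fC x y _ _) _.
- exact: lt_invW xz.
- exact: lt_invW yz.
by rewrite ler_wpM2r.
Qed.

Lemma near_pinftyW (P : R -> Prop) (C0 : R) :
  (forall C C', 0 < C -> C <= C' -> P C -> P C') ->
  0 < C0 -> P C0 -> \forall C \near +oo, P C.
Proof.
by move=> mono C00 PC; near=> C; apply: mono PC => //; near: C; exact: near_ge.
Unshelve. all: by end_near. Qed.

Lemma loc_lip_near z f : loc_lip z f -> \forall C \near +oo, lip_on_ball z C f.
Proof.
case=> C C0 fC; apply: (near_pinftyW _ C0 fC) => {C0 fC}C C'.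
exact: lip_on_ballW.
Qed.

Lemma pinfty_ex (P : R -> Prop) : (\forall C \near +oo, P C) ->
  exists2 C, 1 <= C & P C.
Proof.
move=> nP; have [C [PC C1]] := filter_ex (filterI nP (near_ge 1)).
by exists C.
Qed.

Lemma loc_lip_bounded z f : loc_lip z f ->
  \forall C \near +oo, forall x, `|x - z| < C^-1 -> `|f x| <= C.
Proof.
move=> [C0 C00 fC]; near=> C => x xz.
have CC0 : C0 <= C by near: C; exact: near_ge.
have CB : `|f z| + 1 <= C by near: C; exact: near_ge.
apply: le_trans CB; rewrite -[f x](subrK (f z)) (le_trans (ler_normD _ _))//.
rewrite addrC lerD2l (le_trans (fC x z _ _))//.
- exact: lt_invW xz.
- by rewrite subrr normr0 invr_gt0.
by rewrite -ler_pdivlMl// mulr1 ltW// (lt_invW C00 CC0).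
Unshelve. all: by end_near. Qed.

Lemma loc_lip_cst z (a : R) : loc_lip z (fun=> a).
Proof. by exists 1 => // x y _ _; rewrite subrr normr0 mul1r. Qed.

Lemma loc_lip_eq z f g : (\forall y \near z, f y = g y) ->
  loc_lip z f -> loc_lip z g.
Proof.
move=> /near_norm[d d0 fg] [C C0 fC].
exists (C + d^-1); first by rewrite addr_gt0// invr_gt0.
have Cd : C <= C + d^-1 by rewrite lerDl invr_ge0 ltW.
have dC a : a < (C + d^-1)^-1 -> a < d.
  by rewrite -[d in X in _ -> X]invrK; apply: lt_invW; rewrite ?invr_gt0// lerDr ltW.
move=> x y xz yz; rewrite -!fg; [|exact: dC..].
exact: (lip_on_ballW C0 Cd fC).
Qed.

Lemma loc_lipD z f g : loc_lip z f -> loc_lip z g ->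
  loc_lip z (fun y => f y + g y).
Proof.
move=> [C C0 fC] [D D0 gD]; exists (C + D); first exact: addr_gt0.
move=> x y xz yz; rewrite opprD addrACA (le_trans (ler_normD _ _))// mulrDl.
apply: lerD; [apply: fC|apply: gD].
- by apply: lt_invW xz; rewrite // lerDl ltW.
- by apply: lt_invW yz; rewrite // lerDl ltW.
- by apply: lt_invW xz; rewrite // lerDr ltW.
- by apply: lt_invW yz; rewrite // lerDr ltW.
Qed.

Lemma loc_lipM z f g : loc_lip z f -> loc_lip z g ->
  loc_lip z (fun y => f y * g y).
Proof.
move=> lf lg.
have [C C1 [[fC gC] [fB gB]]] := pinfty_ex (filterI
  (filterI (loc_lip_near lf) (loc_lip_near lg))
  (filterI (loc_lip_bounded lf) (loc_lip_bounded lg))).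
have C0 : 0 < C by exact: lt_le_trans C1.
have CC : C <= C * (C + C) by rewrite ler_peMr ?ltW//; lra.
exists (C * (C + C)); first by nra.
move=> x y /(lt_invW C0 CC) xz /(lt_invW C0 CC) yz.
rewrite (_ : _ - _ = f x * (g x - g y) + (f x - f y) * g y); last by ring.
rewrite (le_trans (ler_normD _ _))// !normrM mulrDr mulrDl.
apply: lerD; first by rewrite -mulrA ler_pM ?fB ?gC.
by rewrite [leRHS]mulrAC ler_pM ?gB ?fC.
Qed.

Lemma loc_lipV z f : loc_lip z f -> f z != 0 -> loc_lip z (fun y => (f y)^-1).
Proof.
move=> [C C0 fC] fz0; set a := `|f z|; have a0 : 0 < a by rewrite normr_gt0.
set D := C + 2 * C / a + 4 * C / a ^+ 2.
have pa : 0 < 2 * C / a by rewrite divr_gt0// mulr_gt0.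
have pb : 0 < 4 * C / a ^+ 2 by rewrite divr_gt0// ?exprn_gt0// mulr_gt0.
have CD : C <= D by rewrite /D; lra.
have D0 : 0 < D by exact: lt_le_trans CD.
have far x : `|x - z| < D^-1 -> a / 2 <= `|f x|.
  move=> xz; have : `|f x - f z| <= a / 2.
    rewrite (le_trans (fC x z _ _))//.
    - exact: (lt_invW C0 CD).
    - by rewrite subrr normr0 invr_gt0.
    have : `|x - z| <= (2 * C / a)^-1.
      by rewrite (le_trans (ltW xz))// lef_pV2 ?posrE// /D; lra.
    move=> xz'; apply: (@le_trans _ _ (C * (2 * C / a)^-1)); first by rewrite ler_pM2l.
    by rewrite (_ : _ * _ = a / 2)//; field; rewrite !gt_eqF.
  have := ler_normD (f x) (f z - f x).
  by rewrite addrC subrK -/a [`|f z - _|]distrC; lra.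
exists D => // x y xz yz.
have fx := far _ xz; have fy := far _ yz.
have fx0 : f x != 0 by rewrite -normr_gt0; apply: lt_le_trans fx; rewrite divr_gt0.
have fy0 : f y != 0 by rewrite -normr_gt0; apply: lt_le_trans fy; rewrite divr_gt0.
have -> : (f x)^-1 - (f y)^-1 = (f y - f x) * ((f x)^-1 * (f y)^-1).
  by field; rewrite fx0 fy0.
rewrite !normrM !normfV distrC.
have Vx : `|f x|^-1 <= 2 / a by rewrite -[2 / a]invrK lef_pV2 ?invf_div ?posrE ?normr_gt0// divr_gt0.
have Vy : `|f y|^-1 <= 2 / a by rewrite -[2 / a]invrK lef_pV2 ?invf_div ?posrE ?normr_gt0// divr_gt0.
apply: (@le_trans _ _ (C * `|x - y| * (2 / a * (2 / a)))).
  apply: ler_pM; rewrite ?mulr_ge0 ?invr_ge0//; last first.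
    by apply: ler_pM; rewrite ?invr_ge0.
  by apply: fC; exact: (lt_invW C0 CD).
rewrite mulrAC ler_wpM2r// (_ : C * _ = 4 * C / a ^+ 2); first by rewrite /D; lra.
by field; rewrite gt_eqF.
Qed.

Lemma loc_lip_sum z (I : finType) (f : I -> 'rV[R]_m -> R) :
  (forall i, loc_lip z (f i)) -> loc_lip z (fun y => \sum_i f i y).
Proof.
move=> lf; rewrite (_ : (fun y => _) = \sum_i f i); last first.
  by apply/funext => y; rewrite fct_sumE.
elim/big_ind: _ => [|g h lg lh|//].
  exact: loc_lip_cst.
exact: loc_lipD.
Qed.

Lemma loc_lip_prod z (I : finType) (f : I -> 'rV[R]_m -> R) :
  (forall i, loc_lip z (f i)) -> loc_lip z (fun y => \prod_i f i y).
Proof.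
move=> lf.
suff H (s : seq I) : loc_lip z (fun y => \prod_(i <- s) f i y) by exact: H.
elim: s => [|i s IH].
  by rewrite (_ : (fun y => _) = fun=> 1); [exact: loc_lip_cst|apply/funext => y; rewrite big_nil].
rewrite (_ : (fun y => _) = fun y => f i y * \prod_(j <- s) f j y).
  exact: loc_lipM.
by apply/funext => y; rewrite big_cons.
Qed.

Lemma loc_lip_det z (n : nat) (A : 'rV[R]_m -> 'M[R]_n) :
  (forall i j, loc_lip z (fun y => A y i j)) -> loc_lip z (fun y => \det (A y)).
Proof.
move=> lA; apply: loc_lip_sum => s; apply: loc_lipM; first exact: loc_lip_cst.
exact: loc_lip_prod.
Qed.

(** The inverse is the adjugate divided by the determinant, and both are
    polynomial in the entries. *)
Lemma loc_lip_invmx z (n : nat) (A : 'rV[R]_m -> 'M[R]_n) i j :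
  (forall i j, loc_lip z (fun y => A y i j)) ->
  (\forall y \near z, A y \in unitmx) -> loc_lip z (fun y => invmx (A y) i j).
Proof.
move=> lA uA.
apply: (@loc_lip_eq _ (fun y => (\det (A y))^-1 * cofactor (A y) j i)).
  by apply: filterS uA => y uy; rewrite /invmx uy !mxE.
apply: loc_lipM.
  apply: loc_lipV; first exact: loc_lip_det.
  by have := nbhs_singleton uA; rewrite unitmxE unitfE.
apply: loc_lipM; first exact: loc_lip_cst.
by apply: loc_lip_det => k l; rewrite (_ : (fun y => _) = fun y => A y (lift j k) (lift i l)) //; apply/funext => y; rewrite !mxE.
Qed.

Lemma loc_lip_C1 f z : C1_near f z -> loc_lip z f.
Proof.
move=> f1.
have fb (i : 'I_m) : \forall y \near z, `|partial i f y| <= `|partial i f z| + 1.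
  have [_ ci] := nbhs_singleton f1 i.
  move/cvgrPdist_lt : ci => /(_ 1 ltr01); apply: filterS => y yz.
  by rewrite -lerBlDl (le_trans (lerB_dist _ _))// distrC ltW.
have {}fb := filter_forall (nbhs_filter z) fb.
have [d d0 fd] := (near_norm _ _).1 (filterI f1 fb).
set B := \sum_i (`|partial i f z| + 1).
have B0 : 0 <= B by apply: sumr_ge0 => i _; rewrite addr_ge0.
exists (B + d^-1); first by rewrite ltr_wpDl// invr_gt0.
have dC a : a < (B + d^-1)^-1 -> a < d.
  by rewrite -[d in X in _ -> X]invrK; apply: lt_invW; rewrite ?invr_gt0// lerDr.
move=> x y /dC xz /dC yz; rewrite distrC.
have [w wd i||| zeta [z1 ->]] := @increment _ _ f z d _ x y => //.
  by case: (fd w wd) => /(_ i)[].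
rewrite (le_trans (ler_norm_sum _ _ _))//.
apply: (@le_trans _ _ (B * `|x - y|)); last first.
  by rewrite ler_wpM2r// lerDl invr_ge0 ltW.
rewrite mulr_suml; apply: ler_sum => i _; rewrite normrM mulrC ler_pM//.
  by case: (z1 i) => /fd[].
by rewrite distrC coord_norm.
Qed.

(** The increment formula evaluates the partial derivatives at intermediate
    points, where they differ from their values at [x] by [O(|y - x|)]. *)
Lemma taylor1_bound f z : C1_near f z -> (forall i, C1_near (partial i f) z) ->
  \forall C \near +oo, forall x y, `|x - z| < C^-1 -> `|y - z| < C^-1 ->
    `|f y - f x - \sum_i (y - x) 0 i * partial i f x| <= C * `|y - x| ^+ 2.
Proof.
move=> f1 f2.
have fl : \forall C \near +oo, forall i, lip_on_ball z C (partial i f).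
  by apply: filter_forall => i; apply: loc_lip_near; apply: loc_lip_C1.
have [D D1 fD] := pinfty_ex fl; have D0 : 0 < D by exact: lt_le_trans D1.
have [d d0 fd] := (near_norm _ _).1 f1.
near=> C => x y xz yz.
have CD : D <= C by near: C; exact: near_ge.
have C0 : 0 < C by exact: lt_le_trans CD.
have dC a : a < C^-1 -> a < d.
  rewrite -[d in X in _ -> X]invrK; apply: lt_invW; rewrite ?invr_gt0//.
have [w wd i||| zeta [z1 ->]] := @increment _ _ f z C^-1 _ x y => //.
  by case: (fd w (dC _ wd) i).
rewrite -sumrB (le_trans (ler_norm_sum _ _ _))//.
apply: (@le_trans _ _ (\sum_(i < m) D * `|y - x| ^+ 2)).
  apply: ler_sum => i _; rewrite -mulrBr normrM expr2 mulrCA.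
  apply: ler_pM => //; first exact: coord_norm.
  have [zi1 zi2] := z1 i.
  rewrite (le_trans (fD i _ _ _ _))//.
  - exact: (lt_invW D0 CD).
  - exact: (lt_invW D0 CD).
  - by rewrite ler_pM2l.
rewrite sumr_const card_ord -mulr_natl mulrA ler_wpM2r ?exprn_ge0//.
Unshelve. all: by end_near. Qed.

End LocalCalculus.

(** * Smooth maps between coordinate spaces *)

Section SmoothMaps.
Context {R : realType} {m : nat}.
Implicit Types (U : set 'rV[R]_m) (z : 'rV[R]_m).

Lemma continuous_near_eq (T W : topologicalType) (x : T) (F G : T -> W) :
  (\forall y \near x, F y = G y) -> {for x, continuous F} ->
  {for x, continuous G}.
Proof.
move=> FG cF; suff : G y @[y --> x] --> G x by [].
rewrite -(nbhs_singleton FG).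
exact: (cvg_trans (@near_eq_cvg _ _ (nbhs x) _ F G FG) cF).
Qed.

(** Partial derivatives are local, so on an open set equality of functions
    passes to all of them. *)
Lemma Ck_on_ext (V : normedModType R) k U (F G : 'rV[R]_m -> V) : open U ->
  (forall z, U z -> F z = G z) -> Ck_on k U F -> Ck_on k U G.
Proof.
move=> Uo; have near_eq (F' G' : 'rV[R]_m -> V) z : (forall z, U z -> F' z = G' z) ->
    U z -> \forall y \near z, F' y = G' y.
  by move=> FG Uz; have := open_nbhs_nbhs (conj Uo Uz); apply: filterS => y /FG.
elim: k F G => [|k IH] F G FG [cF dF]; split=> //.
- by move=> z Uz; apply: continuous_near_eq (near_eq _ _ _ FG Uz) (cF z Uz).
- by move=> z Uz; apply: continuous_near_eq (near_eq _ _ _ FG Uz) (cF z Uz).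
- move=> i; have [dFi cFi] := dF i; split=> [z Uz|].
    exact: (near_eq_derivable (near_eq _ _ _ FG Uz) (dFi z Uz)).
  by apply: IH cFi => z Uz; exact/near_eq_derive/(near_eq _ _ _ FG).
Qed.

Lemma partial_coord (n p : nat) (F : 'rV[R]_m -> 'M[R]_(n, p)) z k i j :
  derivable F z (delta_mx 0 k) ->
  partial k (fun y => F y i j) z = partial k F z i j.
Proof. by move=> Fd; rewrite /partial derive_mx// mxE. Qed.

Lemma Ck_on_coord (n p : nat) k U (F : 'rV[R]_m -> 'M[R]_(n, p)) i j :
  open U -> Ck_on k U F -> Ck_on k U (fun y => F y i j).
Proof.
move=> Uo; elim: k F => [|k IH] F [cF dF]; split.
- move=> z Uz; exact: (cvg_comp _ _ (cF z Uz) (@coord_continuous R n p i j (F z))).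
- by [].
- move=> z Uz; exact: (cvg_comp _ _ (cF z Uz) (@coord_continuous R n p i j (F z))).
- move=> l; have [dFl cFl] := dF l; split=> [z /dFl /derivable_mxP//|].
  apply: Ck_on_ext Uo _ (IH _ cFl) => z Uz.
  by rewrite partial_coord//; exact: dFl.
Qed.

Lemma smooth_on_coord (n p : nat) U (F : 'rV[R]_m -> 'M[R]_(n, p)) i j :
  open U -> smooth_on U F -> smooth_on U (fun y => F y i j).
Proof. by move=> Uo F_smooth k; exact: Ck_on_coord. Qed.

Lemma smooth_on_partial (V : normedModType R) U (F : 'rV[R]_m -> V) i :
  smooth_on U F -> smooth_on U (partial i F).
Proof. by move=> F_smooth k; case: (F_smooth k.+1) => _ /(_ i)[]. Qed.

Lemma smooth_on_derivable (V : normedModType R) U (F : 'rV[R]_m -> V) i z :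
  smooth_on U F -> U z -> derivable F z (delta_mx 0 i).
Proof. by move=> F_smooth Uz; case: (F_smooth 1) => _ /(_ i)[+ _]; apply. Qed.

Lemma smooth_on_continuous (V : normedModType R) U (F : 'rV[R]_m -> V) z :
  smooth_on U F -> U z -> {for z, continuous F}.
Proof. by move=> F_smooth Uz; case: (F_smooth 0) => + _; apply. Qed.

Lemma smooth_on_C1 U (f : 'rV[R]_m -> R) z : open U -> smooth_on U f -> U z ->
  C1_near f z.
Proof.
move=> Uo f_smooth Uz; have := open_nbhs_nbhs (conj Uo Uz).
apply: filterS => y Uy i; split; first exact: smooth_on_derivable f_smooth Uy.
exact: smooth_on_continuous (smooth_on_partial _ f_smooth) Uy.
Qed.

Lemma jacE (p : nat) U (F : 'rV[R]_m -> 'rV[R]_p) z i j : smooth_on U F -> U z ->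
  jac F z i j = partial i (fun y => F y 0 j) z.
Proof.
move=> F_smooth Uz; rewrite mxE partial_coord//.
exact: smooth_on_derivable F_smooth Uz.
Qed.

Lemma coord_derive1 (p : nat) (u : R -> 'rV[R]_p) (t : R) j : derivable u t 1 ->
  is_derive t 1 (fun s => u s 0 j) (derive1 u t 0 j).
Proof.
move=> ud; split; first by have /derivable_mxP := ud; apply.
by rewrite derive1E derive_mx// mxE.
Qed.

Lemma derive1_of_coords (p : nat) (u : R -> 'rV[R]_p) (t : R) (v : 'rV[R]_p) :
  (forall j, is_derive t 1 (fun s => u s 0 j) (v 0 j)) ->
  derivable u t 1 /\ derive1 u t = v.
Proof.
move=> uv; have ud : derivable u t 1.
  by apply/derivable_mxP => i j; rewrite (ord1 i); case: (uv j).
split=> //; apply/rowP => j; rewrite derive1E derive_mx// mxE.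
by case: (uv j).
Qed.

Lemma chain_jac (p : nat) U (F : 'rV[R]_m -> 'rV[R]_p) (u : R -> 'rV[R]_m) (t : R) :
  open U -> smooth_on U F -> U (u t) -> derivable u t 1 ->
  derivable (F \o u) t 1 /\ derive1 (F \o u) t = derive1 u t *m jac F (u t).
Proof.
move=> Uo F_smooth Uut ud; apply: derive1_of_coords => j.
have C1j := smooth_on_C1 Uo (smooth_on_coord 0 j Uo F_smooth) Uut.
have := is_derive_chain C1j ud.
rewrite (_ : \sum_i _ = (derive1 u t *m jac F (u t)) 0 j)//.
by rewrite mxE; apply: eq_bigr => i _; rewrite (jacE _ _ F_smooth).
Qed.

End SmoothMaps.

(** * The metric and the connection in a chart *)

Section BilinearForms.
Context {R : realType} {m : nat}.
Implicit Types (G : 'M[R]_m) (v w : 'rV[R]_m).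

Definition bform G v w : R := (v *m G *m w^T) 0 0.

Lemma bformE G v w : bform G v w = \sum_i \sum_j G i j * v 0 i * w 0 j.
Proof.
rewrite /bform mxE exchange_big/=; apply: eq_bigr => j _.
rewrite mxE mulr_suml; apply: eq_bigr => i _.
by rewrite mxE [v 0 i * _]mulrC.
Qed.

Lemma bformDl G v v' w : bform G (v + v') w = bform G v w + bform G v' w.
Proof. by rewrite /bform !mulmxDl mxE. Qed.

Lemma bformDr G v w w' : bform G v (w + w') = bform G v w + bform G v w'.
Proof. by rewrite /bform linearD/= mulmxDr mxE. Qed.

Lemma bformZl G k v w : bform G (k *: v) w = k * bform G v w.
Proof. by rewrite /bform -!scalemxAl mxE. Qed.

Lemma bformZr G k v w : bform G v (k *: w) = k * bform G v w.
Proof. by rewrite /bform linearZ/= -scalemxAr mxE. Qed.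

Lemma bformC G v w : G^T = G -> bform G v w = bform G w v.
Proof.
move=> Gsym; rewrite /bform -[LHS]trace_mx11 -mxtrace_tr trace_mx11.
by rewrite !trmx_mul trmxK Gsym mulmxA.
Qed.

Lemma bformBm G G' v w : bform (G - G') v w = bform G v w - bform G' v w.
Proof. by rewrite /bform mulmxBr mulmxBl !mxE. Qed.

Lemma bform_sqrD G v w : G^T = G ->
  bform G (v + w) (v + w) = bform G v v + 2 * bform G v w + bform G w w.
Proof. by move=> Gsym; rewrite bformDl !bformDr (bformC w v Gsym); ring. Qed.

Lemma bform_expansion (G G0 D : 'M[R]_m) v w : G0^T = G0 ->
  bform D v v = 2 * bform G0 v w ->
  bform G v v - bform G0 (v + w) (v + w)
    = bform (G - G0 - D) v v - bform G0 w w.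
Proof. by move=> G0sym; rewrite !bformBm (bform_sqrD _ _ G0sym) => ->; ring. Qed.

End BilinearForms.

Lemma chart_image_open (R : realType) (m : nat) (M : riemannian R m)
  (a : chart R m M) : open (cmap a @` cdom a).
Proof. exact: cimg_open. Qed.

Arguments chart_image_open {R m M} a _ _.

Section ChartChange.
Context {R : realType} {m : nat} {M : riemannian R m}.
Implicit Types (a b : chart R m M) (c : R -> M).

Lemma cmap_image_open a (V : set M) : open V ->
  open (cmap a @` (cdom a `&` V)).
Proof.
move=> Vo; rewrite openE => _ [x [ax Vx] <-].
have ia : (cmap a @` cdom a) (cmap a x) by exists x.
have n1 := open_nbhs_nbhs (conj (chart_image_open a) ia).
have n2 : \forall z \near cmap a x, V (cinv a z).
  apply: (cinv_cont ia); rewrite /= cmapK//.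
  exact: open_nbhs_nbhs (conj Vo Vx).
apply: filterS2 n1 n2 => _ [y ay <-] Vy; exists y => //.
by split=> //; move: Vy; rewrite cmapK.
Qed.

Lemma near_cdom a c (t : R) : {for t, continuous c} -> cdom a (c t) ->
  \forall s \near t, cdom a (c s).
Proof.
by move=> cc ac; apply: cc; exact: open_nbhs_nbhs (conj (cdom_open a) ac).
Qed.

Lemma smooth_map_id : smooth_map (fun x : M => x).
Proof. by split=> [x|a b aA bA]; [exact: cvg_id | exact: transition_smooth]. Qed.

End ChartChange.

Section CurvesUnderMaps.
Context {R : realType} {m p : nat} {M : riemannian R m} {N : riemannian R p}.
Implicit Types (f : M -> N) (c : R -> M).

(** For the identity map this is the change of charts. *)
Lemma curve_chain f a b c (t : R) : smooth_map f -> atlas M a -> atlas N b ->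
  {for t, continuous c} -> cdom a (c t) -> cdom b (f (c t)) ->
  derivable (in_chart a c) t 1 ->
  derivable (in_chart b (f \o c)) t 1 /\
  derive1 (in_chart b (f \o c)) t =
    derive1 (in_chart a c) t *m jac (cmap b \o f \o cinv a) (cmap a (c t)).
Proof.
move=> [f_cont f_smooth] aA bA cc act bct ud.
have Uo : open (cmap a @` (cdom a `&` f @^-1` cdom b)).
  by apply: cmap_image_open; apply: open_comp (cdom_open b) => x _; exact: f_cont.
have Uct : (cmap a @` (cdom a `&` f @^-1` cdom b)) (in_chart a c t).
  by exists (c t).
have [d1 d2] := chain_jac Uo (f_smooth a b aA bA) Uct ud.
have E : \forall s \near t,
    ((cmap b \o f \o cinv a) \o in_chart a c) s = in_chart b (f \o c) s.
  by apply: filterS (near_cdom cc act) => s acs; rewrite /in_chart/= cmapK.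
split; first exact: near_eq_derivable E d1.
by rewrite derive1E -(near_eq_derive _ E) -derive1E d2.
Qed.

End CurvesUnderMaps.

Section MetricInCharts.
Context {R : realType} {m : nat} {M : riemannian R m}.
Implicit Types (a b : chart R m M) (c : R -> M) (x : M) (v w : 'rV[R]_m).

Lemma metric_ge0 x v : 0 <= bform (metric x) v v.
Proof.
have [->|v0] := eqVneq v 0; last by rewrite ltW// metric_pos.
by rewrite /bform !mul0mx mxE.
Qed.

Lemma tnorm_ge0 x v : 0 <= tnorm x v.
Proof. exact: sqrtr_ge0. Qed.

Lemma sqr_tnorm x v : tnorm x v ^+ 2 = bform (metric x) v v.
Proof. by rewrite sqr_sqrtr// metric_ge0. Qed.

Lemma bform_gram a z v w :
  bform (gram a z) v w =
  let J := jac (cmap (chart_at (cinv a z)) \o cinv a) z in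
  bform (metric (cinv a z)) (v *m J) (w *m J).
Proof. by rewrite /bform /= /gram /gram_of trmx_mul !mulmxA. Qed.

Lemma gram_tr a z : (gram a z)^T = gram a z.
Proof. by rewrite /gram /gram_of !trmx_mul trmxK Defs.metric_sym mulmxA. Qed.

Lemma velocity_in_chart a c (t : R) : atlas M a -> {for t, continuous c} ->
  cdom a (c t) -> derivable (in_chart a c) t 1 ->
  velocity c t = derive1 (in_chart a c) t *m
    jac (cmap (chart_at (c t)) \o cinv a) (cmap a (c t)).
Proof.
move=> aA cc act ud.
by case: (curve_chain smooth_map_id aA (chart_at_atlas (c t)) cc act (chart_at_dom _) ud).
Qed.

(** The preferred chart, in which the velocity and the metric are expressed,
    changes along the curve; the two changes of coordinates cancel. *)
Lemma sqr_speed a c (t : R) : atlas M a -> {for t, continuous c} ->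
  cdom a (c t) -> derivable (in_chart a c) t 1 ->
  tnorm (c t) (velocity c t) ^+ 2 =
    bform (gram a (in_chart a c t)) (derive1 (in_chart a c) t)
      (derive1 (in_chart a c) t).
Proof.
move=> aA cc act ud; rewrite sqr_tnorm (velocity_in_chart aA)// bform_gram/=.
by rewrite /in_chart/= cmapK.
Qed.

(** The straight coordinate line through [z] has velocity [v] in the chart
    [a]; reading it in the preferred chart and back shows that the change of
    coordinates is injective on tangent vectors. *)
Lemma gram_pos a z v : atlas M a -> (cmap a @` cdom a) z -> v != 0 ->
  0 < bform (gram a z) v v.
Proof.
move=> aA az v0; have [x ax xz] := az.
pose c (s : R) := cinv a (z + s *: v).
have line0 : z + 0 *: v = z by rewrite scale0r addr0.
have line_cont : {for (0 : R), continuous (fun s : R => z + s *: v)}.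
  by apply: cvgD; [exact: cvg_cst|apply: cvgZr_tmp; exact: cvg_id].
have c0 : c 0 = x by rewrite /c line0 -xz cmapK.
have cc : {for 0, continuous c}.
  apply: continuous_comp line_cont _; rewrite line0; exact: cinv_cont.
have E : \forall s \near (0 : R), z + s *: v = in_chart a c s.
  have : \forall s \near (0 : R), (cmap a @` cdom a) (z + s *: v).
    apply: line_cont; rewrite line0.
    exact: open_nbhs_nbhs (conj (chart_image_open a) az).
  by apply: filterS => s [y ay ys]; rewrite /in_chart /c /= -ys cmapK.
have [ld lv] : derivable (fun s : R => z + s *: v) 0 1 /\
    derive1 (fun s : R => z + s *: v) 0 = v.
  apply: derive1_of_coords => j.
  rewrite (_ : (fun s => _) = fun s : R => z 0 j + s * v 0 j); last first.
    by apply/funext => s; rewrite !mxE.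
  by apply: is_derive_eq; rewrite add0r mul1r scaler0 add0r [_%:A]mulr1.
have ud : derivable (in_chart a c) 0 1 by exact: near_eq_derivable E ld.
have uv : derive1 (in_chart a c) 0 = v.
  by rewrite derive1E -(near_eq_derive _ E) -derive1E.
have ac0 : cdom a (c 0) by rewrite c0.
have u0 : in_chart a c 0 = z by rewrite -(nbhs_singleton E) line0.
have := sqr_speed aA cc ac0 ud; rewrite u0 uv => <-.
rewrite sqr_tnorm metric_pos//; apply: contra_neq v0 => vel0.
have bA := chart_at_atlas (c 0).
have [bd bv] := curve_chain smooth_map_id aA bA cc ac0 (chart_at_dom _) ud.
have [_] := curve_chain smooth_map_id bA aA cc (chart_at_dom _) ac0 bd.
rewrite (_ : derive1 _ 0 = v)// => ->.
by rewrite (_ : derive1 _ 0 = velocity c 0)// vel0 mul0mx.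
Qed.

Lemma gram_ge0 a z v : 0 <= bform (gram a z) v v.
Proof. by rewrite bform_gram/= metric_ge0. Qed.

Lemma gram_unit a z : atlas M a -> (cmap a @` cdom a) z ->
  gram a z \in unitmx.
Proof.
move=> aA az; rewrite -row_free_unit; apply: inj_row_free => v vG.
apply/eqP/negP => /negP v0.
by have := gram_pos aA az v0; rewrite /bform vG mul0mx mxE ltxx.
Qed.

Lemma gram_smooth a i j : atlas M a ->
  smooth_on (cmap a @` cdom a) (fun z => gram a z i j).
Proof. by move=> aA; apply: smooth_on_coord (chart_image_open a) _; exact: metric_smooth. Qed.

Lemma christoffel_sym a z i j k : christoffel a z i j k = christoffel a z j i k.
Proof.
have gs (r s : 'I_m) : (fun w => gram a w r s) = (fun w => gram a w s r).
  by apply/funext => w; rewrite -[in LHS]gram_tr mxE.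
rewrite /christoffel; congr (_ * _); apply: eq_bigr => l _; congr (_ * _).
by rewrite [X in X - _]addrC (gs i j).
Qed.

Lemma christoffel_loc_lip a z i j k : atlas M a -> (cmap a @` cdom a) z ->
  loc_lip z (fun y => christoffel a y i j k).
Proof.
move=> aA az.
have glip i' j' l : loc_lip z (partial l (fun w => gram a w i' j')).
  apply/loc_lip_C1/smooth_on_C1; last exact: az.
    exact: chart_image_open.
  exact/smooth_on_partial/gram_smooth.
apply: loc_lipM; first exact: loc_lip_cst.
apply: loc_lip_sum => l; apply: loc_lipM.
  apply: loc_lip_invmx => [i' j'|].
    apply/loc_lip_C1/smooth_on_C1; last exact: az.
      exact: chart_image_open.
    exact: gram_smooth.
  have := open_nbhs_nbhs (conj (chart_image_open a) az).
  by apply: filterS => y ay; exact: gram_unit.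
apply: loc_lipD; first exact: loc_lipD.
rewrite (_ : (fun y => _) = (fun y => -1 * partial l (fun w => gram a w i j) y)).
  by apply: loc_lipM; [exact: loc_lip_cst|exact: glip].
by apply/funext => y; rewrite mulN1r.
Qed.

(** The bilinear expression by which the Levi-Civita connection differs from
    componentwise differentiation. *)
Definition gamma a z v w : 'rV[R]_m :=
  \row_k \sum_i \sum_j christoffel a z i j k * v 0 i * w 0 j.

Definition dgram a z w : 'M[R]_m :=
  \matrix_(i, j) \sum_k w 0 k * partial k (fun y => gram a y i j) z.

Lemma gammaE a z v w k :
  gamma a z v w 0 k = \sum_i \sum_j christoffel a z i j k * v 0 i * w 0 j.
Proof. by rewrite mxE. Qed.

Lemma dgramE a z w i j :
  dgram a z w i j = \sum_k w 0 k * partial k (fun y => gram a y i j) z.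
Proof. by rewrite mxE. Qed.

Lemma gammaC a z v w : gamma a z v w = gamma a z w v.
Proof.
apply/rowP => k; rewrite !mxE exchange_big; apply: eq_bigr => i _.
by apply: eq_bigr => j _; rewrite christoffel_sym mulrAC.
Qed.

Lemma gammaDl a z v v' w : gamma a z (v + v') w = gamma a z v w + gamma a z v' w.
Proof.
apply/rowP => k; rewrite !mxE -big_split; apply: eq_bigr => i _ /=.
by rewrite -big_split; apply: eq_bigr => j _ /=; rewrite !mxE mulrDr mulrDl.
Qed.

Lemma gammaZl a z s v w : gamma a z (s *: v) w = s *: gamma a z v w.
Proof.
apply/rowP => k; rewrite !mxE mulr_sumr; apply: eq_bigr => i _ /=.
by rewrite mulr_sumr; apply: eq_bigr => j _ /=; rewrite !mxE mulrCA !mulrA.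
Qed.

Lemma gammaDr a z v w w' : gamma a z v (w + w') = gamma a z v w + gamma a z v w'.
Proof. by rewrite gammaC gammaDl ![gamma _ _ _ v]gammaC. Qed.

Lemma gammaZr a z s v w : gamma a z v (s *: w) = s *: gamma a z v w.
Proof. by rewrite gammaC gammaZl gammaC. Qed.

(** The metric is parallel: lowering the index of the Christoffel symbols
    cancels the inverse matrix in their definition. *)
Lemma dgram_gamma a z v w : atlas M a -> (cmap a @` cdom a) z ->
  bform (dgram a z w) v v = 2 * bform (gram a z) v (gamma a z w v).
Proof.
move=> aA az; have Gu := gram_unit aA az.
pose D k i j := partial k (fun y => gram a y i j) z.
have DC k i j : D k i j = D k j i.
  rewrite /D; congr (partial k _ z); apply/funext => y.
  by rewrite -[in LHS]gram_tr mxE.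
have low s i j : \sum_k gram a z s k * christoffel a z i j k
    = 2^-1 * (D i j s + D j i s - D s i j).
  under eq_bigr => k _ do rewrite /christoffel mulrCA mulr_sumr.
  rewrite -mulr_sumr exchange_big/=; congr (_ * _).
  under eq_bigr => l _ do under eq_bigr => k _ do rewrite mulrA.
  have inv l : \sum_k gram a z s k * invmx (gram a z) k l = (s == l)%:R.
    by have := congr1 (fun A : 'M[R]_m => A s l) (mulmxV Gu); rewrite !mxE.
  under eq_bigr => l _ do rewrite -mulr_suml inv.
  rewrite (bigD1 s)//= big1 ?addr0 => [|l ls].
    by rewrite eqxx mul1r.
  by rewrite eq_sym (negbTE ls) mul0r.
have -> : bform (gram a z) v (gamma a z w v) =
    \sum_s \sum_i \sum_j v 0 s * w 0 i * v 0 j * (2^-1 * (D i j s + D j i s - D s i j)).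
  rewrite bformE; apply: eq_bigr => s _.
  under eq_bigr => k _ do rewrite gammaE mulr_sumr.
  rewrite exchange_big/=; apply: eq_bigr => i _.
  under eq_bigr => k _ do rewrite mulr_sumr.
  rewrite exchange_big/=; apply: eq_bigr => j _.
  rewrite -low mulr_sumr; apply: eq_bigr => k _.
  by ring.
have -> : bform (dgram a z w) v v = \sum_s \sum_i \sum_j v 0 s * w 0 i * v 0 j * D i s j.
  rewrite bformE; apply: eq_bigr => s _.
  rewrite exchange_big; apply: eq_bigr => j _ /=.
  by rewrite dgramE !mulr_suml; apply: eq_bigr => k _; rewrite -/(D _ _ _); ring.
have swap : \sum_s \sum_i \sum_j v 0 s * w 0 i * v 0 j * D j i s
    = \sum_s \sum_i \sum_j v 0 s * w 0 i * v 0 j * D s i j.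
  under eq_bigr => s _ do rewrite exchange_big.
  rewrite exchange_big/=; apply: eq_bigr => s _.
  rewrite exchange_big/=; apply: eq_bigr => i _.
  by apply: eq_bigr => j _; ring.
transitivity (2 * (2^-1 * (\sum_s \sum_i \sum_j v 0 s * w 0 i * v 0 j * D i s j)
   + 2^-1 * (\sum_s \sum_i \sum_j v 0 s * w 0 i * v 0 j * D j i s)
   - 2^-1 * (\sum_s \sum_i \sum_j v 0 s * w 0 i * v 0 j * D s i j))).
  by rewrite swap addrK mulVKf// pnatr_eq0.
congr (2 * _).
rewrite !mulr_sumr -!sumrN -!big_split; apply: eq_bigr => s _ /=.
rewrite !mulr_sumr -!sumrN -!big_split; apply: eq_bigr => i _ /=.
rewrite !mulr_sumr -!sumrN -!big_split; apply: eq_bigr => j _ /=.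
by rewrite (DC i s j); ring.
Qed.

End MetricInCharts.

(** * Uniform bounds near a point of a chart *)

Section BilinearBounds.
Context {R : realType} {m : nat}.
Implicit Types (G : 'M[R]_m) (v w : 'rV[R]_m).

Lemma subm2E (A B D : 'M[R]_m) i j : (A - B - D) i j = A i j - B i j - D i j.
Proof. by rewrite !mxE. Qed.

Lemma sum2_bound (A : 'I_m -> 'I_m -> R) (B : R) v w :
  (forall i j, `|A i j| <= B) ->
  `|\sum_i \sum_j A i j * v 0 i * w 0 j| <= m%:R * m%:R * B * (`|v| * `|w|).
Proof.
move=> AB; rewrite (le_trans (ler_norm_sum _ _ _))//.
apply: (@le_trans _ _ (\sum_(i < m) \sum_(j < m) B * (`|v| * `|w|))); last first.
  rewrite !sumr_const !card_ord -[_ *+ m *+ m]mulr_natl.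
  by rewrite -[B * _ *+ m]mulr_natl !mulrA.
apply: ler_sum => i _; rewrite (le_trans (ler_norm_sum _ _ _))//.
apply: ler_sum => j _; rewrite !normrM -mulrA.
by apply: ler_pM; rewrite ?mulr_ge0//; apply: ler_pM; rewrite ?coord_norm.
Qed.

Lemma bform_bound G (B : R) v w : (forall i j, `|G i j| <= B) ->
  `|bform G v w| <= m%:R * m%:R * B * (`|v| * `|w|).
Proof. by rewrite bformE; exact: sum2_bound. Qed.

Lemma bform_CauchySchwarz G v w : G^T = G ->
  (forall v, v != 0 -> 0 < bform G v v) ->
  bform G v w ^+ 2 <= bform G v v * bform G w w.
Proof.
move=> Gsym Gpos; have [->|w0] := eqVneq w 0.
  have b0 u : bform G u 0 = 0 by rewrite /bform trmx0 mulmx0 mxE.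
  by rewrite !b0 expr0n mulr0.
have Gge0 u : 0 <= bform G u u.
  have [->|/Gpos/ltW//] := eqVneq u 0.
  by rewrite /bform trmx0 mulmx0 mxE.
set A := bform G v v; set B := bform G v w; set D := bform G w w.
have D0 : 0 < D by exact: Gpos.
have := Gge0 (D *: v + (- B) *: w).
rewrite !bformDl !bformDr !bformZl !bformZr (bformC w v Gsym) -/A -/B -/D.
rewrite (_ : _ + _ = D * (A * D - B ^+ 2)); last by ring.
by rewrite pmulr_rge0// subr_ge0.
Qed.

(** The coordinate [v 0 k] is the inner product of [v] with the [k]-th row of
    the inverse matrix; by Cauchy-Schwarz the form controls the coordinates
    wherever the inverse is bounded. *)
Lemma coord_sqr_le_bform G v k : G^T = G -> G \in unitmx ->
  (forall v, v != 0 -> 0 < bform G v v) ->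
  v 0 k ^+ 2 <= invmx G k k * bform G v v.
Proof.
move=> Gsym Gu Gpos.
pose w : 'rV[R]_m := delta_mx 0 k *m invmx G.
have wT : w^T = invmx G *m delta_mx k 0.
  by rewrite trmx_mul trmx_inv Gsym trmx_delta.
have -> : v 0 k = bform G v w.
  by rewrite /bform wT mulmxA mulmxK// -colE mxE.
rewrite mulrC (_ : invmx G k k = bform G w w); first exact: bform_CauchySchwarz.
by rewrite /bform wT mulmxA mulmxK// -mulmxA -rowE -colE !mxE.
Qed.

End BilinearBounds.

Section ChartBounds.
Context {R : realType} {m : nat} {M : riemannian R m}.
Implicit Types (a : chart R m M) (z : 'rV[R]_m) (C : R).

Lemma gamma_bound a z (B : R) v w : 0 <= B ->
  (forall i j k, `|christoffel a z i j k| <= B) ->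
  `|gamma a z v w| <= m%:R * m%:R * B * (`|v| * `|w|).
Proof.
move=> B0 cB; apply: rV_norm_le => [|k]; last by rewrite gammaE; exact: sum2_bound.
by rewrite !mulr_ge0.
Qed.

(** One constant for all the estimates that hold near the coordinates [zs]. The
    last clause is the basis of all distance estimates: once vectors at [z] are
    corrected by the connection at [z0], the Gram matrix at [z0] measures them
    as the one at [z] does, up to second order in [z - z0]. *)
Definition chart_bounds a zs C : Prop :=
  forall z z0, `|z - zs| < C^-1 -> `|z0 - zs| < C^-1 ->
  [/\ (cmap a @` cdom a) z,
      forall v, `|v| ^+ 2 <= C * bform (gram a z) v v,
      forall v w, `|bform (gram a z) v w| <= C * (`|v| * `|w|)
    & forall v w, `|gamma a z v w| <= C * (`|v| * `|w|)] /\
  [/\ forall v, `|gamma a z v v - gamma a z0 v v| <= C * (`|z - z0| * `|v| ^+ 2)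
    & forall v, `|bform (gram a z) v v
        - bform (gram a z0) (v + gamma a z0 (z - z0) v) (v + gamma a z0 (z - z0) v)|
        <= C * (`|z - z0| ^+ 2 * `|v| ^+ 2)].

(** In the last clause the first-order Taylor term of the Gram matrix is [dgram],
    which [dgram_gamma] identifies with the cross term of the corrected square. *)
Lemma near_chart_bounds a zs : atlas M a -> (cmap a @` cdom a) zs ->
  \forall C \near +oo, chart_bounds a zs C.
Proof.
move=> aA azs.
have imgn := open_nbhs_nbhs (conj (chart_image_open a) azs).
have gC1 i j : C1_near (fun z => gram a z i j) zs.
  by apply: smooth_on_C1 azs; [exact: chart_image_open|exact: gram_smooth].
have glip i j : loc_lip zs (fun z => gram a z i j) by exact: loc_lip_C1.
have dgC1 i j k : C1_near (partial k (fun z => gram a z i j)) zs.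
  apply: smooth_on_C1 azs; first exact: chart_image_open.
  exact/smooth_on_partial/gram_smooth.
have ilip i j : loc_lip zs (fun z => invmx (gram a z) i j).
  apply: loc_lip_invmx => //; apply: filterS imgn => y ay; exact: gram_unit.
have clip i j k := christoffel_loc_lip i j k aA azs.
have FF : Filter (+oo : set_system R) by exact: proper_pinfty_nbhs.
have nG := filter_forall FF (fun i => filter_forall FF (fun j => loc_lip_bounded (glip i j))).
have nI := filter_forall FF (fun i => loc_lip_bounded (ilip i i)).
have nT := filter_forall FF (fun i => filter_forall FF (fun j =>
  taylor1_bound (gC1 i j) (dgC1 i j))).
have nCb := filter_forall FF (fun i => filter_forall FF (fun j => filter_forall FF (fun k =>
  loc_lip_bounded (clip i j k)))).
have nCl := filter_forall FF (fun i => filter_forall FF (fun j => filter_forall FF (fun k =>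
  loc_lip_near (clip i j k)))).
have [B B1 [[gB iB] [tB [cB cL]]]] :=
  pinfty_ex (filterI (filterI nG nI) (filterI nT (filterI nCb nCl))).
have B0 : 0 < B by exact: lt_le_trans B1.
have [d d0 dimg] := (near_norm _ _).1 imgn.
set K := m%:R * m%:R * B + B.
have KB : B <= K by rewrite lerDr !mulr_ge0// ltW.
have K0 : 0 < K by exact: lt_le_trans KB.
have KK0 : 0 < K * K * K by rewrite !mulr_gt0.
have dV0 : 0 < d^-1 by rewrite invr_gt0.
apply: (filterS _ (near_ge (K + K * K * K + d^-1))) => C CC.
have CB : B <= C by apply: le_trans CC; lra.
have CK : K <= C by apply: le_trans CC; lra.
have CKK : K + K * K * K <= C by apply: le_trans CC; lra.
have Cd : d^-1 <= C by apply: le_trans CC; lra.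
have C0 : 0 < C by exact: lt_le_trans CB.
have dC (s : R) : s < C^-1 -> s < d.
  rewrite -[d in X in _ -> X]invrK; exact: lt_invW.
have weak (s t : R) : 0 <= t -> s <= m%:R * m%:R * B * t -> s <= C * t.
  move=> t0 /le_trans; apply; rewrite ler_wpM2r// (le_trans _ CK)//.
  by rewrite /K lerDl ltW.
move=> z z0 zz zz0.
have az := dimg _ (dC _ zz); have az0 := dimg _ (dC _ zz0).
have zB := lt_invW B0 CB zz; have z0B := lt_invW B0 CB zz0.
have gram_bound v w : `|bform (gram a z0) v w| <= K * (`|v| * `|w|).
  rewrite (le_trans (bform_bound v w (fun i j => gB i j z0 z0B)))//.
  by rewrite ler_wpM2r ?mulr_ge0// /K lerDl ltW.
have gam_bound v w : `|gamma a z0 v w| <= K * (`|v| * `|w|).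
  rewrite (le_trans (gamma_bound v w (ltW B0) (fun i j k => cB i j k z0 z0B)))//.
  by rewrite ler_wpM2r ?mulr_ge0// /K lerDl ltW.
split; split.
- exact: az.
- move=> v; have q0 := gram_ge0 a z v.
  suff nv : `|v| <= Num.sqrt (C * bform (gram a z) v v).
    by rewrite -(@ler_sqrt _ (`|v| ^+ 2)) ?mulr_ge0 ?(ltW C0)// sqrtr_sqr normr_id.
  apply: rV_norm_le => [|k]; first exact: sqrtr_ge0.
  rewrite -sqrtr_sqr ler_sqrt ?mulr_ge0 ?(ltW C0)//.
  apply: le_trans (coord_sqr_le_bform v k (gram_tr a z) (gram_unit aA az) _) _.
    by move=> u; exact: gram_pos.
  by rewrite ler_wpM2r// (le_trans _ CB)// (le_trans (ler_norm _))// iB.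
- move=> v w; apply: weak; first by rewrite mulr_ge0.
  exact: bform_bound (fun i j => gB i j z zB).
- move=> v w; apply: weak; first by rewrite mulr_ge0.
  exact: gamma_bound (ltW B0) (fun i j k => cB i j k z zB).
- move=> v; apply: rV_norm_le => [|k]; first by rewrite !mulr_ge0 ?(ltW C0) ?exprn_ge0.
  have -> : (gamma a z v v - gamma a z0 v v) 0 k = \sum_i \sum_j
      (christoffel a z i j k - christoffel a z0 i j k) * v 0 i * v 0 j.
    rewrite !mxE -sumrB; apply: eq_bigr => i _; rewrite -sumrB.
    by apply: eq_bigr => j _; rewrite !mulrBl.
  have := @sum2_bound _ _ _ (B * `|z - z0|) v v
    (fun i j => cL i j k z z0 zB z0B).
  move=> H; apply: weak; first by rewrite mulr_ge0 ?exprn_ge0.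
  by apply: le_trans H _; rewrite expr2 !mulrA.
- move=> v; set w := z - z0; set g := gamma a z0 w v.
  have -> : bform (gram a z) v v - bform (gram a z0) (v + g) (v + g) =
      bform (gram a z - gram a z0 - dgram a z0 w) v v - bform (gram a z0) g g.
    apply: bform_expansion; first exact: gram_tr.
    exact: dgram_gamma.
  have h1 : `|bform (gram a z - gram a z0 - dgram a z0 w) v v|
      <= K * (`|w| ^+ 2 * `|v| ^+ 2).
    apply: le_trans (bform_bound v v (B := B * `|w| ^+ 2) _) _.
      move=> i j; have := tB i j z0 z z0B zB.
      by rewrite -dgramE -/w -subm2E.
    have -> : m%:R * m%:R * (B * `|w| ^+ 2) * (`|v| * `|v|)
        = m%:R * m%:R * B * (`|w| ^+ 2 * `|v| ^+ 2).
      by rewrite (expr2 `|v|) !mulrA.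
    by rewrite ler_wpM2r ?mulr_ge0 ?exprn_ge0// /K lerDl ltW.
  have h2 : `|bform (gram a z0) g g| <= K * K * K * (`|w| ^+ 2 * `|v| ^+ 2).
    apply: le_trans (gram_bound g g) _.
    rewrite -exprMn -2!mulrA; rewrite ler_pM2l// mulrA -expr2 -[K * K]expr2 -exprMn.
    by rewrite ler_sqr ?nnegrE ?mulr_ge0 ?(ltW K0)//; exact: gam_bound.
  rewrite (le_trans (ler_normB _ _))// (le_trans (lerD h1 h2))// -mulrDl.
  by rewrite ler_wpM2r// mulr_ge0 ?exprn_ge0.
Qed.

End ChartBounds.

(** * Exit from a coordinate ball *)

(** The exit time is the infimum of the times spent outside [W]. *)
Lemma exit_time (R : realType) (X : topologicalType) (c : R -> X) (W : set X) :
  open W -> (forall t : R, 0 <= t <= 1 -> {for t, continuous c}) -> W (c 0) ->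
  (forall t, 0 <= t <= 1 -> W (c t)) \/
  exists T : R, [/\ 0 < T <= 1, forall t, 0 <= t < T -> W (c t) & ~ W (c T)].
Proof.
move=> Wo cc W0; pose E := [set t : R | 0 <= t <= 1 /\ ~ W (c t)].
have [E0|/eqP/set0P[e [e01 We]]] := pselect (E = set0).
  left=> t t01; apply: contrapT => nW.
  by have : E t by []; rewrite E0.
have Elb : has_lbound E by exists 0 => t [/andP[]].
have En : E !=set0 by exists e.
right; exists (inf E).
have T0 : 0 <= inf E by apply: lb_le_inf => // t [/andP[]].
have T1 : inf E <= 1.
  by case/andP: (e01) => _; apply: le_trans; apply: (ge_inf Elb); split.
have before t : 0 <= t < inf E -> W (c t).
  move=> /andP[t0 tT]; apply: contrapT => nW.
  have : inf E <= t by apply: (ge_inf Elb); split=> //; rewrite t0 (le_trans (ltW tT)).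
  by rewrite leNgt tT.
have out : ~ W (c (inf E)).
  move=> WT; have : \forall s \near inf E, W (c s).
    by apply: cc; [rewrite T0 T1|exact: open_nbhs_nbhs].
  move=> /near_norm[d d0 dW].
  have [s Es sT] := inf_adherent d0 (conj En Elb).
  have [_] := Es; apply; apply: dW; rewrite ger0_norm ?subr_ge0; last exact: (ge_inf Elb).
  by rewrite ltrBlDl.
split=> //; rewrite T1 andbT lt_neqAle T0 andbT.
by apply: contra_notN out => /eqP <-.
Qed.

Lemma continuous_dist (R : realType) (V : normedModType R) (z : V) :
  continuous (fun y : V => `|y - z|).
Proof.
move=> y; apply: (@continuous_comp _ _ _ (fun y : V => y - z) (fun w => `|w|)).
  by apply: cvgB; [exact: cvg_id|exact: cvg_cst].
exact: norm_continuous.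
Qed.

Section ExitFromChartBall.
Context {R : realType} {m : nat} {M : riemannian R m}.
Implicit Types (a : chart R m M) (c : R -> M) (z : 'rV[R]_m).

Lemma cinv_ball_closed a z (rho : R) :
  (forall y, `|y - z| <= rho -> (cmap a @` cdom a) y) ->
  closed (cinv a @` [set y | `|y - z| <= rho]).
Proof.
move=> img; apply: compact_closed; first exact: rspace_hausdorff.
apply: continuous_compact.
  apply: continuous_in_subspaceT => y; rewrite inE => /img; exact: cinv_cont.
apply: bounded_closed_compact.
  exists (rho + `|z|); split; first exact: num_real.
  move=> x xK y /= yz; rewrite -[y](subrK z) (le_trans (ler_normD _ _))//.
  by rewrite (le_trans _ (ltW xK))// lerD2r.
rewrite (_ : [set y | _] = (fun y => `|y - z|) @^-1` [set r | r <= rho])//.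
apply: (@closed_comp 'rV[R]_m R (fun y => `|y - z|) [set r | r <= rho]); last exact: closed_le.
by move=> y _; exact: continuous_dist.
Qed.

(** Exit from an open coordinate ball: the closed ball is compact, hence closed
    in the manifold, so the exit point has coordinates on the sphere instead of
    having left the domain of the chart. *)
Lemma exit_ball a c z (rho : R) :
  (forall y, `|y - z| <= rho -> (cmap a @` cdom a) y) ->
  (forall t : R, 0 <= t <= 1 -> {for t, continuous c}) ->
  cdom a (c 0) -> `|in_chart a c 0 - z| < rho ->
  (forall t, 0 <= t <= 1 -> cdom a (c t) /\ `|in_chart a c t - z| < rho) \/
  exists T : R, [/\ 0 < T <= 1,
    forall t, 0 <= t <= T -> cdom a (c t) /\ `|in_chart a c t - z| <= rho
    & `|in_chart a c T - z| = rho].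
Proof.
move=> img cc a0 u0.
pose W := [set x | cdom a x /\ `|cmap a x - z| < rho].
have Wo : open W.
  rewrite openE => x [ax xz].
  apply: filterS2 (open_nbhs_nbhs (conj (cdom_open a) ax))
    (_ : \forall y \near x, `|cmap a y - z| < rho) => [y ay yz//|].
  have : {for x, continuous (fun y => `|cmap a y - z|)}.
    exact: (continuous_comp (cmap_cont ax) (@continuous_dist _ _ z (cmap a x))).
  by move=> /cvgr_lt; exact.
have [stay|[T [/andP[T0 T1] before out]]] := exit_time Wo cc (conj a0 u0).
  by left.
right; exists T.
have TA : (cinv a @` [set y | `|y - z| <= rho]) (c T).
  apply: contrapT => nA.
  have nAo : open (~` (cinv a @` [set y | `|y - z| <= rho])).
    by apply: closed_openC; exact: cinv_ball_closed.
  have : \forall s \near T, (~` (cinv a @` [set y | `|y - z| <= rho])) (c s).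
    apply: cc; first by rewrite ltW.
    exact: open_nbhs_nbhs.
  move=> /near_norm[d d0 dA].
  pose s := T - Num.min (T / 2) (d / 2).
  have m0 : 0 < Num.min (T / 2) (d / 2) by rewrite lt_min !divr_gt0.
  have mT : Num.min (T / 2) (d / 2) <= T / 2 by rewrite ge_min lexx.
  have md : Num.min (T / 2) (d / 2) <= d / 2 by rewrite ge_min lexx orbT.
  have [as_ sz] : W (c s).
    by apply: before; apply/andP; split; rewrite /s; lra.
  have : (~` (cinv a @` [set y | `|y - z| <= rho])) (c s).
    apply: dA; rewrite /s addrAC subrr add0r normrN ger0_norm ?(ltW m0)//; lra.
  by apply; exists (cmap a (c s)); [exact: ltW|rewrite cmapK].
have [y yz ycT] := TA; have [x ax xy] := img y yz.
have aT : cdom a (c T) by rewrite -ycT -xy cmapK.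
have uT : in_chart a c T = y by rewrite /in_chart/= -ycT -xy cmapK.
split; first by rewrite T0.
  move=> t /andP[t0]; rewrite le_eqVlt => /predU1P[->|tT]; first by rewrite uT.
  by have [|? /ltW] := before t; rewrite ?t0.
apply/eqP; rewrite eq_le uT yz leNgt/=; apply/negP => yT; apply: out.
by split=> //; rewrite -[cmap a (c T)]/(in_chart a c T) uT.
Qed.

End ExitFromChartBall.

(** * Geodesics in a chart *)

Lemma bform_leibniz (R : realType) (m : nat) (D G : 'M[R]_m) (v w : 'rV[R]_m) :
  \sum_i \sum_j (D i j * v 0 i * v 0 j + G i j * - w 0 i * v 0 j
                  + G i j * v 0 i * - w 0 j)
  = bform D v v - bform G w v - bform G v w.
Proof.
rewrite !bformE -!sumrB; apply: eq_bigr => i _; rewrite -!sumrB.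
by apply: eq_bigr => j _; rewrite !mulrN mulNr.
Qed.

Section Geodesics.
Context {R : realType} {m : nat} {M : riemannian R m}.
Implicit Types (a : chart R m M) (c : R -> M) (z : 'rV[R]_m) (t : R).

Lemma is_derive_bigsum (f : 'I_m -> R -> R) (df : 'I_m -> R) t :
  (forall i, is_derive t 1 (f i) (df i)) ->
  is_derive t 1 (fun s => \sum_i f i s) (\sum_i df i).
Proof.
move=> fd; have := @is_derive_sum _ _ _ m f t 1 df fd.
by rewrite (_ : \sum_i f i = fun s => \sum_i f i s)//; apply/funext => s; rewrite fct_sumE.
Qed.

Lemma is_derive_mul3 (f g h : R -> R) (df dg dh t : R) :
  is_derive t 1 f df -> is_derive t 1 g dg -> is_derive t 1 h dh ->
  is_derive t 1 (fun s => f s * g s * h s)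
    (df * g t * h t + f t * dg * h t + f t * g t * dh).
Proof.
move=> fd gd hd; apply: is_derive_eq.
by rewrite /GRing.scale/=; ring.
Qed.

Lemma geodesic_near a c t : geodesic c -> atlas M a -> cdom a (c t) ->
  \forall s \near t, [/\ cdom a (c s), derivable (in_chart a c) s 1
    & derivable (derive1 (in_chart a c)) s 1].
Proof.
move=> [cc cg] aA act; have acs := near_cdom (cc t) act.
apply: filterS acs => s acs; split=> //.
- by have [/nbhs_singleton] := cg s a aA acs.
- by have [] := cg s a aA acs.
Qed.

Lemma geodesic_coord a c t k : geodesic c -> atlas M a -> cdom a (c t) ->
  is_derive t 1 (fun s => in_chart a c s 0 k) (derive1 (in_chart a c) t 0 k).
Proof.
move=> gc aA act; have [_ ud _] := nbhs_singleton (geodesic_near gc aA act).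
exact: coord_derive1.
Qed.

Lemma geodesic_accel a c t k : geodesic c -> atlas M a -> cdom a (c t) ->
  is_derive t 1 (fun s => derive1 (in_chart a c) s 0 k)
    (- gamma a (in_chart a c t) (derive1 (in_chart a c) t)
         (derive1 (in_chart a c) t) 0 k).
Proof.
move=> gc aA act; have [cc /(_ t a aA act)[_ ud2 ueq]] := gc.
have := coord_derive1 k ud2; rewrite ueq gammaE.
by [].
Qed.

(** In a chart, the derivative of the squared speed is
    [dgram u' u' u' + 2 g(u', u'')], and the geodesic equation makes the two
    terms cancel. *)
Lemma geodesic_speed_cst c t : geodesic c ->
  tnorm (c t) (velocity c t) = tnorm (c 0) (velocity c 0).
Proof.
move=> gc; suff E : tnorm (c t) (velocity c t) ^+ 2 = tnorm (c 0) (velocity c 0) ^+ 2.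
  exact: (@pexpIrn R 2 isT _ _ (tnorm_ge0 _ _) (tnorm_ge0 _ _) E).
apply: (@is_derive_0_is_cst R (fun t => tnorm (c t) (velocity c t) ^+ 2)) => {}t.
set a := chart_at (c t).
have aA : atlas M a by exact: chart_at_atlas.
have act : cdom a (c t) by exact: chart_at_dom.
set u := in_chart a c.
have cc := gc.1.
pose q s := \sum_i \sum_j gram a (u s) i j * derive1 u s 0 i * derive1 u s 0 j.
have qE : \forall s \near t, q s = tnorm (c s) (velocity c s) ^+ 2.
  apply: filterS (geodesic_near gc aA act) => s [acs us _].
  by rewrite (sqr_speed aA (cc s) acs us) bformE.
apply: (near_eq_is_derive qE).
set v := derive1 u t; set w := gamma a (u t) v v.
have az : (cmap a @` cdom a) (u t) by exists (c t).
have [_ ud _] := nbhs_singleton (geodesic_near gc aA act).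
rewrite -/u in ud.
have gd i j : is_derive t 1 (fun s => gram a (u s) i j) (dgram a (u t) v i j).
  rewrite dgramE; apply: (is_derive_chain _ ud).
  apply: smooth_on_C1 az; first exact: chart_image_open.
  exact: gram_smooth.
have := is_derive_bigsum (fun i => is_derive_bigsum (fun j =>
  is_derive_mul3 (gd i j) (geodesic_accel i gc aA act) (geodesic_accel j gc aA act))).
rewrite -/u -/v -/w bform_leibniz (dgram_gamma v v aA az) -/w.
rewrite (bformC w v (gram_tr a (u t))).
by rewrite mulr2n mulrDl mul1r addrK subrr.
Qed.

End Geodesics.

Lemma covariant_hessian_sum (R : realType) (m : nat) (H : 'I_m -> 'I_m -> R)
    (P : 'I_m -> R) (G : 'I_m -> 'I_m -> 'I_m -> R) (v : 'rV[R]_m) :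
  \sum_i (- (\sum_j \sum_k G j k i * v 0 j * v 0 k) * P i
          + v 0 i * \sum_j v 0 j * H i j)
  = \sum_i \sum_j (H i j - \sum_k P k * G i j k) * v 0 i * v 0 j.
Proof.
have -> : \sum_i \sum_j (H i j - \sum_k P k * G i j k) * v 0 i * v 0 j
    = \sum_i (v 0 i * \sum_j v 0 j * H i j)
      - \sum_i \sum_j \sum_k P k * G i j k * v 0 i * v 0 j.
  rewrite -sumrB; apply: eq_bigr => i _; rewrite mulr_sumr -sumrB.
  apply: eq_bigr => j _; rewrite !mulrBl !mulr_suml; congr (_ - _).
  by ring.
rewrite big_split/= addrC; congr (_ + _).
under eq_bigr => i _ do rewrite mulNr.
rewrite sumrN; congr (- _).
under [RHS]eq_bigr => i _ do rewrite exchange_big/=.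
rewrite [RHS]exchange_big/=; apply: eq_bigr => k _.
rewrite mulr_suml; apply: eq_bigr => i _; rewrite mulr_suml.
by apply: eq_bigr => j _; rewrite mulrC !mulrA.
Qed.

Lemma bilinear_sum_diff (R : realType) (m : nat) (A B : 'I_m -> 'I_m -> R)
    (v w : 'rV[R]_m) :
  \sum_i \sum_j A i j * v 0 i * v 0 j - \sum_i \sum_j B i j * w 0 i * w 0 j
  = \sum_i \sum_j (A i j - B i j) * v 0 i * v 0 j
    + (\sum_i \sum_j B i j * (v - w) 0 i * v 0 j
       + \sum_i \sum_j B i j * w 0 i * (v - w) 0 j).
Proof.
rewrite -sumrB -!big_split; apply: eq_bigr => i _ /=.
rewrite -sumrB -!big_split; apply: eq_bigr => j _ /=.
by rewrite !mxE; ring.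
Qed.

Lemma is_derive_mul2 (R : realType) (f g : R -> R) (df dg t : R) :
  is_derive t 1 f df -> is_derive t 1 g dg ->
  is_derive t 1 (fun s => f s * g s) (df * g t + f t * dg).
Proof.
move=> fd gd; apply: is_derive_eq; rewrite /GRing.scale/=.
by rewrite addrC [g t * _]mulrC.
Qed.

Section GeodesicEstimates.
Context {R : realType} {m : nat} {M : riemannian R m}.
Implicit Types (a : chart R m M) (c : R -> M) (z : 'rV[R]_m).

Lemma geodesic_length c : geodesic c ->
  curve_length c = tnorm (c 0) (velocity c 0).
Proof.
move=> gc; rewrite /curve_length.
rewrite (@eq_Rintegral _ _ _ _ _ (cst (tnorm (c 0) (velocity c 0)))) => [|t _].
  rewrite Rintegral_cst//= lebesgue_measure_itv/= lte_fin ltr01.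
  by rewrite sube0/= mulr1.
exact: geodesic_speed_cst.
Qed.

(** The metric dominates the coordinate norm and the speed is constant. *)
Lemma geodesic_coord_speed a zs (B : R) c t : chart_bounds a zs B -> 1 <= B ->
  atlas M a -> geodesic c -> cdom a (c t) -> `|in_chart a c t - zs| < B^-1 ->
  `|derive1 (in_chart a c) t| <= B * tnorm (c 0) (velocity c 0).
Proof.
move=> aB B1 aA gc act uB; have B0 : 0 < B by exact: lt_le_trans B1.
have [[_ nlow _ _] _] := aB _ _ uB uB.
have [_ ud _] := nbhs_singleton (geodesic_near gc aA act).
have := nlow (derive1 (in_chart a c) t).
rewrite -(sqr_speed aA (gc.1 t) act ud) (geodesic_speed_cst t gc).
set l := tnorm _ _; have l0 : 0 <= l by exact: tnorm_ge0.
move=> h; rewrite -(@ler_pXn2r _ 2) ?nnegrE ?mulr_ge0 ?(ltW B0)//.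
rewrite (le_trans h)// exprMn ler_wpM2r ?exprn_ge0//.
by rewrite expr2 ler_peMl// ltW.
Qed.

(** Up to a first exit from a smaller ball the coordinate speed is at most [B]
    times the speed, too slow to reach the sphere within unit time. *)
Lemma geodesic_stays a zs (B : R) c : chart_bounds a zs B -> 1 <= B ->
  atlas M a -> geodesic c -> cdom a (c 0) ->
  `|in_chart a c 0 - zs| < (2 * B)^-1 ->
  B * tnorm (c 0) (velocity c 0) < (2 * B)^-1 ->
  forall t, 0 <= t <= 1 -> cdom a (c t) /\ `|in_chart a c t - zs| < B^-1.
Proof.
move=> aB B1 aA gc ac0 u0 lB; have B0 : 0 < B by exact: lt_le_trans B1.
set rho := (2 * B)^-1 in u0 lB.
have rho2 : rho + rho = B^-1 by rewrite /rho; field; rewrite gt_eqF.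
have rho0 : 0 < rho by rewrite invr_gt0 mulr_gt0.
have near_zs y : `|y - in_chart a c 0| <= rho -> `|y - zs| < B^-1.
  move=> yu; rewrite -(subrKA (in_chart a c 0)) (le_lt_trans (ler_normD _ _))//.
  by rewrite -rho2 ler_ltD.
have := @exit_ball _ _ _ a c (in_chart a c 0) rho.
case=> [y yu||//||stay|[T [/andP[T0 T1] before out]]].
- by have [[]] := aB _ _ (near_zs y yu) (near_zs y yu).
- by move=> t _; exact: gc.1.
- by rewrite subrr normr0.
- by move=> t /stay[act ut]; split=> //; apply: near_zs; exact: ltW.
have bd t k : 0 <= t <= T -> `|derive1 (in_chart a c) t 0 k|
    <= B * tnorm (c 0) (velocity c 0).
  move=> /before[act ut]; apply: le_trans (coord_norm _ _) _.
  by apply: geodesic_coord_speed aB _ _ _ _ _ => //; exact: near_zs.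
have : `|in_chart a c T - in_chart a c 0| <= B * tnorm (c 0) (velocity c 0) * T.
  apply: rV_norm_le => [|k].
    by rewrite !mulr_ge0 ?(ltW B0) ?(ltW T0)// tnorm_ge0.
  have := @norm_le_of_derive _ (fun s => in_chart a c s 0 k)
    (fun s => derive1 (in_chart a c) s 0 k) _ T (ltW T0) _ (fun t => @bd t k) T.
  rewrite !mxE; apply; last by rewrite lexx ltW.
  by move=> t /before[act _]; exact: geodesic_coord.
rewrite out => h; exfalso; move: lB; apply/negP; rewrite -leNgt.
by rewrite (le_trans h)// ler_piMr// mulr_ge0 ?tnorm_ge0// ltW.
Qed.

(** Covariant Hessian of [f], so that [hess f u u' u'] is the second derivative
    of [f] along a geodesic. *)
Definition hess_coef a (f : 'rV[R]_m -> R) z i j : R :=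
  partial j (partial i f) z - \sum_k partial k f z * christoffel a z i j k.

Definition hess a f z (v : 'rV[R]_m) : R :=
  \sum_i \sum_j hess_coef a f z i j * v 0 i * v 0 j.

Lemma hess_coef_loc_lip a zs (U : set 'rV[R]_m) f i j : atlas M a ->
  (cmap a @` cdom a) zs -> open U -> U zs -> smooth_on U f ->
  loc_lip zs (fun z => hess_coef a f z i j).
Proof.
move=> aA azs Uo Uzs f_smooth.
have sm1 k := smooth_on_partial k f_smooth.
apply: loc_lipD.
  exact/loc_lip_C1/(smooth_on_C1 Uo)/Uzs/smooth_on_partial.
rewrite (_ : (fun _ => _) = (fun z => -1 * \sum_k partial k f z * christoffel a z i j k)).
  apply: loc_lipM; first exact: loc_lip_cst.
  apply: loc_lip_sum => k; apply: loc_lipM; last exact: christoffel_loc_lip.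
  exact/loc_lip_C1/(smooth_on_C1 Uo)/Uzs.
by apply/funext => z; rewrite mulN1r.
Qed.

(** Along a geodesic the first derivative of [f] is of size [l] and the second,
    [hess f u u' u'], varies by [O(l ^ 3)], where [l] is the speed. *)
Lemma geodesic_taylor a zs (U : set 'rV[R]_m) f : atlas M a ->
  (cmap a @` cdom a) zs -> open U -> U zs -> smooth_on U f ->
  \forall C \near +oo, forall c, geodesic c -> cdom a (c 0) ->
    `|in_chart a c 0 - zs| < C^-1 -> tnorm (c 0) (velocity c 0) < C^-1 ->
    let v := derive1 (in_chart a c) 0 in let u := in_chart a c in
    `|f (u 1) - f (u 0) - \sum_i v 0 i * partial i f (u 0) - 2^-1 * hess a f (u 0) v|
      <= C * tnorm (c 0) (velocity c 0) ^+ 3.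
Proof.
move=> aA azs Uo Uzs f_smooth.
have FF : Filter (+oo : set_system R) by exact: proper_pinfty_nbhs.
have hl i j := hess_coef_loc_lip i j aA azs Uo Uzs f_smooth.
have nH1 := filter_forall FF (fun i => filter_forall FF (fun j => loc_lip_near (hl i j))).
have nH2 := filter_forall FF (fun i => filter_forall FF (fun j => loc_lip_bounded (hl i j))).
have [d d0 dU] := (near_norm _ _).1 (open_nbhs_nbhs (conj Uo Uzs)).
have [B B1 [[hL hB] [aB dB]]] := pinfty_ex (filterI (filterI nH1 nH2)
  (filterI (near_chart_bounds aA azs) (near_ge d^-1))).
have B0 : 0 < B by exact: lt_le_trans B1.
set K := m%:R * m%:R * (B ^+ 4 + 2 * B ^+ 5).
have K0 : 0 <= K.
  by rewrite /K !mulr_ge0// addr_ge0 ?mulr_ge0 ?exprn_ge0// ltW.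
apply: (filterS _ (near_ge (2 * B * B + K))) => C CC c gc ac0 u0C lC.
set u := in_chart a c in u0C *; set v := derive1 u 0.
set l := tnorm (c 0) (velocity c 0) in lC *.
have l0 : 0 <= l by exact: tnorm_ge0.
have BB : 2 * B <= 2 * B * B by rewrite ler_peMr// mulr_ge0// ltW.
have BB0 : 0 <= 2 * B * B by rewrite !mulr_ge0// ltW.
have C2B : 2 * B <= C by apply: le_trans CC; lra.
have CBB : 2 * B * B <= C by apply: le_trans CC; lra.
have KC : K <= C by apply: le_trans CC; lra.
have st : forall t, 0 <= t <= 1 -> cdom a (c t) /\ `|u t - zs| < B^-1.
  apply: (geodesic_stays aB B1 aA gc ac0).
    by apply: lt_invW C2B u0C; rewrite mulr_gt0.
  rewrite -/l mulrC -ltr_pdivlMr//.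
  by rewrite -invfM; apply: lt_invW lC; rewrite ?mulr_gt0.
have vB t : 0 <= t <= 1 -> `|derive1 u t| <= B * l.
  by move=> /st[act ut]; exact: geodesic_coord_speed aB B1 aA gc act ut.
have ud t : 0 <= t <= 1 -> derivable u t 1.
  move=> /st[act _]; have [_ ud _] := nbhs_singleton (geodesic_near gc aA act).
  exact: ud.
have inU t : 0 <= t <= 1 -> U (u t).
  move=> /st[_ ut]; apply: dU; rewrite -[d]invrK; apply: lt_invW ut => //.
  by rewrite invr_gt0.
have d1 (t : R) : 0 <= t <= 1 -> is_derive t 1 (fun t => f (u t))
    (\sum_i derive1 u t 0 i * partial i f (u t)).
  move=> t01; apply: is_derive_chain (ud t t01).
  exact: (smooth_on_C1 Uo f_smooth (inU t t01)).
have d2 (t : R) : 0 <= t <= 1 -> is_derive t 1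
    (fun t => \sum_i derive1 u t 0 i * partial i f (u t)) (hess a f (u t) (derive1 u t)).
  move=> t01; have [act _] := st t t01.
  have pd i : is_derive t 1 (fun t => partial i f (u t))
      (\sum_j derive1 u t 0 j * partial j (partial i f) (u t)).
    apply: is_derive_chain (ud t t01).
    exact: (smooth_on_C1 Uo (smooth_on_partial i f_smooth) (inU t t01)).
  have acc i : is_derive t 1 (fun s => derive1 u s 0 i)
      (- \sum_j \sum_k christoffel a (u t) j k i * derive1 u t 0 j * derive1 u t 0 k).
    by rewrite -gammaE; exact: geodesic_accel.
  have := is_derive_bigsum (fun i => is_derive_mul2 (acc i) (pd i)).
  by rewrite covariant_hessian_sum.
have du t : 0 <= t <= 1 -> `|u t - u 0| <= B * l.
  move=> t01; have /andP[t0 t1] := t01.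
  apply: rV_norm_le => [|k]; first by rewrite mulr_ge0// ltW.
  have dk s : 0 <= s <= 1 -> `|derive1 u s 0 k| <= B * l.
    by move=> s01; apply: le_trans (coord_norm _ _) (vB s s01).
  have gk (s : R) : 0 <= s <= 1 -> is_derive s 1 (fun s => u s 0 k) (derive1 u s 0 k).
    by move=> /st[acs _]; exact: geodesic_coord.
  have := norm_le_of_derive ler01 gk dk t01.
  rewrite !mxE => /le_trans; apply.
  by rewrite ler_piMr// mulr_ge0// ltW.
have dv t : 0 <= t <= 1 -> `|derive1 u t - v| <= B ^+ 3 * l ^+ 2.
  move=> t01; have /andP[t0 t1] := t01.
  apply: rV_norm_le => [|k]; first by rewrite mulr_ge0// exprn_ge0// ltW.
  have gk (s : R) : 0 <= s <= 1 -> is_derive s 1 (fun s => derive1 u s 0 k)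
      (- gamma a (u s) (derive1 u s) (derive1 u s) 0 k).
    by move=> /st[acs _]; exact: geodesic_accel.
  have dk s : 0 <= s <= 1 ->
      `|- gamma a (u s) (derive1 u s) (derive1 u s) 0 k| <= B ^+ 3 * l ^+ 2.
    move=> s01; rewrite normrN (le_trans (coord_norm _ _))//.
    have [[_ _ _ gB] _] := aB _ _ (st s s01).2 (st s s01).2.
    rewrite (le_trans (gB _ _))// exprS -mulrA ler_pM2l// -exprMn expr2.
    by rewrite ler_pM// vB.
  have := norm_le_of_derive ler01 gk dk t01.
  rewrite !mxE => /le_trans; apply.
  by rewrite ler_piMr// mulr_ge0// exprn_ge0// ltW.
have t00 : ((0 : R) <= 0) && ((0 : R) <= 1) by rewrite lexx ler01.
have d2close t : 0 <= t <= 1 ->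
    `|hess a f (u t) (derive1 u t) - hess a f (u 0) v| <= K * l ^+ 3.
  move=> t01; rewrite /hess bilinear_sum_diff.
  have [_ utB] := st t t01; have [_ u0B] := st 0 t00.
  have h1 := sum2_bound (derive1 u t) (derive1 u t) (fun i j => hL i j _ _ utB u0B).
  have h2 := sum2_bound (derive1 u t - v) (derive1 u t) (fun i j => hB i j _ u0B).
  have h3 := sum2_bound v (derive1 u t - v) (fun i j => hB i j _ u0B).
  have e1 : B * `|u t - u 0| * (`|derive1 u t| * `|derive1 u t|)
      <= B ^+ 4 * l ^+ 3.
    rewrite (_ : B ^+ 4 * l ^+ 3 = B * (B * l) * (B * l * (B * l))); last by ring.
    by rewrite ler_pM ?mulr_ge0 ?(ltW B0) ?ler_pM2l ?du// ler_pM// vB.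
  have e2 : B * (`|derive1 u t - v| * `|derive1 u t|) <= B ^+ 5 * l ^+ 3.
    rewrite (_ : B ^+ 5 * l ^+ 3 = B * (B ^+ 3 * l ^+ 2 * (B * l))); last by ring.
    by rewrite ler_pM2l// ler_pM ?dv ?vB.
  have e3 : B * (`|v| * `|derive1 u t - v|) <= B ^+ 5 * l ^+ 3.
    rewrite (_ : B ^+ 5 * l ^+ 3 = B * (B * l * (B ^+ 3 * l ^+ 2))); last by ring.
    by rewrite ler_pM2l// ler_pM ?dv// /v vB.
  have mm : 0 <= m%:R * m%:R :> R by rewrite mulr_ge0.
  rewrite (le_trans (ler_normD _ _))// (le_trans (lerD h1 (ler_normD _ _)))//.
  rewrite (le_trans (lerD (lexx _) (lerD h2 h3)))//.
  rewrite (_ : K * l ^+ 3 = m%:R * m%:R * (B ^+ 4 * l ^+ 3)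
    + (m%:R * m%:R * (B ^+ 5 * l ^+ 3) + m%:R * m%:R * (B ^+ 5 * l ^+ 3))); last first.
    by rewrite /K; ring.
  rewrite -!(mulrA (m%:R * m%:R)).
  by rewrite lerD ?ler_wpM2l// lerD ?ler_wpM2l.
apply: le_trans (taylor2_of_derive2_close d1 d2 d2close) _.
by rewrite ler_wpM2r// exprn_ge0.
Qed.

End GeodesicEstimates.

(** * Speed and length of curves *)

Section IntegralBound.
Context {R : realType}.
Implicit Types (s phi : R -> R).

Lemma continuous_integrable01 s :
  (forall t : R, 0 <= t <= 1 -> {for t, continuous s}) ->
  lebesgue_measure.-integrable `[0, 1] (EFin \o s).
Proof.
move=> sc; apply: continuous_compact_integrable; first exact: segment_compact.
by apply: continuous_in_subspaceT => t; rewrite inE/= in_itv/=; exact: sc.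
Qed.

(** Multiplied by [k], the primitive of [s] grows at least as fast as [phi]. *)
Lemma increment_le_integral s phi dphi (k T : R) : 0 <= k -> 0 < T <= 1 ->
  (forall t : R, 0 <= t <= 1 -> {for t, continuous s}) ->
  (forall t, 0 <= t <= 1 -> 0 <= s t) ->
  (forall t : R, 0 <= t <= T -> is_derive t 1 phi (dphi t)) ->
  (forall t, 0 <= t <= T -> dphi t <= k * s t) ->
  phi T - phi 0 <= k * (\int[lebesgue_measure]_(t in `[0, 1]) s t)%R.
Proof.
move=> k0 /andP[T0 T1] sc s0 phid dphi_le.
have si := continuous_integrable01 sc.
pose S (t : R) : R := (\int[lebesgue_measure]_(x in `[0%R, t]) s x)%R.
have siT : lebesgue_measure.-integrable `[0, T] (EFin \o s).
  apply: integrableS si => //; apply: subset_itvl.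
  by rewrite bnd_simp.
have Sc : {within `[0, T], continuous S}.
  exact: (parameterized_integral_continuous (ltW T0) siT).
have Sd (t : R) : t \in `]0, T[ -> is_derive t 1 S (s t).
  rewrite in_itv/= => /andP[t0 tT].
  have tc : {for t, continuous s} by apply: sc; apply/andP; split; lra.
  have [Sd1 Sd2] := continuous_FTC1_closed (lt_le_trans tT T1) si t0 tc.
  by split; [exact: Sd1|rewrite -derive1E; exact: Sd2].
have phic : {within `[0, T], continuous phi}.
  apply: continuous_in_subspaceT => t; rewrite inE/= in_itv/= => /phid[pd _].
  exact/differentiable_continuous/derivable1_diffP.
have [] := @MVT_segment R (fun t => k * S t - phi t) (fun t => k * s t - dphi t) 0 T (ltW T0).
- move=> t tT; have := Sd t tT; move: tT; rewrite in_itv/= => /andP[t0 tT] ?.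
  have ? : is_derive t 1 phi (dphi t) by apply: phid; rewrite !ltW.
  by apply: is_derive_eq.
- move=> t; apply: cvgB; last exact: phic.
  by apply: cvgM; [exact: cvg_cst|exact: Sc].
move=> t; rewrite in_itv/= subr0 => tT E.
have dge0 : 0 <= (k * s t - dphi t) * T.
  by rewrite mulr_ge0 ?(ltW T0)// subr_ge0 dphi_le.
have S0 : S 0 = 0 by rewrite /S set_itv1 Rintegral_set1.
have ST : S T <= S 1.
  rewrite fine_le ?integrable_fin_num//; apply: ge0_subset_integral => //.
  - by case/integrableP: si.
  - move=> x; rewrite /= !in_itv/= => /andP[-> xT] /=; exact: le_trans xT T1.
move: E; rewrite S0 mulr0 sub0r opprK => E.
have : k * S T <= k * S 1 by rewrite ler_wpM2l.
rewrite -/(S 1); move: dge0; rewrite -E; lra.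
Qed.

End IntegralBound.

Section ContinuouslyDifferentiableCurves.
Context {R : realType} {m : nat} {M : riemannian R m}.
Implicit Types (a b : chart R m M) (c : R -> M).

(** Continuity is required of a [C1] curve at the times of [[0, 1]] only; next
    to the end points it follows from the derivability in a chart. *)
Lemma C1_curve_near a c (t : R) : C1_curve c -> 0 <= t <= 1 -> atlas M a ->
  cdom a (c t) -> \forall s \near t,
    [/\ cdom a (c s), {for s, continuous c} & derivable (in_chart a c) s 1].
Proof.
move=> c1 t01 aA act; have [cc /(_ a aA act)[ud _]] := c1 t t01.
have near_a := near_cdom cc act.
apply: filterS2 (near_join near_a) (filterI near_a ud) => s near_as [acs us].
split=> //.
have uc : {for s, continuous (in_chart a c)}.
  exact/differentiable_continuous/derivable1_diffP.
have im : (cmap a @` cdom a) (in_chart a c s) by exists (c s).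
apply: (@continuous_near_eq _ _ s (cinv a \o in_chart a c)).
  by apply: filterS near_as => r acr; rewrite /in_chart/= cmapK.
exact: (continuous_comp uc (cinv_cont im)).
Qed.

Lemma coord_cont (u : R -> 'rV[R]_m) (t : R) i :
  {for t, continuous u} -> {for t, continuous (fun s => u s 0 i)}.
Proof.
move=> uc; exact: (continuous_comp uc (@coord_continuous R 1 m 0 i (u t))).
Qed.

Lemma rV_continuous n (u : R -> 'rV[R]_n) (t : R) :
  (forall i, {for t, continuous (fun s => u s 0 i)}) -> {for t, continuous u}.
Proof.
move=> uc; apply/cvgrPdist_lt => e e0.
have ne (i : 'I_n) : \forall s \near t, `|u t 0 i - u s 0 i| < e.
  by have /cvgrPdist_lt := uc i; apply.
apply: filterS (filter_forall (nbhs_filter t) ne) => s us.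
by apply: rV_norm_lt => // i; rewrite !mxE.
Qed.

Lemma continuous_bigsum n (f : 'I_n -> R -> R) (t : R) :
  (forall i, {for t, continuous (f i)}) ->
  {for t, continuous (fun s => \sum_i f i s)}.
Proof.
by move=> fc; apply: cvg_big => [|i _]; [exact: add_continuous|exact: fc].
Qed.

Lemma C1_curve_speed_continuous c (t : R) : C1_curve c -> 0 <= t <= 1 ->
  {for t, continuous (fun s => tnorm (c s) (velocity c s))}.
Proof.
move=> c1 t01; set a := chart_at (c t).
have aA : atlas M a by exact: chart_at_atlas.
have act : cdom a (c t) by exact: chart_at_dom.
have [cc /(_ a aA act)[_ vc]] := c1 t t01.
have nearP := C1_curve_near c1 t01 aA act.
have [_ _ ud] := nbhs_singleton nearP.
pose u := in_chart a c.
have uc : {for t, continuous u} by exact/differentiable_continuous/derivable1_diffP.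
have az : (cmap a @` cdom a) (u t) by exists (c t).
apply: (@continuous_near_eq _ _ t (fun s => Num.sqrt (\sum_i \sum_j
    gram a (u s) i j * derive1 u s 0 i * derive1 u s 0 j))).
  apply: filterS nearP => s [acs cs us].
  rewrite -bformE -(sqr_speed aA cs acs us).
  by rewrite sqrtr_sqr ger0_norm// tnorm_ge0.
have qc : {for t, continuous (fun s => \sum_i \sum_j
    gram a (u s) i j * derive1 u s 0 i * derive1 u s 0 j)}.
  apply: continuous_bigsum => i; apply: continuous_bigsum => j.
  apply: continuousM; last exact: coord_cont vc.
  apply: continuousM; last exact: coord_cont vc.
  exact: (continuous_comp uc (smooth_on_continuous (gram_smooth i j aA) az)).
exact: (continuous_comp qc (@sqrt_continuous R _)).
Qed.

Lemma curve_length_ge0 c : 0 <= curve_length c.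
Proof. by apply: Rintegral_ge0 => t _; exact: tnorm_ge0. Qed.

Lemma curve_length_le c (L : R) : C1_curve c ->
  (forall t, 0 <= t <= 1 -> tnorm (c t) (velocity c t) <= L) ->
  curve_length c <= L.
Proof.
move=> c1 cL; have E : L = (\int[lebesgue_measure]_(t in `[0%R, 1%R]) (cst L) t)%R.
  by rewrite Rintegral_cst//= lebesgue_measure_itv/= lte_fin ltr01 sube0/= mulr1.
rewrite [leRHS]E; apply: le_Rintegral => //.
- by apply: continuous_integrable01 => t t01; exact: C1_curve_speed_continuous.
- by apply: continuous_integrable01 => t t01; exact: cst_continuous.
Qed.

Lemma dist_ge0 (x y : M) : 0 <= dist x y.
Proof.
rewrite /dist; set E := [set l | _].
have [->|/eqP/set0P En] := pselect (E = set0); first by rewrite inf0.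
by apply: lb_le_inf => // l [c [_ _ _ ->]]; exact: curve_length_ge0.
Qed.

Lemma dist_le_length c : C1_curve c -> dist (c 0) (c 1) <= curve_length c.
Proof.
move=> c1; apply: ge_inf; last by exists c.
by exists 0 => l [c' [_ _ _ ->]]; exact: curve_length_ge0.
Qed.

(** Any other chart sees the curve through a transition map, to which the chain
    rule applies. *)
Lemma coord_curve_C1 a (u : R -> 'rV[R]_m) : atlas M a ->
  (forall t : R, derivable u t 1 /\ {for t, continuous (derive1 u)}) ->
  (forall t : R, 0 <= t <= 1 -> (cmap a @` cdom a) (u t)) ->
  C1_curve (cinv a \o u) /\
  (forall t : R, 0 <= t <= 1 -> tnorm (cinv a (u t)) (velocity (cinv a \o u) t) ^+ 2
     = bform (gram a (u t)) (derive1 u t) (derive1 u t)).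
Proof.
move=> aA u1 uimg; set c := cinv a \o u.
have uc (t : R) : {for t, continuous u}.
  exact/differentiable_continuous/derivable1_diffP/(u1 t).1.
have near_img (t : R) : 0 <= t <= 1 -> \forall s \near t, (cmap a @` cdom a) (u s).
  move=> t01; apply: uc.
  exact: open_nbhs_nbhs (conj (chart_image_open a) (uimg t t01)).
have cE s : (cmap a @` cdom a) (u s) ->
    [/\ cdom a (c s), in_chart a c s = u s & {for s, continuous c}].
  move=> im; split; last exact: (continuous_comp (uc s) (cinv_cont im)).
    by case: im => x ax xu; rewrite /c/= -xu cmapK.
  by case: im => x ax xu; rewrite /in_chart /c/= -xu cmapK.
have near_c (t : R) : 0 <= t <= 1 -> \forall s \near t,
    [/\ cdom a (c s), {for s, continuous c}, derivable (in_chart a c) s 1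
      & derive1 (in_chart a c) s = derive1 u s].
  move=> t01; apply: filterS2 (near_img t t01) (near_join (near_img t t01)) => s ims nims.
  have [acs ucs cs] := cE s ims.
  have E : \forall r \near s, u r = in_chart a c r.
    by apply: filterS nims => r /cE[].
  split=> //; first exact: near_eq_derivable E (u1 s).1.
  by rewrite [RHS]derive1E (near_eq_derive _ E) -derive1E.
split=> [t t01|t t01]; last first.
  have [act ct ud vt] := nbhs_singleton (near_c t t01).
  rewrite -[cinv a (u t)]/(c t) (sqr_speed aA ct act ud) vt.
  by have [_ -> _] := cE t (uimg t t01).
have [act ct ud vt] := nbhs_singleton (near_c t t01).
split; first exact: ct.
move=> b bA bct.
have near_b := near_cdom ct bct.
have chain s : cdom b (c s) -> [/\ cdom a (c s), {for s, continuous c},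
    derivable (in_chart a c) s 1 & derive1 (in_chart a c) s = derive1 u s] ->
    derivable (in_chart b c) s 1 /\
    derive1 (in_chart b c) s = derive1 u s *m jac (cmap b \o cinv a) (cmap a (c s)).
  move=> bcs [acs cs us <-].
  exact: (curve_chain smooth_map_id aA bA cs acs bcs us).
split.
  by apply: filterS2 near_b (near_c t t01) => s bcs /(chain s bcs)[].
have smo := transition_smooth aA bA.
set V := [set cmap a x | x in _] in smo.
have Vo : open V by apply: cmap_image_open; exact: cdom_open.
have Vt : V (u t).
  exists (c t) => //.
  by have [_ <- _] := cE t (uimg t t01).
apply: (@continuous_near_eq _ _ t (fun s => derive1 u s *m jac (cmap b \o cinv a) (u s))).
  apply: filterS2 near_b (filterI (near_img t t01) (near_c t t01)) => s bcs [ims ncs].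
  have [_ ->] := chain s bcs ncs.
  by have [_ <- _] := cE s ims.
apply: rV_continuous => k.
apply: (@continuous_near_eq _ _ t (fun s => \sum_i derive1 u s 0 i *
    partial i (cmap b \o cinv a) (u s) 0 k)).
  by apply: (@filterE _ (nbhs t)) => s; rewrite mxE; apply: eq_bigr => i _; rewrite mxE.
apply: continuous_bigsum => i; apply: continuousM.
  exact: coord_cont (u1 t).2.
apply: coord_cont.
exact: (continuous_comp (uc t) (smooth_on_continuous (smooth_on_partial i smo) Vt)).
Qed.

End ContinuouslyDifferentiableCurves.

(** * Normal coordinates to second order *)

Lemma le_of_sqr_le (R : realType) (x y : R) : 0 <= y -> x ^+ 2 <= y ^+ 2 -> x <= y.
Proof.
move=> y0; rewrite !leNgt; apply: contraNN => yx.
by rewrite ltr_pXn2r// nnegrE// ltW// (le_lt_trans y0).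
Qed.

Lemma bform_rowE (R : realType) (m : nat) (G : 'M[R]_m) (v w : 'rV[R]_m) :
  bform G v w = \sum_k (v *m G) 0 k * w 0 k.
Proof. by rewrite /bform mxE; apply: eq_bigr => k _; rewrite [w^T _ _]mxE. Qed.

Lemma coordD (R : realType) (m : nat) (v w : 'rV[R]_m) k :
  (v + w) 0 k = v 0 k + w 0 k.
Proof. by rewrite mxE. Qed.

Lemma coordZ (R : realType) (m : nat) (s : R) (v : 'rV[R]_m) k :
  (s *: v) 0 k = s * v 0 k.
Proof. by rewrite mxE. Qed.

Lemma le_frame_factor (R : realType) (S Q B d rho v : R) : 0 <= B ->
  0 <= d -> d <= rho -> `|S - Q| <= B * (d ^+ 2 * v ^+ 2) -> v ^+ 2 <= B * S ->
  Q <= S * (1 + B ^+ 2 * rho ^+ 2).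
Proof.
move=> B0 d0 d_rho /ler_normlP[h _] vS.
have : d ^+ 2 * v ^+ 2 <= rho ^+ 2 * (B * S).
  by rewrite ler_pM ?sqr_ge0// ler_sqr ?nnegrE// (le_trans d0).
move=> /(ler_wpM2l B0) e.
rewrite (_ : S * _ = S + B * (rho ^+ 2 * (B * S))); [lra|ring].
Qed.

Section NormalCoordinates.
Context {R : realType} {m : nat} {M : riemannian R m}.
Implicit Types (b : chart R m M) (c : R -> M) (z v w : 'rV[R]_m).

(** Normal coordinates at [z0] up to second order, read in the chart [b]: the
    quadratic term absorbs the first derivatives of the metric at [z0]. *)
Definition normal_coord b z0 z : 'rV[R]_m :=
  (z - z0) + 2^-1 *: gamma b z0 (z - z0) (z - z0).

(** Differential of [normal_coord b z0] at [z], applied to [v]. *)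
Definition normal_frame b z0 z v : 'rV[R]_m := v + gamma b z0 (z - z0) v.

Lemma is_derive_normal_coord b z0 (u : R -> 'rV[R]_m) (t : R) k :
  derivable u t 1 ->
  is_derive t 1 (fun s => normal_coord b z0 (u s) 0 k)
    (normal_frame b z0 (u t) (derive1 u t) 0 k).
Proof.
move=> ud; pose w s := u s - z0.
have wd i : is_derive t 1 (fun s => w s 0 i) (derive1 u t 0 i).
  have := coord_derive1 i ud => udi.
  rewrite (_ : (fun s => w s 0 i) = (fun s => u s 0 i - z0 0 i)); last first.
    by apply/funext => s; rewrite !mxE.
  by apply: is_derive_eq; rewrite subr0.
have qd := is_derive_bigsum (fun i => is_derive_bigsum (fun j =>
  is_derive_mul3 (is_derive_cst (christoffel b z0 i j k) t 1) (wd i) (wd j))).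
have half := is_derive_mul2 (is_derive_cst (2^-1 : R) t 1) qd.
have sumd := is_deriveD (wd k) half.
have -> : (fun s => normal_coord b z0 (u s) 0 k) = (fun s => w s 0 k) + (fun s =>
    cst 2^-1 s * \sum_i \sum_j cst (christoffel b z0 i j k) s * w s 0 i * w s 0 j).
  by apply/funext => s; rewrite /normal_coord coordD coordZ gammaE.
apply: (@is_derive_eq _ _ _ _ _ _ _ _ sumd).
rewrite /normal_frame coordD gammaE; congr (_ + _).
rewrite mul0r add0r.
set x := derive1 u t; set y := w t.
have e : \sum_i \sum_j christoffel b z0 i j k * x 0 i * y 0 j
    = \sum_i \sum_j christoffel b z0 i j k * y 0 i * x 0 j.
  by rewrite -!gammaE gammaC.
under eq_bigr => i _ do under eq_bigr => j _ do rewrite !mul0r add0r.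
under eq_bigr => i _ do rewrite big_split/=.
rewrite big_split/= e -/(w t) -/y; move: (\sum_i _) => S; by field.
Qed.

(** The component of the normal coordinate along the direction of [xi] has a
    gradient of norm at most [1 + O(rho ^ 2)], by Cauchy-Schwarz and the last
    clause of [chart_bounds]. Integrating its derivative along the curve bounds
    the length from below. *)
Lemma normal_coord_le_length b zs (B : R) c (rho T : R) :
  chart_bounds b zs B -> 1 <= B -> atlas M b -> C1_curve c -> 0 < T <= 1 ->
  let u := in_chart b c in let z0 := u 0 in 0 <= rho ->
  (forall t, 0 <= t <= T ->
    [/\ cdom b (c t), `|u t - zs| < B^-1 & `|u t - z0| <= rho]) ->
  bform (gram b z0) (normal_coord b z0 (u T)) (normal_coord b z0 (u T)) <= (1 + B ^+ 2 * rho ^+ 2) * curve_length c ^+ 2.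
Proof.
move=> bB B1 bA c1 /andP[T0 T1] u z0 rho0 cT.
set xi := normal_coord b z0 (u T).
have B0 : 0 < B by exact: lt_le_trans B1.
have [bc0 u0B _] : [/\ cdom b (c 0), `|u 0 - zs| < B^-1 & `|u 0 - z0| <= rho].
  by apply: cT; rewrite lexx ltW.
set G := gram b z0; set N0 := bform G xi xi.
have az0 : (cmap b @` cdom b) z0 by exists (c 0).
have Gpos v : v != 0 -> 0 < bform G v v by exact: gram_pos.
have Gsym : G^T = G by exact: gram_tr.
have N00 : 0 <= N0 by exact: gram_ge0.
set f := 1 + B ^+ 2 * rho ^+ 2.
have f0 : 0 <= f by rewrite addr_ge0// mulr_ge0// exprn_ge0// ltW.
have t01 t : 0 <= t <= T -> 0 <= t <= 1.
  by move=> /andP[-> tT]; rewrite (le_trans tT).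
have ud t : 0 <= t <= T -> derivable u t 1.
  move=> tT; have [bct _ _] := cT t tT.
  by have [] := nbhs_singleton (C1_curve_near c1 (t01 t tT) bA bct).
pose phi (t : R) := \sum_k (xi *m G) 0 k * normal_coord b z0 (u t) 0 k.
pose dphi (t : R) := bform G xi (normal_frame b z0 (u t) (derive1 u t)).
have phid (t : R) : 0 <= t <= T -> is_derive t 1 phi (dphi t).
  move=> tT; have := is_derive_bigsum (fun k => is_derive_mul2
    (is_derive_cst ((xi *m G) 0 k) t 1) (is_derive_normal_coord b z0 k (ud t tT))).
  rewrite /dphi bform_rowE.
  by under eq_bigr => k _ do rewrite mul0r add0r.
have dphi_le t : 0 <= t <= T -> dphi t <= Num.sqrt (N0 * f) * tnorm (c t) (velocity c t).
  move=> tT; have [bct utB utr] := cT t tT.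
  apply: le_of_sqr_le; first by rewrite mulr_ge0 ?sqrtr_ge0.
  rewrite exprMn sqr_sqrtr ?mulr_ge0//.
  apply: le_trans (bform_CauchySchwarz xi _ Gsym Gpos) _.
  rewrite -/N0 -[N0 * f * _]mulrA ler_wpM2l//.
  have [_ ct _] := nbhs_singleton (C1_curve_near c1 (t01 t tT) bA bct).
  rewrite (sqr_speed bA ct bct (ud t tT)) -/u.
  have [[_ low _ _] [_ close]] := bB _ _ utB u0B.
  rewrite mulrC; exact: (le_frame_factor (ltW B0) _ _ (close _) (low _)).
have := increment_le_integral (sqrtr_ge0 (N0 * f)) (introT andP (conj T0 T1))
  (fun t => @C1_curve_speed_continuous _ _ _ c t c1) (fun t _ => tnorm_ge0 _ _)
  phid dphi_le.
have phiT : phi T = N0 by rewrite /phi -bform_rowE.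
have phi0 : phi 0 = 0.
  rewrite /phi -bform_rowE (_ : normal_coord b z0 (u 0) = 0).
    by rewrite /bform trmx0 mulmx0 mxE.
  rewrite /normal_coord -/z0 subrr add0r -(scale0r 0) gammaZl.
  by rewrite scale0r !scaler0.
rewrite phiT phi0 subr0 -/(curve_length c) => h.
have [N0z|N0n] := eqVneq N0 0.
  by rewrite N0z mulr_ge0 ?exprn_ge0// curve_length_ge0.
have N0p : 0 < N0 by rewrite lt0r N0n.
rewrite -(ler_pM2l N0p) -expr2 mulrA.
rewrite -[N0 * f]sqr_sqrtr ?mulr_ge0// -exprMn ler_sqr ?nnegrE//.
by rewrite mulr_ge0 ?sqrtr_ge0 ?curve_length_ge0.
Qed.

End NormalCoordinates.

Section DistanceExpansion.
Context {R : realType} {m : nat} {M : riemannian R m}.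
Implicit Types (b : chart R m M) (c : R -> M) (z v w : 'rV[R]_m).

(** Chart representation of the segment from [z0] to [z0 + w] in second-order
    normal coordinates, up to third order. *)
Definition bent_segment b z0 w (t : R) : 'rV[R]_m :=
  z0 + (t *: w + (2^-1 * (t * (1 - t))) *: gamma b z0 w w).

Lemma bent_segment_derive b z0 w (t : R) :
  derivable (bent_segment b z0 w) t 1 /\
  derive1 (bent_segment b z0 w) t = w + (2^-1 * (1 - 2 * t)) *: gamma b z0 w w.
Proof.
apply: derive1_of_coords => j.
rewrite (_ : (fun s => _) = (fun s : R => z0 0 j + (s * w 0 j
    + (2^-1 * (s * (1 - s))) * gamma b z0 w w 0 j))); last first.
  by apply/funext => s; rewrite /bent_segment !coordD !coordZ.
rewrite coordD coordZ; move: (gamma _ _ _ _ 0 j) => g.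
apply: is_derive_eq; rewrite /GRing.scale/=.
by field.
Qed.

Lemma bent_segment0 b z0 w : bent_segment b z0 w 0 = z0.
Proof. by rewrite /bent_segment mul0r mulr0 !scale0r !addr0. Qed.

Lemma bent_segment1 b z0 w : bent_segment b z0 w 1 = z0 + w.
Proof. by rewrite /bent_segment subrr mulr0 mulr0 scale0r scale1r addr0. Qed.

(** Velocity of the bent segment in the normal frame: constant up to third
    order in [w]. *)
Lemma bent_segment_frame b z0 w (t : R) : let g := gamma b z0 w w in
  normal_frame b z0 (bent_segment b z0 w t) (derive1 (bent_segment b z0 w) t)
  = (w + 2^-1 *: g) + ((2^-1 * (t * (2 - 3 * t))) *: gamma b z0 w g
      + (4^-1 * (t * (1 - t) * (1 - 2 * t))) *: gamma b z0 g g).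
Proof.
move=> g; have [_ ->] := bent_segment_derive b z0 w t.
rewrite /normal_frame /bent_segment [z0 + _ - z0]addrAC subrr add0r -/g.
rewrite gammaDl !gammaDr !gammaZl !gammaZr -/g (gammaC b z0 g w).
apply/rowP => k; rewrite !(coordD, coordZ).
move: (gamma b z0 w _ 0 k) (gamma b z0 g g 0 k) (g 0 k) (w 0 k) => A B' C' D.
by field.
Qed.

Lemma normal_coordE b z0 w :
  normal_coord b z0 (z0 + w) = w + 2^-1 *: gamma b z0 w w.
Proof. by rewrite /normal_coord [z0 + w - z0]addrAC subrr add0r. Qed.

End DistanceExpansion.

Lemma bform_sqrD_le (R : realType) (m : nat) (G : 'M[R]_m) (v e : 'rV[R]_m) (d : R) :
  G^T = G -> bform G v e <= d -> bform G e e <= d ->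
  bform G (v + e) (v + e) <= bform G v v + 3 * d.
Proof. by move=> Gsym ved eed; rewrite (bform_sqrD v e Gsym); lra. Qed.

Lemma le_of_close (R : realType) (S Q a b c d : R) :
  `|S - Q| <= a -> Q <= b + c -> a <= d -> S <= b + c + d.
Proof. by move=> /ler_normlP[_]; lra. Qed.

Section BentSegmentEstimates.
Context {R : realType} {m : nat} {M : riemannian R m}.
Implicit Types (b : chart R m M) (c : R -> M) (z v w : 'rV[R]_m).

Lemma normZ_le1 (k : R) (v : 'rV[R]_m) (d : R) : `|k| <= 1 -> `|v| <= d ->
  `|k *: v| <= d.
Proof.
move=> k1 vd; rewrite normrZ (le_trans _ vd)//.
by rewrite ler_piMl.
Qed.

Let dbl (x : R) : 2 * x = x + x. Proof. by ring. Qed.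

Lemma bent_coeffs (t : R) : 0 <= t <= 1 ->
  [/\ `|2^-1 * (t * (1 - t))| <= 1, `|2^-1 * (1 - 2 * t)| <= 1,
      `|2^-1 * (t * (2 - 3 * t))| <= 1
    & `|4^-1 * (t * (1 - t) * (1 - 2 * t))| <= 1].
Proof.
move=> /andP[t0 t1].
have p0 : 0 <= t * (1 - t) by rewrite mulr_ge0// subr_ge0.
have p1 : t * (1 - t) <= 1 by rewrite mulr_ile1// ?subr_ge0// lerBlDl lerDr.
have q1 : - 1 <= t * (2 - 3 * t) <= 2 by apply/andP; split; nra.
have [q2 q3] := andP q1.
have r1 : `|t * (1 - t) * (1 - 2 * t)| <= 1.
  have s1 : `|1 - 2 * t| <= 1 by rewrite ler_norml; apply/andP; split; lra.
  by rewrite normrM mulr_ile1// ger0_norm.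
move: r1; rewrite ler_norml => /andP[r1 r2].
by split; rewrite ler_norml; apply/andP; split; lra.
Qed.

Lemma normal_coord_norm b zs (B : R) z0 w : chart_bounds b zs B -> 0 < B ->
  `|z0 - zs| < B^-1 -> B * `|w| <= 1 ->
  `|gamma b z0 w w| <= `|w| /\ `|w + 2^-1 *: gamma b z0 w w| <= 2 * `|w|.
Proof.
move=> bB B0 z0B w1; have [[_ _ _ gB] _] := bB _ _ z0B z0B.
have gw : `|gamma b z0 w w| <= `|w|.
  by rewrite (le_trans (gB _ _))// mulrA ler_piMl.
split=> //; rewrite (dbl `|w|) (le_trans (ler_normD _ _))// lerD//.
by apply: normZ_le1 => //; rewrite ger0_norm; lra.
Qed.

Lemma bent_segment_norm b zs (B : R) z0 w (t : R) : chart_bounds b zs B ->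
  0 < B -> `|z0 - zs| < B^-1 -> B * `|w| <= 1 -> 0 <= t <= 1 ->
  `|bent_segment b z0 w t - z0| <= 2 * `|w|.
Proof.
move=> bB B0 z0B w1 t01; have [gw _] := normal_coord_norm bB B0 z0B w1.
have [c1 _ _ _] := bent_coeffs t01.
rewrite /bent_segment addrAC subrr add0r (dbl `|w|).
rewrite (le_trans (ler_normD _ _))// lerD//; apply: normZ_le1 => //.
by case/andP: t01 => t0 t1; rewrite ger0_norm.
Qed.

(** By [bent_segment_frame] the velocity measured at [z0] is the normal coordinate
    of the end point plus a vector of size [O(|w| ^ 3)]. *)
Lemma bent_segment_speed b zs (B : R) z0 w (t : R) : chart_bounds b zs B ->
  1 <= B -> `|z0 - zs| < B^-1 -> B * `|w| <= 1 -> 0 <= t <= 1 ->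
  `|bent_segment b z0 w t - zs| < B^-1 ->
  bform (gram b (bent_segment b z0 w t)) (derive1 (bent_segment b z0 w) t)
      (derive1 (bent_segment b z0 w) t)
    <= bform (gram b z0) (normal_coord b z0 (z0 + w)) (normal_coord b z0 (z0 + w))
       + 28 * B ^+ 3 * `|w| ^+ 4.
Proof.
move=> bB B1 z0B w1 t01 utB; have B0 : 0 < B by exact: lt_le_trans B1.
have [gw xw] := normal_coord_norm bB B0 z0B w1.
have uw := bent_segment_norm bB B0 z0B w1 t01.
have [c1 c2 c3 c4] := bent_coeffs t01.
have [[_ _ _ _] [_ close]] := bB _ _ utB z0B.
have [[_ _ fB gB] _] := bB _ _ z0B z0B.
have vw : `|derive1 (bent_segment b z0 w) t| <= 2 * `|w|.
  have [_ ->] := bent_segment_derive b z0 w t.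
  rewrite (dbl `|w|) (le_trans (ler_normD _ _))// lerD//.
  exact: normZ_le1.
move: (close (derive1 (bent_segment b z0 w) t)).
rewrite -/(normal_frame b z0 (bent_segment b z0 w t) (derive1 (bent_segment b z0 w) t)).
rewrite bent_segment_frame normal_coordE.
move: (derive1 (bent_segment b z0 w) t) vw => v vw.
set W := `|w| in uw vw gw xw w1 *; have W0 : 0 <= W by exact: normr_ge0.
set e := _ *: _ + _ *: _; set xi := w + _ in xw *.
have e_small : `|e| <= 2 * B ^+ 2 * W ^+ 3.
  have g2 : `|gamma b z0 w w| <= B * (W * W) by exact: gB.
  rewrite (_ : 2 * _ * _ = B * (W * (B * (W * W))) + B * (W * (B * (W * W)))); last by ring.
  rewrite (le_trans (ler_normD _ _))// lerD//; apply: normZ_le1 => //.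
    by rewrite (le_trans (gB _ _))// ler_pM2l// ler_wpM2l.
  by rewrite (le_trans (gB _ _))// ler_pM2l// ler_pM.
have cross : bform (gram b z0) xi e <= 4 * B ^+ 3 * W ^+ 4.
  rewrite (le_trans (ler_norm _))// (le_trans (fB _ _))//.
  rewrite (_ : 4 * _ * _ = B * (2 * W * (2 * B ^+ 2 * W ^+ 3))); last by ring.
  by rewrite ler_pM2l// ler_pM.
have BW : B ^+ 5 * W ^+ 6 <= B ^+ 3 * W ^+ 4.
  rewrite (_ : B ^+ 5 * _ = (B ^+ 3 * W ^+ 4) * ((B * W) * (B * W))); last by ring.
  have BW0 : 0 <= B * W by rewrite mulr_ge0// ltW.
  rewrite ler_piMr ?mulr_ge0 ?exprn_ge0 ?(ltW B0)//.
  by rewrite mulr_ile1.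
have square : bform (gram b z0) e e <= 4 * B ^+ 3 * W ^+ 4.
  rewrite (le_trans (ler_norm _))// (le_trans (fB _ _))//.
  apply: (@le_trans _ _ (B * (2 * B ^+ 2 * W ^+ 3 * (2 * B ^+ 2 * W ^+ 3)))).
    by rewrite ler_pM2l// ler_pM.
  rewrite (_ : B * _ = 4 * (B ^+ 5 * W ^+ 6)); last by ring.
  by rewrite -mulrA ler_wpM2l.
have Qle := bform_sqrD_le (gram_tr b z0) cross square.
have close2 : B * (`|bent_segment b z0 w t - z0| ^+ 2 * `|v| ^+ 2) <= 16 * B ^+ 3 * W ^+ 4.
  apply: (@le_trans _ _ (B * ((2 * W) ^+ 2 * (2 * W) ^+ 2))).
    rewrite ler_pM2l//; apply: ler_pM; rewrite ?exprn_ge0//.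
      by rewrite ler_sqr ?nnegrE ?mulr_ge0.
    by rewrite ler_sqr ?nnegrE ?mulr_ge0.
  rewrite (_ : B * _ = 16 * W ^+ 4 * B); last by ring.
  rewrite (_ : 16 * B ^+ 3 * W ^+ 4 = 16 * W ^+ 4 * (B ^+ 3)); last by ring.
  by rewrite ler_wpM2l ?mulr_ge0 ?exprn_ge0// ler_eXnr.
move=> hS; apply: le_trans (le_of_close hS Qle close2) _.
by rewrite -addrA lerD2l le_eqVlt; apply/orP; left; apply/eqP; ring.
Qed.

End BentSegmentEstimates.

(** * Expansion of the squared distance *)

(** Arithmetic of a curve that stays in the ball of radius [6 * B * W]: [k2] is the
    square of the normal coordinate of its end point, [l2] of its length. *)
Lemma sqr_gap_stay (R : realType) (k2 l2 B W : R) : 0 <= B -> 0 <= l2 -> 0 <= W ->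
  k2 <= (1 + B ^+ 2 * (6 * B * W) ^+ 2) * l2 -> k2 <= 4 * B * W ^+ 2 ->
  k2 - 144 * B ^+ 5 * W ^+ 4 <= l2.
Proof.
move=> B0 l20 W0 h1 h2; have [kl|lk] := leP k2 l2.
  by rewrite lerBlDr (le_trans kl)// lerDl !mulr_ge0 ?exprn_ge0.
set f := B ^+ 2 * (6 * B * W) ^+ 2 in h1.
have f0 : 0 <= f by rewrite mulr_ge0 ?sqr_ge0.
have h3 : f * l2 <= f * (4 * B * W ^+ 2).
  by rewrite ler_wpM2l// (le_trans (ltW lk)).
rewrite (_ : 144 * B ^+ 5 * W ^+ 4 = f * (4 * B * W ^+ 2)); last by rewrite /f; ring.
move: h1 h3; rewrite mulrDl mul1r; lra.
Qed.

(** Arithmetic of a curve that reaches the sphere of radius [6 * B * W]: [n] is the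
    norm and [x2] the metric square of the normal coordinate of the exit point. *)
Lemma sqr_gap_exit (R : realType) (k2 l2 x2 n B W : R) : 1 <= B -> 0 <= l2 ->
  0 <= W -> 6 * B ^+ 2 * W <= 1 ->
  x2 <= (1 + B ^+ 2 * (6 * B * W) ^+ 2) * l2 -> n ^+ 2 <= B * x2 ->
  3 * B * W <= n -> k2 <= 4 * B * W ^+ 2 -> k2 <= l2.
Proof.
move=> B1 l20 W0 BW h1 h2 h3 h4; have B0 : 0 < B by exact: lt_le_trans B1.
have s1 : (6 * B ^+ 2 * W) ^+ 2 <= 1.
  by rewrite expr_le1// mulr_ge0// mulr_ge0// ?exprn_ge0// ltW.
have h5 : x2 <= 2 * l2.
  apply: le_trans h1 _; rewrite ler_wpM2r//.
  rewrite (_ : B ^+ 2 * _ = (6 * B ^+ 2 * W) ^+ 2); [lra|ring].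
have h6 : (3 * B * W) ^+ 2 <= n ^+ 2.
  have p : 0 <= 3 * B * W by rewrite mulr_ge0// mulr_ge0// ltW.
  by rewrite ler_sqr ?nnegrE// (le_trans p).
have h7 : B * x2 <= B * (2 * l2) by rewrite ler_pM2l.
have h8 : B * (9 * B * W ^+ 2) <= B * (2 * l2).
  rewrite (_ : B * (9 * B * W ^+ 2) = (3 * B * W) ^+ 2); last by ring.
  exact: le_trans h6 (le_trans h2 h7).
rewrite ler_pM2l// in h8.
have q : 0 <= B * W ^+ 2 by rewrite mulr_ge0 ?sqr_ge0 ?ltW.
move: h4 h8 q; rewrite -!mulrA; move: (B * _) => y; lra.
Qed.

Section DistanceExpansionNearPoint.
Context {R : realType} {m : nat} {M : riemannian R m}.
Implicit Types (b : chart R m M) (c : R -> M) (z v w : 'rV[R]_m).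

(** In a small ball the quadratic term is at most half of the linear one. *)
Lemma normal_coord_lower b z0 z (B r : R) :
  `|gamma b z0 (z - z0) (z - z0)| <= B * (r * r) -> `|z - z0| = r ->
  B * (r * r) <= r -> r / 2 <= `|normal_coord b z0 z|.
Proof.
rewrite /normal_coord; set g := gamma _ _ _ _; set y := z - z0 => gr yr Br.
have := ler_normB (y + 2^-1 *: g) (2^-1 *: g).
by rewrite addrK normrZ ger0_norm ?invr_ge0// yr; lra.
Qed.

Lemma bent_segment_C1 b z0 w (t : R) : derivable (bent_segment b z0 w) t 1 /\
  {for t, continuous (derive1 (bent_segment b z0 w))}.
Proof.
have [ud _] := bent_segment_derive b z0 w t; split; first exact: ud.
apply: rV_continuous => i.
apply: (@continuous_near_eq _ _ t (fun s => w 0 i + (2^-1 * (1 - 2 * s)) * gamma b z0 w w 0 i)).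
  apply: (@filterE _ (nbhs t)) => s.
  by have [_ ->] := bent_segment_derive b z0 w s; rewrite coordD coordZ.
apply: cvgD; first exact: cvg_cst.
apply: cvgM; last exact: cvg_cst.
apply: cvgM; first exact: cvg_cst.
apply: cvgB; first exact: cvg_cst.
by apply: cvgM; [exact: cvg_cst|exact: cvg_id].
Qed.

Section Estimates.
Variables (b : chart R m M) (zs z0 z1 : 'rV[R]_m) (B : R).
Hypotheses (bA : atlas M b) (bB : chart_bounds b zs B) (B1 : 1 <= B).
Let w := z1 - z0.
Hypotheses (z0B : `|z0 - zs| < (2 * B)^-1) (w1 : 12 * B ^+ 2 * `|w| < 1).

Let B0 : 0 < B. Proof. exact: lt_le_trans B1. Qed.
Let W0 : 0 <= `|w|. Proof. exact: normr_ge0. Qed.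
Let z1E : z0 + w = z1. Proof. by rewrite addrC subrK. Qed.

Let Bw1 : B * `|w| <= 1.
Proof.
apply: le_trans (ltW w1); rewrite ler_wpM2r//.
have : B * 1 <= B * B by rewrite ler_pM2l.
rewrite expr2; move: B0 (B * B) => ? x; lra.
Qed.

Let ball_B z : `|z - z0| <= 6 * B * `|w| -> `|z - zs| < B^-1.
Proof.
move=> zz0; rewrite -(subrKA z0) (le_lt_trans (ler_normD _ _))//.
have -> : B^-1 = (2 * B)^-1 + (2 * B)^-1 by field; rewrite gt_eqF.
rewrite addrC ltr_leD// (le_trans zz0)// -[(2 * B)^-1]mul1r ler_pdivlMr ?mulr_gt0//.
by rewrite (_ : _ * (2 * B) = 12 * B ^+ 2 * `|w|) ?ltW//; ring.
Qed.

Let z0B' : `|z0 - zs| < B^-1.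
Proof. by apply: ball_B; rewrite subrr normr0 !mulr_ge0// ltW. Qed.

Let img z : `|z - zs| < B^-1 -> (cmap b @` cdom b) z.
Proof. by move=> zB; have [[]] := bB zB zB. Qed.

Let k2 := bform (gram b z0) (normal_coord b z0 z1) (normal_coord b z0 z1).

Let k2_le : k2 <= 4 * B * `|w| ^+ 2.
Proof.
have [_ xw] := normal_coord_norm bB B0 z0B' Bw1.
have [[_ _ fB _] _] := bB z0B' z0B'.
rewrite /k2 -{1 2}z1E normal_coordE (le_trans (ler_norm _))//.
rewrite (le_trans (fB _ _))//.
apply: (@le_trans _ _ (B * (2 * `|w| * (2 * `|w|)))); first by rewrite ler_pM2l// ler_pM.
by rewrite le_eqVlt; apply/orP; left; apply/eqP; ring.
Qed.

Lemma short_curve_exists : exists c, [/\ C1_curve c, c 0 = cinv b z0,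
  c 1 = cinv b z1 & curve_length c <= Num.sqrt (k2 + 28 * B ^+ 3 * `|w| ^+ 4)].
Proof.
pose u := bent_segment b z0 w.
have uB (t : R) : 0 <= t <= 1 -> `|u t - zs| < B^-1.
  move=> t01; apply: ball_B.
  apply: le_trans (bent_segment_norm bB B0 z0B' Bw1 t01) _.
  by rewrite ler_wpM2r//; move: B1; lra.
have u1 t := bent_segment_C1 b z0 w t.
have [c1 cs] := coord_curve_C1 bA u1 (fun t t01 => img (uB t t01)).
exists (cinv b \o u); split; first exact: c1.
- by rewrite /= /u bent_segment0.
- by rewrite /= /u bent_segment1 z1E.
apply: curve_length_le => // t t01.
rewrite -[leLHS]ger0_norm ?tnorm_ge0// -sqrtr_sqr.
apply: ler_wsqrtr; rewrite [X in X <= _](cs t t01).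
apply: le_trans (bent_segment_speed bB B1 z0B' Bw1 t01 (uB t t01)) _.
by rewrite z1E.
Qed.

(** A curve may leave the region where the chart is controlled, but only after
    having crossed a ball large enough for its length to exceed the normal
    coordinate of [z1] anyway. *)
Lemma curve_length_ge c : C1_curve c -> c 0 = cinv b z0 -> c 1 = cinv b z1 ->
  k2 - 144 * B ^+ 5 * `|w| ^+ 4 <= curve_length c ^+ 2.
Proof.
move=> c1 c0E c1E; have [W00|Wn0] := eqVneq `|w| 0.
  have k20 : k2 <= 0 by apply: le_trans k2_le _; rewrite W00 expr0n mulr0.
  by rewrite W00 expr0n/= mulr0 subr0 (le_trans k20)// sqr_ge0.
have W1 : 0 < `|w| by rewrite lt0r Wn0.
(* The radius is such that reaching the sphere costs a length of at least
   [rho / sqrt (8 * B)], which exceeds the bound [2 * sqrt B * |w|] on the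
   normal coordinate of [z1]. *)
pose rho := 6 * B * `|w|.
have rho0 : 0 < rho by rewrite !mulr_gt0.
have az0 := img z0B'.
have uc z : (cmap b @` cdom b) z -> cdom b (cinv b z) /\ cmap b (cinv b z) = z.
  by move=> [x bx <-]; rewrite cmapK.
have bc0 : cdom b (c 0) by rewrite c0E; case: (uc z0 az0).
have u0 : in_chart b c 0 = z0 by rewrite /in_chart/= c0E; case: (uc z0 az0).
have z1B : `|z1 - zs| < B^-1.
  by apply: ball_B; rewrite -/w ler_peMl//; move: B1; lra.
have u1 : in_chart b c 1 = z1 by rewrite /in_chart/= c1E; case: (uc z1 (img z1B)).
have l20 : 0 <= curve_length c ^+ 2 by exact: sqr_ge0.
have bound (T : R) : 0 < T <= 1 -> (forall t, 0 <= t <= T ->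
    cdom b (c t) /\ `|in_chart b c t - z0| <= rho) ->
    bform (gram b z0) (normal_coord b z0 (in_chart b c T))
      (normal_coord b z0 (in_chart b c T))
    <= (1 + B ^+ 2 * rho ^+ 2) * curve_length c ^+ 2.
  move=> T01 before; rewrite -{1 2 3}u0.
  apply: (normal_coord_le_length bB B1 bA c1 T01 (ltW rho0)) => t /before[bct ut].
  by rewrite u0; split; [exact: bct|exact: ball_B|exact: ut].
have [stay|[T [T01 before out]]] : (forall t, 0 <= t <= 1 ->
    cdom b (c t) /\ `|in_chart b c t - z0| < rho) \/ exists T : R, [/\ 0 < T <= 1,
    forall t, 0 <= t <= T -> cdom b (c t) /\ `|in_chart b c t - z0| <= rho
    & `|in_chart b c T - z0| = rho].
- apply: exit_ball => //.
  + by move=> y yz; apply: img; exact: ball_B.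
  + by move=> t /c1[].
  + by rewrite u0 subrr normr0.
- apply: sqr_gap_stay k2_le => //; first exact: ltW.
  have := bound 1; rewrite u1; apply; first by rewrite ltr01 lexx.
  by move=> t /stay[bct /ltW].
have BBw : 6 * B ^+ 2 * `|w| < 1.
  apply: le_lt_trans w1; rewrite ler_wpM2r// ler_wpM2r ?exprn_ge0 ?ler_nat//.
  exact: ltW.
have kl : k2 <= curve_length c ^+ 2.
  apply: (@sqr_gap_exit _ _ _ _ `|normal_coord b z0 (in_chart b c T)|
    B `|w| B1 l20 W0 _ (bound T T01 before)) k2_le => //.
  - exact: ltW.
  - by have [[_ low _ _] _] := bB z0B' z0B'; exact: low.
  - have [[_ _ _ gB] _] := bB z0B' z0B'.
    have h := gB (in_chart b c T - z0) (in_chart b c T - z0).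
    rewrite out in h.
    rewrite (_ : 3 * B * `|w| = rho / 2); last by rewrite /rho; field.
    apply: (normal_coord_lower h out).
    rewrite (_ : B * _ = rho * (6 * B ^+ 2 * `|w|)); last by rewrite /rho; ring.
    by rewrite ler_piMr// ltW.
by rewrite (le_trans _ kl) ?lerBlDr ?lerDl ?mulr_ge0 ?exprn_ge0 ?(ltW B0).
Qed.

Lemma dist_sqr_close : 
  `|dist (cinv b z0) (cinv b z1) ^+ 2 - k2| <= (28 * B ^+ 3 + 144 * B ^+ 5) * `|w| ^+ 4.
Proof.
have [c [c1 c0E c1E cl]] := short_curve_exists.
have d0 := dist_ge0 (cinv b z0) (cinv b z1).
have k20 : 0 <= k2 by exact: gram_ge0.
have p3 : 0 <= 28 * B ^+ 3 * `|w| ^+ 4 by rewrite !mulr_ge0 ?exprn_ge0// ltW.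
have p5 : 0 <= 144 * B ^+ 5 * `|w| ^+ 4 by rewrite !mulr_ge0 ?exprn_ge0// ltW.
have up : dist (cinv b z0) (cinv b z1) ^+ 2 <= k2 + 28 * B ^+ 3 * `|w| ^+ 4.
  rewrite -[leRHS]sqr_sqrtr ?addr_ge0// ler_sqr ?nnegrE ?sqrtr_ge0//.
  by apply: le_trans cl; rewrite -c0E -c1E; exact: dist_le_length.
have low : k2 - 144 * B ^+ 5 * `|w| ^+ 4 <= dist (cinv b z0) (cinv b z1) ^+ 2.
  have [neg|pos] := leP (k2 - 144 * B ^+ 5 * `|w| ^+ 4) 0.
    by rewrite (le_trans neg)// sqr_ge0.
  rewrite -[leLHS]sqr_sqrtr ?(ltW pos)// ler_sqr ?nnegrE ?sqrtr_ge0//.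
  apply: lb_le_inf; first by exists (curve_length c), c.
  move=> l [c' [c1' c0' c1E' ->]].
  rewrite -[leRHS]ger0_norm ?curve_length_ge0// -sqrtr_sqr ler_wsqrtr//.
  exact: curve_length_ge.
rewrite mulrDl ler_norml; apply/andP; split; lra.
Qed.

End Estimates.

(** The bent segment bounds the distance from above, and any other curve is
    almost as long. *)
Lemma near_dist_expansion b zs : atlas M b -> (cmap b @` cdom b) zs ->
  \forall C \near +oo, forall z0 z1, `|z0 - zs| < C^-1 -> `|z1 - zs| < C^-1 ->
    `|dist (cinv b z0) (cinv b z1) ^+ 2
      - bform (gram b z0) (normal_coord b z0 z1) (normal_coord b z0 z1)|
    <= C * `|z1 - z0| ^+ 4.
Proof.
move=> bA bzs; have [B B1 bB] := pinfty_ex (near_chart_bounds bA bzs).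
have B0 : 0 < B by exact: lt_le_trans B1.
apply: (filterS _ (near_ge (24 * B ^+ 2 + (28 * B ^+ 3 + 144 * B ^+ 5)))) => C CC z0 z1 z0C z1C.
have p2 : 0 < B ^+ 2 by rewrite exprn_gt0.
have p3 : 0 < B ^+ 3 by rewrite exprn_gt0.
have p5 : 0 < B ^+ 5 by rewrite exprn_gt0.
have C0 : 0 < C by apply: lt_le_trans CC; lra.
apply: (@le_trans _ _ ((28 * B ^+ 3 + 144 * B ^+ 5) * `|z1 - z0| ^+ 4)); last first.
  by rewrite ler_wpM2r ?exprn_ge0// (le_trans _ CC)// lerDr mulr_ge0 ?ltW.
apply: (dist_sqr_close bA bB B1).
  apply: lt_invW z0C; first by rewrite mulr_gt0.
  apply: le_trans CC; have : B * 1 <= B * B by rewrite ler_pM2l.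
  by rewrite -expr2; lra.
have : `|z1 - z0| < C^-1 + C^-1.
  rewrite -(subrKA zs) (le_lt_trans (ler_normD _ _))// ltrD//.
  by rewrite distrC.
rewrite -(ltr_pM2l (_ : 0 < 12 * B ^+ 2)) ?mulr_gt0//; move=> h.
apply: lt_le_trans h _.
rewrite (_ : 12 * B ^+ 2 * (C^-1 + C^-1) = 24 * B ^+ 2 / C); last by ring.
by rewrite ler_pdivrMr// mul1r; lra.
Qed.

End DistanceExpansionNearPoint.

(** * Cubic forms *)

Section CubicForms.
Context {R : realType} {m : nat}.
Implicit Types (P Q : 'rV[R]_m -> R) (L : 'cV[R]_m).

(** Sums of products of three linear forms; this is the shape in which the
    third-order Laplacian condition annihilates them. *)
Definition cubic_form P : Prop :=
  exists s : seq ('cV[R]_m * 'cV[R]_m * 'cV[R]_m), forall v,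
    P v = \sum_(L <- s) (v *m L.1.1) 0 0 * (v *m L.1.2) 0 0 * (v *m L.2) 0 0.

Lemma cubic_formM L1 L2 L3 :
  cubic_form (fun v => (v *m L1) 0 0 * (v *m L2) 0 0 * (v *m L3) 0 0).
Proof. by exists [:: (L1, L2, L3)] => v; rewrite big_seq1. Qed.

Lemma cubic_formD P Q : cubic_form P -> cubic_form Q ->
  cubic_form (fun v => P v + Q v).
Proof. by move=> [s Ps] [t Qt]; exists (s ++ t) => v; rewrite big_cat -Ps -Qt. Qed.

Lemma cubic_form0 : cubic_form (fun=> 0).
Proof. by exists [::] => v; rewrite big_nil. Qed.

Lemma cubic_formZ (k : R) P : cubic_form P -> cubic_form (fun v => k * P v).
Proof.
move=> [s Ps]; exists [seq (k *: F.1.1, F.1.2, F.2) | F <- s] => v.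
rewrite Ps mulr_sumr big_map; apply: eq_bigr => F _ /=.
rewrite (_ : (v *m (k *: F.1.1)) 0 0 = k * (v *m F.1.1) 0 0) ?mulrA//.
by rewrite -scalemxAr mxE.
Qed.

Lemma cubic_form_sum (I : finType) (P : I -> 'rV[R]_m -> R) :
  (forall i, cubic_form (P i)) -> cubic_form (fun v => \sum_i P i v).
Proof.
move=> cP; rewrite (_ : (fun v => _) = \sum_i P i); last first.
  by apply/funext => v; rewrite fct_sumE.
elim/big_ind: _ => [|P1 P2|//]; [exact: cubic_form0|exact: cubic_formD].
Qed.

Lemma cubic_form_eq P Q : P =1 Q -> cubic_form P -> cubic_form Q.
Proof. by move=> PQ [s Ps]; exists s => v; rewrite -PQ. Qed.

End CubicForms.

Section NormalSquare.
Context {R : realType} {m : nat} {M : riemannian R m}.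
Implicit Types (b : chart R m M) (z v w : 'rV[R]_m).

Lemma gamma_sqrD b z v w : gamma b z (v + w) (v + w)
  = gamma b z v v + 2 *: gamma b z v w + gamma b z w w.
Proof.
rewrite gammaDl !gammaDr (gammaC b z w v) -!addrA; congr (_ + _).
by rewrite !addrA; congr (_ + _); rewrite scaler_nat mulr2n.
Qed.

Lemma bform_remainder (G : 'M[R]_m) (L Q e : 'rV[R]_m) : G^T = G ->
  bform G (L + Q + e) (L + Q + e) - bform G L L - 2 * bform G L Q
  = 2 * bform G L e + bform G (Q + e) (Q + e).
Proof.
by move=> Gsym; rewrite -(addrA L Q e) (bform_sqrD L (Q + e) Gsym) bformDr; ring.
Qed.

(** Expansion of the squared length of the normal coordinate of a displacement
    [L + (H + E)] whose terms are of order 1, 2 and 3 in [l]. *)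
Lemma normal_sqr_expansion b z0 (L H E : 'rV[R]_m) (K l : R) :
  1 <= K -> 0 <= l <= 1 ->
  (forall v w, `|bform (gram b z0) v w| <= K * (`|v| * `|w|)) ->
  (forall v w, `|gamma b z0 v w| <= K * (`|v| * `|w|)) ->
  `|L| <= K * l -> `|H| <= K * l ^+ 2 -> `|E| <= K * l ^+ 3 ->
  `|bform (gram b z0) (normal_coord b z0 (z0 + (L + (H + E))))
      (normal_coord b z0 (z0 + (L + (H + E)))) - bform (gram b z0) L L
     - 2 * bform (gram b z0) L (H + 2^-1 *: gamma b z0 L L)|
  <= 59 * K ^+ 7 * l ^+ 4.
Proof.
move=> K1 /andP[l0 l1] fB gB LK HK EK; rewrite normal_coordE.
have K0 : 0 < K by exact: lt_le_trans K1.
set r := H + E; set Q := H + 2^-1 *: gamma b z0 L L.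
pose e := E + (gamma b z0 L r + 2^-1 *: gamma b z0 r r).
have -> : L + r + 2^-1 *: gamma b z0 (L + r) (L + r) = L + Q + e.
  rewrite (gamma_sqrD b z0 L r) /Q /e {1}/r.
  apply/rowP => k; rewrite !(coordD, coordZ).
  move: (gamma b z0 L L 0 k) (gamma b z0 L r 0 k) (gamma b z0 r r 0 k) => x y z.
  by field.
rewrite (bform_remainder _ _ _ (gram_tr b z0)).
have Kle n : K ^+ n <= K ^+ n.+1 by rewrite exprS ler_peMl// exprn_ge0// ltW.
have lle n : l ^+ n.+1 <= l ^+ n by rewrite exprS ler_piMl// exprn_ge0.
have l20 n : 0 <= l ^+ n by rewrite exprn_ge0.
have K20 n : 0 <= K ^+ n by rewrite exprn_ge0// ltW.
have K13 : K <= K ^+ 3 by rewrite ler_eXnr.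
have rK : `|r| <= 2 * K * l ^+ 2.
  rewrite (le_trans (ler_normD _ _))// -mulrA mulr_natl mulr2n lerD//.
  by rewrite (le_trans EK)// ler_pM2l.
have gLr : `|gamma b z0 L r| <= 2 * K ^+ 3 * l ^+ 3.
  apply: le_trans (gB _ _) _.
  rewrite (_ : 2 * _ * _ = K * (K * l * (2 * K * l ^+ 2))); last by ring.
  by rewrite ler_pM2l// ler_pM.
have grr : `|2^-1 *: gamma b z0 r r| <= 2 * K ^+ 3 * l ^+ 3.
  rewrite normrZ ger0_norm ?invr_ge0// ler_pdivrMl//.
  apply: le_trans (gB _ _) _.
  apply: (@le_trans _ _ (K * (2 * K * l ^+ 2 * (2 * K * l ^+ 2)))).
    by rewrite ler_pM2l// ler_pM.
  rewrite (_ : K * _ = (4 * K ^+ 3) * l ^+ 4); last by ring.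
  rewrite (_ : 2 * (2 * K ^+ 3 * l ^+ 3) = (4 * K ^+ 3) * l ^+ 3); last by ring.
  by rewrite ler_wpM2l// mulr_ge0.
have eK : `|e| <= 5 * K ^+ 3 * l ^+ 3.
  rewrite (_ : 5 * _ * _ = K ^+ 3 * l ^+ 3 + (2 * K ^+ 3 * l ^+ 3 + 2 * K ^+ 3 * l ^+ 3)); last by ring.
  rewrite (le_trans (ler_normD _ _))// lerD//.
    by rewrite (le_trans EK)// ler_wpM2r.
  by rewrite (le_trans (ler_normD _ _))// lerD.
have QK : `|Q| <= 2 * K ^+ 3 * l ^+ 2.
  rewrite (_ : 2 * _ * _ = K ^+ 3 * l ^+ 2 + K ^+ 3 * l ^+ 2); last by ring.
  rewrite (le_trans (ler_normD _ _))// lerD//.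
    by rewrite (le_trans HK)// ler_wpM2r.
  apply: normZ_le1; first by rewrite ger0_norm; lra.
  apply: le_trans (gB _ _) _.
  rewrite (_ : K ^+ 3 * _ = K * (K * l * (K * l))); last by ring.
  by rewrite ler_pM2l// ler_pM.
have QeK : `|Q + e| <= 7 * K ^+ 3 * l ^+ 2.
  rewrite (_ : 7 * _ * _ = 2 * K ^+ 3 * l ^+ 2 + 5 * K ^+ 3 * l ^+ 2); last by ring.
  rewrite (le_trans (ler_normD _ _))// lerD// (le_trans eK)// ler_wpM2l//.
  by rewrite mulr_ge0.
have h1 : `|2 * bform (gram b z0) L e| <= 10 * K ^+ 7 * l ^+ 4.
  rewrite normrM ger0_norm//.
  apply: (@le_trans _ _ (2 * (K * (K * l * (5 * K ^+ 3 * l ^+ 3))))).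
    rewrite ler_pM2l//; apply: le_trans (fB _ _) _.
    by rewrite ler_pM2l// ler_pM.
  rewrite (_ : 2 * (K * (K * l * (5 * K ^+ 3 * l ^+ 3))) = 10 * l ^+ 4 * K ^+ 5); last by ring.
  rewrite (_ : 10 * K ^+ 7 * l ^+ 4 = 10 * l ^+ 4 * K ^+ 7); last by ring.
  by rewrite ler_wpM2l ?mulr_ge0// (le_trans (Kle 5%N)).
have h2 : `|bform (gram b z0) (Q + e) (Q + e)| <= 49 * K ^+ 7 * l ^+ 4.
  apply: le_trans (fB _ _) _.
  rewrite (_ : 49 * _ * _ = K * (7 * K ^+ 3 * l ^+ 2 * (7 * K ^+ 3 * l ^+ 2))); last by ring.
  by rewrite ler_pM2l// ler_pM.
rewrite (le_trans (ler_normD _ _))// (le_trans (lerD h1 h2))//.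
by rewrite -!mulrDl le_eqVlt; apply/orP; left; apply/eqP; ring.
Qed.

End NormalSquare.

(** * Expansion of the distance between images of geodesic end points *)

Lemma coordB (R : realType) (m : nat) (v w : 'rV[R]_m) k :
  (v - w) 0 k = v 0 k - w 0 k.
Proof. by rewrite !mxE. Qed.

Lemma add_sub_three (V : zmodType) (x y z t : V) :
  x = y + (z + (t + (x - y - z - t))).
Proof. by rewrite [t + _]addrC subrK [z + _]addrC subrK [y + _]addrC subrK. Qed.

Lemma le_dist_add3 (R : realType) (a b c d r s : R) :
  `|a - b| <= r -> `|b - c - d| <= s -> `|a - c - d| <= r + s.
Proof.
move=> h1 h2; rewrite (_ : a - c - d = (a - b) + (b - c - d)); last by ring.
by rewrite (le_trans (ler_normD _ _))// lerD.
Qed.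

Section MapExpansion.
Context {R : realType} {m p : nat} {M : riemannian R m} {N : riemannian R p}.
Variable f : M -> N.
Hypothesis f_smooth : smooth_map f.
Implicit Types (c : R -> M) (x : M).

(** Fourth-order expansion of the squared distance along geodesics issued from
    [x], uniform in the initial velocity. *)
Definition edge_expansion (C : R) x : Prop :=
  exists2 P : 'rV[R]_m -> R, cubic_form P &
    forall c, geodesic c -> c 0 = x -> tnorm x (velocity c 0) < C^-1 ->
      `|dist (f x) (f (c 1)) ^+ 2
        - bform (metric (f x)) (velocity c 0 *m tangent_map f x)
            (velocity c 0 *m tangent_map f x)
        - P (velocity c 0)| <= C * tnorm x (velocity c 0) ^+ 4.

Lemma edge_expansionW (C C' : R) x : 0 < C -> C <= C' ->
  edge_expansion C x -> edge_expansion C' x.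
Proof.
move=> C0 CC' [P cP Pf]; exists P => // c gc c0 vC.
rewrite (le_trans (Pf c gc c0 (lt_invW C0 CC' vC)))//.
by rewrite ler_wpM2r// exprn_ge0// tnorm_ge0.
Qed.

Lemma velocity_map c : geodesic c ->
  velocity (f \o c) 0 = velocity c 0 *m tangent_map f (c 0).
Proof.
move=> gc; have aA := chart_at_atlas (c 0).
have [_ ud _] := nbhs_singleton (geodesic_near gc aA (chart_at_dom (c 0))).
by case: (curve_chain f_smooth aA (chart_at_atlas (f (c 0))) (gc.1 0)
  (chart_at_dom _) (chart_at_dom _) ud).
Qed.

(** The second-order terms are quadratic in the coordinates of a linear image of
    the velocity, and they are paired with a linear one. *)
Lemma cubic_form_bform_quadratic q (J1 : 'M[R]_(m, p)) (J2 : 'M[R]_(m, q))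
    (G : 'M[R]_p) (B : 'I_q -> 'I_q -> 'I_p -> R) :
  cubic_form (fun v => bform G (v *m J1)
    (\row_k \sum_i \sum_j B i j k * (v *m J2) 0 i * (v *m J2) 0 j)).
Proof.
apply: (@cubic_form_eq _ _ (fun v => \sum_l \sum_k \sum_i \sum_j (G l k * B i j k) *
   ((v *m col l J1) 0 0 * (v *m col i J2) 0 0 * (v *m col j J2) 0 0))).
  move=> v; rewrite bformE; apply: eq_bigr => l _; apply: eq_bigr => k _.
  rewrite [(\row__ _) 0 k]mxE mulr_sumr; apply: eq_bigr => i _; rewrite mulr_sumr.
  apply: eq_bigr => j _.
  have colE' n (D : 'M[R]_(m, n)) s : (v *m col s D) 0 0 = (v *m D) 0 s.
    by rewrite colE mulmxA -colE mxE.
  by rewrite !colE'; ring.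
by do 4 (apply: cubic_form_sum => ?); apply: cubic_formZ; exact: cubic_formM.
Qed.

Lemma velocity_to_chart a c (t : R) : geodesic c -> atlas M a -> cdom a (c t) ->
  derive1 (in_chart a c) t = velocity c t *m
    jac (cmap a \o (fun y : M => y) \o cinv (chart_at (c t))) (cmap (chart_at (c t)) (c t)).
Proof.
move=> gc aA act; have cA := chart_at_atlas (c t).
have [_ ud _] := nbhs_singleton (geodesic_near gc cA (chart_at_dom (c t))).
by case: (curve_chain smooth_map_id cA aA (gc.1 t) (chart_at_dom _) act ud).
Qed.

Lemma bform_map_chart a b c : geodesic c -> atlas M a -> atlas N b ->
  cdom a (c 0) -> cdom b (f (c 0)) ->
  let L := derive1 (in_chart a c) 0 *m jac (cmap b \o f \o cinv a) (cmap a (c 0)) in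
  bform (gram b (cmap b (f (c 0)))) L L =
  bform (metric (f (c 0))) (velocity c 0 *m tangent_map f (c 0))
    (velocity c 0 *m tangent_map f (c 0)).
Proof.
move=> gc aA bA ac0 bc0; have [_ ud _] := nbhs_singleton (geodesic_near gc aA ac0).
have [fd fv] := curve_chain f_smooth aA bA (gc.1 0) ac0 bc0 ud.
have fc : {for (0 : R), continuous (f \o c)}.
  by apply: continuous_comp; [exact: gc.1|exact: f_smooth.1].
have := sqr_speed bA fc bc0 fd.
by rewrite sqr_tnorm (velocity_map gc) fv => e; symmetry; exact: e.
Qed.

(** In charts around [xs] and [f xs], the image of the end point of the geodesic
    is [L + H + O(l ^ 3)] away from [f x], with [L] linear and [H] quadratic in
    the velocity, by [geodesic_taylor]. Inserted in [near_dist_expansion] this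
    leaves the square of [L], which is the pulled back metric, and a cubic
    form. *)
Lemma near_edge_expansion (xs : M) :
  \forall x \near xs & C \near +oo, edge_expansion C x.
Proof.
pose a := chart_at xs; pose b := chart_at (f xs).
have aA : atlas M a by exact: chart_at_atlas.
have bA : atlas N b by exact: chart_at_atlas.
have axs : cdom a xs by exact: chart_at_dom.
have bfxs : cdom b (f xs) by exact: chart_at_dom.
pose zs := cmap a xs; pose ys := cmap b (f xs).
have azs : (cmap a @` cdom a) zs by exists xs.
have bys : (cmap b @` cdom b) ys by exists (f xs).
pose F := cmap b \o f \o cinv a.
pose U := cmap a @` (cdom a `&` f @^-1` cdom b).
have Uo : open U.
  apply: cmap_image_open; apply: open_comp (cdom_open b) => x _; exact: f_smooth.1.
have F_smooth : smooth_on U F by exact: f_smooth.2.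
have Uzs : U zs by exists xs.
have FT : Filter (+oo : set_system R) by exact: proper_pinfty_nbhs.
pose Fk k z := F z 0 k.
have Fk_smooth k : smooth_on U (Fk k) by exact: smooth_on_coord.
have nT := filter_forall FT (fun k => geodesic_taylor aA azs Uo Uzs (Fk_smooth k)).
have nL := filter_forall FT (fun k => loc_lip_near
  (loc_lip_C1 (smooth_on_C1 Uo (Fk_smooth k) Uzs))).
have nP := filter_forall FT (fun k => filter_forall FT (fun i => loc_lip_bounded
  (loc_lip_C1 (smooth_on_C1 Uo (smooth_on_partial i (Fk_smooth k)) Uzs)))).
have nH := filter_forall FT (fun k => filter_forall FT (fun i => filter_forall FT (fun j =>
  loc_lip_bounded (hess_coef_loc_lip i j aA azs Uo Uzs (Fk_smooth k))))).
have [d d0 dU] := (near_norm _ _).1 (open_nbhs_nbhs (conj Uo Uzs)).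
have [D D1 [[[tay lip] [par hes]] [[aD bD] [dist_exp dD]]]] := pinfty_ex (filterI
  (filterI (filterI nT nL) (filterI nP nH))
  (filterI (filterI (near_chart_bounds aA azs) (near_chart_bounds bA bys))
           (filterI (near_dist_expansion bA bys) (near_ge d^-1)))).
(* The second, smaller ball of radius [1 / D2] is mapped by [F], which is
   [D]-Lipschitz, into the ball of radius [1 / D] around [ys]. *)
have [D2 D21 [aD2 DD2]] := pinfty_ex (filterI (near_chart_bounds aA azs) (near_ge (D ^+ 2))).
have D0 : 0 < D by exact: lt_le_trans D1.
have D20 : 0 < D2 by exact: lt_le_trans D21.
pose K := (m%:R * m%:R + m%:R + 1) * D ^+ 3.
have D30 : 0 < D ^+ 3 by rewrite exprn_gt0.
have DD3 : D <= D ^+ 3 by rewrite ler_eXnr.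
have mm0 : 0 <= m%:R * m%:R :> R by rewrite mulr_ge0.
have KD3 : D ^+ 3 <= K.
  by rewrite /K ler_peMl ?(ltW D30)// lerDr addr_ge0.
have DK : D <= K by exact: le_trans KD3.
have K1 : 1 <= K by exact: le_trans DK.
have K0 : 0 < K by exact: lt_le_trans K1.
have pK7 : 0 <= 59 * K ^+ 7 by rewrite mulr_ge0 ?exprn_ge0 ?ltW.
have pK4 : 0 <= 81 * D * K ^+ 4 by rewrite !mulr_ge0 ?exprn_ge0 ?ltW.
have pD2 : 0 < 2 * D2 * D2 by rewrite !mulr_gt0.
pose C0 := 2 * D2 * D2 + 2 * D2 + D + (59 * K ^+ 7 + 81 * D * K ^+ 4).
have C2 : 2 * D2 * D2 <= C0 by rewrite /C0; lra.
have C3 : 2 * D2 <= C0 by rewrite /C0; lra.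
have C4 : D <= C0 by rewrite /C0; lra.
have C5 : D2 <= C0 by rewrite /C0; lra.
have C6 : 59 * K ^+ 7 + 81 * D * K ^+ 4 <= C0 by rewrite /C0; lra.
have C00 : 0 < C0 by exact: lt_le_trans C4.
have DD : D <= D2 by apply: le_trans DD2; rewrite ler_eXnr.
suff local x : cdom a x -> `|cmap a x - zs| < C0^-1 -> edge_expansion C0 x.
  exists ([set x | cdom a x /\ `|cmap a x - zs| < C0^-1], [set C | C0 <= C]) => /=.
    split; last exact: near_ge.
    apply: filterI; first exact: open_nbhs_nbhs (conj (cdom_open a) axs).
    have cd := continuous_comp (cmap_cont axs) (@continuous_dist _ _ zs (cmap a xs)).
    apply: (cvgr_lt _ cd).
    by rewrite /= subrr normr0 invr_gt0.
  move=> [x C] [/= [ax xz] CC]; apply: edge_expansionW CC _ => //; exact: local.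
move=> ax xz.
pose z := cmap a x; pose z0 := cmap b (f x).
have in_ball y : `|y - zs| < D2^-1 -> [/\ U y, `|F y - ys| < D^-1 & `|y - zs| < D^-1].
  move=> yz; have yD : `|y - zs| < D^-1 by apply: lt_invW yz.
  split=> //.
    by apply: dU; rewrite -[d]invrK; apply: lt_invW yD; rewrite ?invr_gt0.
  apply: rV_norm_lt; first by rewrite invr_gt0.
  move=> k; have -> : (F y - ys) 0 k = Fk k y - Fk k zs.
    by rewrite coordB /Fk /F /= /zs cmapK.
  apply: le_lt_trans (lip k y zs yD _) _; first by rewrite subrr normr0 invr_gt0.
  rewrite -ltr_pdivlMl// -invfM; apply: lt_le_trans yz _.
  by rewrite lef_pV2 ?posrE ?mulr_gt0// -expr2.
have inU y : cdom a y -> U (cmap a y) -> cdom b (f y).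
  by move=> ay [y' [ay' by'] e]; rewrite -(cmapK ay) -e cmapK.
have zD2 : `|z - zs| < D2^-1 by exact: lt_invW xz.
have [Uz z0ys zD] := in_ball z zD2.
have bfx : cdom b (f x) by exact: inU.
have Fz : F z = z0 by rewrite /F /= cmapK.
rewrite Fz in z0ys.
have [[_ _ fB gB] _] := bD _ _ z0ys z0ys.
pose J := jac (cmap a \o (fun y : M => y) \o cinv (chart_at x)) (cmap (chart_at x) x).
pose A := jac F z.
pose H V : 'rV[R]_p := \row_k (2^-1 * hess a (Fk k) z V).
exists (fun v => 2 * bform (gram b z0) (v *m J *m A)
   (H (v *m J) + 2^-1 *: gamma b z0 (v *m J *m A) (v *m J *m A))).
  apply: (@cubic_form_eq _ _ (fun v => bform (gram b z0) (v *m (J *m A))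
      (\row_k \sum_i \sum_j hess_coef a (Fk k) z i j * (v *m J) 0 i * (v *m J) 0 j)
    + bform (gram b z0) (v *m (J *m A)) (\row_k \sum_i \sum_j
      christoffel b z0 i j k * (v *m (J *m A)) 0 i * (v *m (J *m A)) 0 j))).
    move=> v; rewrite -mulmxA -bformDr -bformZr; congr (bform _ _ _).
    rewrite scalerDr scalerA mulfV// scale1r; congr (_ + _).
    apply/rowP => k; rewrite coordZ [RHS]/=.
    by rewrite [(H _) 0 k]mxE mulrA mulfV// mul1r [LHS]mxE.
  by apply: cubic_formD; exact: cubic_form_bform_quadratic.
move=> c gc cx lC.
set v := velocity c 0 in lC *; set l := tnorm x v in lC *.
have l0 : 0 <= l by exact: tnorm_ge0.
have lE : tnorm (c 0) (velocity c 0) = l by rewrite /l cx.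
have ac0 : cdom a (c 0) by rewrite cx.
pose u := in_chart a c; pose V := derive1 u 0.
have u0 : u 0 = z by rewrite /u /in_chart /= cx.
have VJ : v *m J = V.
  by rewrite /V /u (velocity_to_chart gc aA ac0) cx.
have u0C : `|u 0 - zs| < C0^-1 by rewrite u0.
have l1 : l <= 1.
  by rewrite (le_trans (ltW lC))// invf_le1// (le_trans D1).
have t01 : ((0 : R) <= 1) && ((1 : R) <= 1) by rewrite ler01 lexx.
have [ac1 u1D2] : cdom a (c 1) /\ `|u 1 - zs| < D2^-1.
  apply: (geodesic_stays aD2 D21 aA gc ac0) t01.
    by apply: lt_invW u0C; rewrite ?mulr_gt0.
  rewrite lE mulrC -ltr_pdivlMr// -invfM; exact: lt_invW lC.
have [Uu1 z1ys _] := in_ball _ u1D2.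
have bfc1 : cdom b (f (c 1)) by exact: inU.
pose z1 := F (u 1).
have z1E : cinv b z1 = f (c 1) by rewrite /z1 /F /u /in_chart /= !cmapK.
have z0E : cinv b z0 = f x by rewrite /z0 cmapK.
have VD : `|V| <= D * l.
  rewrite -lE; apply: (geodesic_coord_speed aD D1 aA gc ac0).
  by rewrite -/u u0.
pose L := V *m A; pose Hv := H V; pose E := z1 - z0 - L - Hv.
have z1D : z1 = z0 + (L + (Hv + E)).
  exact: add_sub_three.
have AE i k : A i k = partial i (Fk k) z by exact: (jacE _ _ F_smooth Uz).
have LE k : L 0 k = \sum_i V 0 i * partial i (Fk k) z.
  by rewrite /L mxE; apply: eq_bigr => i _; rewrite AE.
have EK : `|E| <= K * l ^+ 3.
  apply: rV_norm_le => [|k]; first by rewrite mulr_ge0 ?exprn_ge0// ltW.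
  have -> : E 0 k = Fk k (u 1) - Fk k (u 0) - \sum_i V 0 i * partial i (Fk k) (u 0)
      - 2^-1 * hess a (Fk k) (u 0) V.
    rewrite u0 -LE /E !coordB /Hv [(H V) 0 k]mxE -Fz.
    by rewrite /z1 /Fk.
  have := tay k c gc ac0; rewrite lE => /(_ (lt_invW D0 C4 u0C) (lt_invW D0 C4 lC)).
  by move=> /le_trans; apply; rewrite ler_wpM2r ?exprn_ge0.
have LK : `|L| <= K * l.
  apply: rV_norm_le => [|k]; first by rewrite mulr_ge0// ltW.
  rewrite LE (le_trans (ler_norm_sum _ _ _))//.
  apply: (@le_trans _ _ (\sum_(i < m) (D * l) * D)).
    apply: ler_sum => i _; rewrite normrM ler_pM//; last exact: par.
    exact: le_trans (coord_norm _ _) VD.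
  rewrite sumr_const card_ord -[_ *+ m]mulr_natl.
  rewrite (_ : m%:R * _ = m%:R * D ^+ 2 * l); last by ring.
  rewrite ler_wpM2r//; apply: (@le_trans _ _ (m%:R * D ^+ 3)).
    by rewrite ler_wpM2l// ler_weXn2l.
  by rewrite /K ler_wpM2r ?(ltW D30)// -addrA addrCA lerDl addr_ge0.
have HK : `|Hv| <= K * l ^+ 2.
  apply: rV_norm_le => [|k]; first by rewrite mulr_ge0 ?exprn_ge0// ltW.
  rewrite /Hv [(H V) 0 k]mxE normrM ger0_norm ?invr_ge0//.
  apply: (@le_trans _ _ (1 * `|hess a (Fk k) z V|)).
    by rewrite ler_wpM2r// invf_le1// ler1n.
  rewrite mul1r (le_trans (sum2_bound V V (fun i j => hes k i j z zD)))//.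
  apply: (@le_trans _ _ (m%:R * m%:R * D * (D * l * (D * l)))).
    by rewrite ler_wpM2l ?mulr_ge0// ?(ltW D0)// ler_pM.
  rewrite (_ : _ * (D * l * (D * l)) = m%:R * m%:R * D ^+ 3 * l ^+ 2); last by ring.
  rewrite ler_wpM2r ?exprn_ge0// /K ler_wpM2r ?(ltW D30)// -addrA lerDl.
  by rewrite addr_ge0.
have l01 : 0 <= l <= 1 by rewrite l0.
have fBK v1 w1 : `|bform (gram b z0) v1 w1| <= K * (`|v1| * `|w1|).
  by rewrite (le_trans (fB _ _))// ler_wpM2r// mulr_ge0.
have gBK v1 w1 : `|gamma b z0 v1 w1| <= K * (`|v1| * `|w1|).
  by rewrite (le_trans (gB _ _))// ler_wpM2r// mulr_ge0.
have main := normal_sqr_expansion K1 l01 fBK gBK LK HK EK.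
rewrite -z1D in main.
have wK : `|z1 - z0| <= 3 * K * l.
  have lle n : l ^+ n.+1 <= l by rewrite exprS ler_piMr// exprn_ile1.
  rewrite z1D addrAC subrr add0r (le_trans (ler_normD _ _))//.
  rewrite (_ : 3 * K * l = K * l + (K * l + K * l)); last by ring.
  rewrite lerD// (le_trans (ler_normD _ _))// lerD//.
    by rewrite (le_trans HK)// ler_pM2l.
  by rewrite (le_trans EK)// ler_pM2l.
have dist_close := dist_exp z0 z1 z0ys z1ys; rewrite z0E z1E in dist_close.
have dist_close' : D * `|z1 - z0| ^+ 4 <= 81 * D * K ^+ 4 * l ^+ 4.
  rewrite (_ : 81 * D * _ * _ = D * (3 * K * l) ^+ 4); last by ring.
  rewrite ler_pM2l// ler_pXn2r// nnegrE//.
  by rewrite !mulr_ge0// ltW.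
have bc0 : cdom b (f (c 0)) by rewrite cx.
have lead := bform_map_chart gc aA bA ac0 bc0.
rewrite cx -/v -/V in lead; rewrite -/z0 -/z -/F -/A -/L in lead.
rewrite -lead VJ -/L -/Hv.
have lead' := le_dist_add3 (le_trans dist_close dist_close') main.
apply: (le_trans lead'); rewrite addrC -mulrDl.
by apply: ler_wpM2r; [exact: exprn_ge0|exact: C6].
Qed.

End MapExpansion.

(** * Moments of weighted edge vectors *)

Section Moments.
Context {R : realType} {m : nat} {I : Type}.
Variables (s : seq I) (om : I -> R) (V : I -> 'rV[R]_m).
Implicit Types (L : 'cV[R]_m).

Let ev y L : R := (V y *m L) 0 0.

Let evD y L L' : ev y (L + L') = ev y L + ev y L'.
Proof. by rewrite /ev mulmxDr mxE. Qed.

Lemma second_moment_polar (Gi : 'M[R]_m) : Gi^T = Gi ->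
  (forall L, \sum_(y <- s) om y * ev y L ^+ 2 = 2 * (L^T *m Gi *m L) 0 0) ->
  forall L1 L2, \sum_(y <- s) om y * (ev y L1 * ev y L2)
    = 2 * (L1^T *m Gi *m L2) 0 0.
Proof.
move=> Gs mom L1 L2; have := mom (L1 + L2).
have -> : \sum_(y <- s) om y * ev y (L1 + L2) ^+ 2 =
    \sum_(y <- s) om y * ev y L1 ^+ 2 + \sum_(y <- s) om y * ev y L2 ^+ 2
    + 2 * \sum_(y <- s) om y * (ev y L1 * ev y L2).
  rewrite mulr_sumr -!big_split; apply: eq_bigr => y _ /=.
  by rewrite evD; ring.
rewrite !mom; have -> : ((L1 + L2)^T *m Gi *m (L1 + L2)) 0 0 =
    (L1^T *m Gi *m L1) 0 0 + (L2^T *m Gi *m L2) 0 0 + 2 * (L1^T *m Gi *m L2) 0 0.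
  have sym : (L2^T *m Gi *m L1) 0 0 = (L1^T *m Gi *m L2) 0 0.
    rewrite -[LHS]trace_mx11 -mxtrace_tr trace_mx11.
    by rewrite !trmx_mul trmxK Gs mulmxA.
  have -> : (L1 + L2)^T = L1^T + L2^T by rewrite linearD.
  rewrite !mulmxDl !mulmxDr.
  have e (A B : 'M[R]_1) : (A + B) 0 0 = A 0 0 + B 0 0 by rewrite mxE.
  by rewrite !e sym; ring.
by lra.
Qed.

(** Polarization of the cube: a product of three linear forms is a combination of
    cubes of linear forms. *)
Lemma third_moment_polar :
  (forall L, \sum_(y <- s) om y * ev y L ^+ 3 = 0) ->
  forall L1 L2 L3, \sum_(y <- s) om y * (ev y L1 * ev y L2 * ev y L3) = 0.
Proof.
move=> mom L1 L2 L3.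
have : 6 * \sum_(y <- s) om y * (ev y L1 * ev y L2 * ev y L3) =
    \sum_(y <- s) om y * ev y (L1 + L2 + L3) ^+ 3
    - \sum_(y <- s) om y * ev y (L1 + L2) ^+ 3
    - \sum_(y <- s) om y * ev y (L1 + L3) ^+ 3
    - \sum_(y <- s) om y * ev y (L2 + L3) ^+ 3
    + \sum_(y <- s) om y * ev y L1 ^+ 3
    + \sum_(y <- s) om y * ev y L2 ^+ 3
    + \sum_(y <- s) om y * ev y L3 ^+ 3.
  rewrite mulr_sumr -!sumrB -!big_split; apply: eq_bigr => y _ /=.
  by rewrite !evD; ring.
rewrite !mom !subr0 !addr0 => /eqP; rewrite mulf_eq0 pnatr_eq0/= => /eqP.
by [].
Qed.

Lemma cubic_form_moment (P : 'rV[R]_m -> R) : cubic_form P ->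
  (forall L, \sum_(y <- s) om y * ev y L ^+ 3 = 0) ->
  \sum_(y <- s) om y * P (V y) = 0.
Proof.
move=> [t Pt] /third_moment_polar mom.
under eq_bigr => y _ do rewrite Pt mulr_sumr.
by rewrite exchange_big big1//= => F _; exact: mom.
Qed.

Lemma trace_mul_tr n (A B : 'M[R]_n) :
  \sum_k \sum_l A k l * B k l = \tr (A *m B^T).
Proof.
rewrite /mxtrace; apply: eq_bigr => k _; rewrite mxE; apply: eq_bigr => l _.
by rewrite mxE.
Qed.

Lemma bform_moment p (Gi : 'M[R]_m) (A : 'M[R]_(m, p)) (h : 'M[R]_p) :
  Gi^T = Gi ->
  (forall L, \sum_(y <- s) om y * ev y L ^+ 2 = 2 * (L^T *m Gi *m L) 0 0) ->
  \sum_(y <- s) om y * bform h (V y *m A) (V y *m A)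
    = 2 * \tr (Gi *m (A *m h *m A^T)).
Proof.
move=> Gs /(second_moment_polar Gs) mom.
have colE' y k : (V y *m A) 0 k = ev y (col k A).
  by rewrite /ev colE mulmxA -colE [RHS]mxE.
under eq_bigr => y _.
  rewrite bformE mulr_sumr.
  under eq_bigr => k _ do rewrite mulr_sumr.
  over.
rewrite exchange_big/=.
under eq_bigr => k _ do rewrite exchange_big/=.
have E k l : \sum_(y <- s) om y * (h k l * (V y *m A) 0 k * (V y *m A) 0 l)
    = 2 * (h k l * (A^T *m Gi *m A) k l).
  transitivity (h k l * \sum_(y <- s) om y * (ev y (col k A) * ev y (col l A))).
    by rewrite mulr_sumr; apply: eq_bigr => y _; rewrite !colE'; ring.
  rewrite mom mulrCA; congr (2 * (_ * _)).
  have gen (B : 'M[R]_(p, m)) : (row k B *m col l A) 0 0 = (B *m A) k l.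
    by rewrite !mxE; apply: eq_bigr => j _; rewrite !mxE.
  by rewrite tr_col -row_mul gen.
under eq_bigr => k _ do under eq_bigr => l _ do rewrite E.
under eq_bigr => k _ do rewrite -mulr_sumr.
rewrite -mulr_sumr trace_mul_tr; congr (2 * _).
rewrite !trmx_mul trmxK Gs mulmxA -mxtrace_mulC.
by rewrite !mulmxA [in RHS]mxtrace_mulC !mulmxA.
Qed.

End Moments.

(** * Energy at a Laplacian vertex *)

Section MetricAtPoint.
Context {R : realType} {m : nat} {M : riemannian R m}.
Implicit Types (x : M) (L : 'cV[R]_m).

Lemma metric_unit x : metric x \in unitmx.
Proof.
rewrite -row_free_unit; apply: inj_row_free => v vG.
apply/eqP/negP => /negP v0.
by have := metric_pos x v0; rewrite vG mul0mx mxE ltxx.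
Qed.

Lemma invmx_metric_tr x : (invmx (metric x))^T = invmx (metric x).
Proof. by rewrite trmx_inv Defs.metric_sym. Qed.

Lemma sqr_conorm x L : conorm x L ^+ 2 = (L^T *m invmx (metric x) *m L) 0 0.
Proof.
rewrite sqr_sqrtr//.
have := metric_ge0 x (L^T *m invmx (metric x)).
rewrite /bform trmx_mul trmxK invmx_metric_tr.
by rewrite -[_ *m metric x]mulmxA mulVmx ?metric_unit// mulmx1 mulmxA.
Qed.

End MetricAtPoint.

Section MeshEdges.
Context {R : realType} {m : nat} {M : riemannian R m}.
Variable T : triangulation M.
Implicit Types (x y : M).

Lemma vertex_in_edge_cell x y : vertex T x -> x <> y -> cell T [set x; y] x.
Proof.
move=> vx xy; exists \1_[set x]; last exact: realize_vertex.
split=> [z|z zs|]; first by rewrite indicE; case: (_ \in _).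
  rewrite indicE memNset// => zx; apply: zs; left; exact: zx.
rewrite -(@fsbig_widen _ _ _ _ [set x])//.
- by rewrite fsbig_set1 indicE mem_set.
- by move=> z [_ zx] /=; rewrite indicE memNset.
Qed.

(** The cells of the edges at [x] contain [x], and the cells are locally finite.
    Hence the sums over neighbors are genuine finite sums. *)
Lemma neighbors_finite x : vertex T x -> finite_set (neighbors T x).
Proof.
move=> vx; have [U xU fU] := cells_locally_finite T x.
apply: (@sub_finite_set _ _ ((fun y => [set x; y]) @^-1`
    [set s | simplices T s /\ realize T @` std_simplex s `&` U !=set0])).
  move=> y [xy sxy]; split=> //; exists x; split; last exact: nbhs_singleton.
  exact: vertex_in_edge_cell.
apply: finite_preimage fU => y y' _ _ e.
have : [set x; y'] y by rewrite -e; right.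
case=> [yx|//]; have : [set x; y] y' by rewrite e; right.
by case=> ->; rewrite ?yx.
Qed.

Lemma edge_vectorP x y : geodesic_mesh T -> Defs.adjacent T x y ->
  exists2 c, geodesic_from x (edge_vector T x y) c & edge_geodesic T x y c.
Proof.
move=> mesh xy; have [c ec] := mesh x y xy.
rewrite /edge_vector; case: xgetP => [v _ //|none].
have [gc c0 _ _ _] := ec.
exfalso; apply: (none (velocity c 0)); exists c => //.
Qed.

(** Geodesics have constant speed, so the norm of the initial velocity is the
    length of the edge. *)
Lemma edge_vector_le_mesh_size x y : geodesic_mesh T -> Defs.adjacent T x y ->
  ((tnorm x (edge_vector T x y))%:E <= mesh_size T)%E.
Proof.
move=> mesh xy; have [c [gc c0 cv] ec] := edge_vectorP mesh xy.
apply: ereal_sup_ubound; right; exists x, y, c; split=> //.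
by rewrite geodesic_length// c0 cv.
Qed.

Lemma mesh_size_ge0 : (0 <= mesh_size T)%E.
Proof. by apply: ereal_sup_ubound; left. Qed.

End MeshEdges.

Section EnergyAtVertex.
Context {R : realType} {m p : nat} {M : riemannian R m} {N : riemannian R p}.
Variables (f : M -> N) (T : triangulation M) (w : weights T).

(** At a Laplacian vertex the leading quadratic terms add up to the energy
    density, the cubic terms cancel, and the remainders are controlled by the
    second moment of the edge vectors. *)
Lemma discrete_energy_close (C r : R) (x : M) : geodesic_mesh T -> 0 < C ->
  vertex T x -> laplacian_at w x -> edge_expansion f C x ->
  (forall y, Defs.adjacent T x y -> tnorm x (edge_vector T x y) <= r) -> r < C^-1 ->
  `|discrete_energy_density w f x - energy_density f x| <= (2^-1 * m%:R * C) * r ^+ 2.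
Proof.
move=> mesh C0 vx lap [P cP Pf] Vr rC.
have fin := neighbors_finite vx.
pose s := finmap.enum_fset (fset_set (neighbors T x)).
have sP y : y \in s -> Defs.adjacent T x y.
  by move=> ys; have := in_fset_set fin y; rewrite [LHS]ys => /esym /set_mem.
pose om y := (vweight w x)^-1 * eweight w x y.
pose V y := edge_vector T x y.
have mu0 := vweight_gt0 w vx.
have om0 y : y \in s -> 0 <= om y.
  by move=> /sP xy; rewrite mulr_ge0 ?invr_ge0 ?ltW// eweight_gt0.
have mom2 (L : 'cV[R]_m) : \sum_(y <- s) om y * ((V y *m L) 0 0) ^+ 2
    = 2 * (L^T *m invmx (metric x) *m L) 0 0.
  have [_ + _] := lap L; rewrite sqr_conorm => <-.
  rewrite fsbig_finite// mulr_sumr; apply: eq_bigr => y _.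
  by rewrite [RHS]mulrA.
have mom3 (L : 'cV[R]_m) : \sum_(y <- s) om y * ((V y *m L) 0 0) ^+ 3 = 0.
  have [_ _ cubE] := lap L.
  rewrite -[RHS]cubE fsbig_finite// mulr_sumr; apply: eq_bigr => y _.
  by rewrite [RHS]mulrA.
have quad := bform_moment (tangent_map f x) (metric (f x)) (invmx_metric_tr x) mom2.
have cub := cubic_form_moment cP mom3.
have total := bform_moment 1%:M (metric x) (invmx_metric_tr x) mom2.
rewrite mul1mx trmx1 mulmx1 mulVmx ?metric_unit// mxtrace1 in total.
have dE : discrete_energy_density w f x =
    4^-1 * \sum_(y <- s) om y * dist (f x) (f y) ^+ 2.
  rewrite /discrete_energy_density fsbig_finite// invfM -mulrA; congr (_ * _).
  by rewrite mulr_sumr; apply: eq_bigr => y _; rewrite [LHS]mulrA.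
have eE : energy_density f x = 4^-1 * \sum_(y <- s) om y *
    (bform (metric (f x)) (V y *m tangent_map f x) (V y *m tangent_map f x) + P (V y)).
  under eq_bigr => y _ do rewrite mulrDr.
  rewrite big_split/= quad cub addr0 /energy_density mulrA.
  by congr (_ * _); field.
rewrite dE eE -mulrBr normrM ger0_norm ?invr_ge0// -sumrB.
rewrite (_ : 2^-1 * m%:R * C * r ^+ 2 = 4^-1 * (C * r ^+ 2 * (2 * m%:R))); last by field.
rewrite ler_pM2l ?invr_gt0// -total mulr_sumr (le_trans (ler_norm_sum _ _ _))//.
rewrite big_seq [leRHS]big_seq; apply: ler_sum => y ys.
rewrite -mulrBr normrM ger0_norm ?om0// mulrCA ler_wpM2l ?om0//.
have xy := sP y ys.
have [c [gc c0 cv] [_ _ c1 _ _]] := edge_vectorP mesh xy.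
have Vyr : tnorm x (V y) <= r by exact: Vr.
have := Pf c gc c0; rewrite cv c1 => /(_ (le_lt_trans Vyr rC)).
rewrite opprD addrA => /le_trans; apply.
rewrite mulmx1 -sqr_tnorm (_ : tnorm x (V y) ^+ 4 = tnorm x (V y) ^+ 2 * tnorm x (V y) ^+ 2); last by ring.
rewrite mulrA ler_wpM2r ?sqr_ge0// ler_pM2l// ler_sqr// nnegrE ?tnorm_ge0//.
by rewrite (le_trans _ Vyr)// tnorm_ge0.
Qed.

End EnergyAtVertex.

Theorem theorem3p19 (R : realType) (m p : nat)
    (M : riemannian R m) (N : riemannian R p)
    (M_complete : riemannian_complete M) (N_complete : riemannian_complete N)
    (f : M -> N) (f_smooth : smooth_map f)
    (T : nat -> triangulation M) (T_mesh : forall n, geodesic_mesh (T n))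
    (T_fine : fine_seq T) (T_crystalline : crystalline T)
    (w : forall n, weights (T n)) :
  forall K : set M, compact K ->
  exists (C : R) (n0 : nat), 0 < C /\
    forall n, (n0 <= n)%N ->
    forall x : M, K x -> vertex (T n) x -> laplacian_at (w n) x ->
      (`|discrete_energy_density (w n) f x - energy_density f x|%:E
         <= C%:E * mesh_size (T n) ^+ 2)%E.
Proof.
move=> K /compact_near_coveringP cov.
have oo_filter : Filter (+oo : set_system R) by exact: proper_pinfty_nbhs.
have [C C1 KC] := pinfty_ex (cov R (+oo : set_system R) (edge_expansion f) oo_filter
  (fun x _ => near_edge_expansion f_smooth x)).
have C0 : 0 < C by exact: lt_le_trans C1.
have : \forall n \near \oo, (mesh_size (T n) < C^-1%:E)%E.
  apply: (T_fine [set e : \bar R | (e < C^-1%:E)%E]); apply: open_nbhs_nbhs; split; first exact: open_ereal_lt_ereal.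
  by rewrite /= lte_fin invr_gt0.
case=> n0 _ small.
exists (2^-1 * m%:R * C + C), n0; split.
  by rewrite ltr_wpDl// !mulr_ge0// ltW.
move=> n n0n x Kx vx lap.
have lt := small n n0n; have ge0 := mesh_size_ge0 (T n).
have rE : (mesh_size (T n) = (fine (mesh_size (T n)))%:E)%E.
  by rewrite fineK// ge0_fin_numE// (lt_trans lt)// ltry.
set r := fine _ in rE; rewrite rE -EFin_expe -EFinM lee_fin.
apply: (@le_trans _ _ (2^-1 * m%:R * C * r ^+ 2)); last first.
  by rewrite ler_wpM2r ?sqr_ge0// lerDl ltW.
apply: (discrete_energy_close (T_mesh n) C0 vx lap (KC x Kx)).
  by move=> y xy; rewrite -lee_fin -rE; exact: edge_vector_le_mesh_size.
by rewrite -lte_fin -rE.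
Qed.
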